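(* Let $(M,\phi,\xi,\eta,g)$ be a nearly Kenmotsu manifold and let $H$ be the $(1,1)$-tensor field on $M$ defined by $d\eta(X,Y)=g(HX,Y)$ for all vector fields $X,Y$. Then $H=0$, and the distribution $D=\ker\eta$ is completely integrable.
   Context: All objects are smooth ($C^\infty$) and manifolds are connected. An almost contact metric structure on a $(2n+1)$-dimensional manifold $M$ is a quadruple $(\phi,\xi,\eta,g)$ consisting of a $(1,1)$-tensor field $\phi$, a vector field $\xi$, a one-form $\eta$ and a Riemannian metric $g$ such that $\phi^2=-\mathrm{Id}+\eta\otimes\xi$, $\eta(\xi)=1$ and $g(\phi X,\phi Y)=g(X,Y)-\eta(X)\eta(Y)$ for all vector fields $X,Y$; then $\eta(X)=g(X,\xi)$, $\phi\xi=0$, $\eta\circ\phi=0$ and $g(X,\phi Y)+g(\phi X,Y)=0$. Let $\nabla$ be the Levi-Civita connection of $g$. The almost contact metric manifold $(M,\phi,\xi,\eta,g)$ is called nearly Kenmotsu if $(\nabla_X\phi)Y+(\nabla_Y\phi)X=-\eta(Y)\phi X-\eta(X)\phi Y$ for all vector fields $X,Y$. *)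

(* Defs.v *)
From HB Require Import structures.
From mathcomp Require Import all_boot all_order all_algebra.
From mathcomp Require Import all_classical all_reals all_analysis.
Set Implicit Arguments. Unset Strict Implicit. Unset Printing Implicit Defensive.
Import Order.TTheory GRing.Theory Num.Theory.
Import numFieldNormedType.Exports.
Local Open Scope classical_set_scope.
Local Open Scope ring_scope.

Section Euclidean.
Context {R : realType} {m : nat}.
Implicit Types (U : set 'rV[R]_m) (f g : 'rV[R]_m -> R).

(* All partial derivatives of order at most k exist and are continuous on U. *)
Fixpoint Ck (k : nat) U f : Prop :=
  (forall x, U x -> {for x, continuous f}) /\
  if k is k'.+1 then
    forall i : 'I_m, (forall x, U x -> derivable f x (delta_mx 0 i)) /\
      Ck k' U (fun x => 'D_(delta_mx 0 i) f x)
  else True.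

Definition smooth_on U f := forall k, Ck k U f.

Lemma Ck_ext k U f g : open U -> (forall x, U x -> f x = g x) ->
  Ck k U f -> Ck k U g.
Proof.
move=> oU; elim: k f g => [|k IH] f g fg /= [cf H].
  split=> // x Ux; have nfg : {near x, f =1 g}.
    by apply: filterS (open_nbhs_nbhs (conj oU Ux)) => y /fg.
  rewrite /prop_for /continuous_at -(fg x Ux).
  exact: cvg_trans (near_eq_cvg nfg) (cf x Ux).
have nfg x : U x -> {near x, f =1 g}.
  by move=> Ux; apply: filterS (open_nbhs_nbhs (conj oU Ux)) => y /fg.
split=> [x Ux|i].
  rewrite /prop_for /continuous_at -(fg x Ux).
  exact: cvg_trans (near_eq_cvg (nfg x Ux)) (cf x Ux).
have [df cdf] := H i; split=> [x Ux|].
  exact: near_eq_derivable (nfg x Ux) (df x Ux).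
by apply: IH cdf => x Ux; apply: near_eq_derive; exact: nfg.
Qed.

Lemma Ck_cst k U (a : R) : Ck k U (fun=> a).
Proof.
elim: k a => [|k IH] a /=; first by split=> // x _; exact: cst_continuous.
split=> [x _|i]; first exact: cst_continuous.
split=> [x _|]; first exact: derivable_cst.
by under eq_fun do rewrite derive_cst.
Qed.

Lemma CkW k U f : Ck k.+1 U f -> Ck k U f.
Proof.
elim: k f => [|k IH] f; first by case.
by move=> [cf H]; split=> // i; have [df /IH] := H i.
Qed.

Lemma CkD k U f g : open U -> Ck k U f -> Ck k U g ->
  Ck k U (fun x => f x + g x).
Proof.
move=> oU; elim: k f g => [|k IH] f g /= [cf Hf] [cg Hg].
  by split=> // x Ux; exact: continuousD (cf x Ux) (cg x Ux).
split=> [x Ux|i]; first exact: continuousD (cf x Ux) (cg x Ux).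
have [df ddf] := Hf i; have [dg ddg] := Hg i; split=> [x Ux|].
  by apply: derivableD; [exact: df|exact: dg].
apply: Ck_ext (IH _ _ ddf ddg) => // x Ux.
by rewrite -deriveD//; [exact: df|exact: dg].
Qed.

Lemma CkM k U f g : open U -> Ck k U f -> Ck k U g ->
  Ck k U (fun x => f x * g x).
Proof.
move=> oU; elim: k f g => [|k IH] f g Hf Hg.
  by split=> // x Ux; exact: continuousM (Hf.1 x Ux) (Hg.1 x Ux).
split=> [x Ux|i]; first exact: continuousM (Hf.1 x Ux) (Hg.1 x Ux).
have [df ddf] := Hf.2 i; have [dg ddg] := Hg.2 i; split=> [x Ux|].
  by apply: derivableM; [exact: df|exact: dg].
apply: Ck_ext (CkD oU (IH _ _ (CkW Hf) ddg) (IH _ _ (CkW Hg) ddf)) => // x Ux.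
by rewrite deriveM//; [exact: df|exact: dg].
Qed.

End Euclidean.

Section Charts.
Context {R : realType} (T : topologicalType) (m : nat).

(* chart_inv is total; only its values on the image of the domain matter. *)
Record chart := Chart {
  chart_dom : set T;
  chart_map :> T -> 'rV[R]_m;
  chart_inv : 'rV[R]_m -> T;
  chart_dom_open : open chart_dom;
  chart_im_open : open (chart_map @` chart_dom);
  chart_mapK : forall p, chart_dom p -> chart_inv (chart_map p) = p;
  chart_cont : {within chart_dom, continuous chart_map};
  chart_inv_cont : {within chart_map @` chart_dom, continuous chart_inv} }.

Definition chart_im (c : chart) : set 'rV[R]_m := c @` chart_dom c.

Definition smooth_transition (c c' : chart) := forall j,
  smooth_on (c @` (chart_dom c `&` chart_dom c'))
    (fun x => c' (chart_inv c x) 0 j).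

End Charts.

(* Connected smooth manifolds of dimension m, with their maximal atlas. *)
Record manifold (R : realType) (m : nat) := Manifold {
  mfd_space :> topologicalType;
  mfd_hausdorff : hausdorff_space mfd_space;
  mfd_second_countable : @second_countable mfd_space;
  mfd_connected : connected [set: mfd_space];
  atlas : set (@chart R mfd_space m);
  atlas_cover : forall p, exists2 c, atlas c & chart_dom c p;
  atlas_smooth : forall c c', atlas c -> atlas c' -> smooth_transition c c';
  atlas_max : forall c,
    (forall c', atlas c' -> smooth_transition c c' /\ smooth_transition c' c) ->
    atlas c }.

Section SmoothFunctions.
Context {R : realType} {m : nat} (M : manifold R m).

Definition is_smooth (f : M -> R) : Prop := forall c, @atlas R m M c ->
  smooth_on (chart_im c) (f \o chart_inv c).

Definition smooth_pred : {pred (M -> R)} := [pred f | `[< is_smooth f >]].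

Record smooth_fun := SmoothFun {
  smooth_fun_val :> M -> R;
  smooth_fun_prop : smooth_fun_val \in smooth_pred }.

HB.instance Definition _ := [isSub for smooth_fun_val].
HB.instance Definition _ := [Choice of smooth_fun by <:].

Lemma is_smooth_cst (a : R) : (fun=> a) \in smooth_pred.
Proof. by apply/asboolP => c _ k; exact: Ck_cst. Qed.

Lemma smooth_subring_closed : subring_closed smooth_pred.
Proof.
split=> [|f g /asboolP sf /asboolP sg|f g /asboolP sf /asboolP sg].
- exact: is_smooth_cst.
- apply/asboolP => c ac k; have o := @chart_im_open _ _ _ c.
  have := CkD o (sf c ac k) (CkM o (Ck_cst k _ (-1)) (sg c ac k)).
  by apply: Ck_ext => // x _ /=; rewrite mulN1r.
- apply/asboolP => c ac k; have o := @chart_im_open _ _ _ c.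
  exact: CkM o (sf c ac k) (sg c ac k).
Qed.

HB.instance Definition _ := GRing.SubChoice_isSubComPzRing.Build
  (M -> R) smooth_pred smooth_fun smooth_subring_closed.

Definition smooth_cst (a : R) : smooth_fun := SmoothFun (is_smooth_cst a).

End SmoothFunctions.

Section VectorFields.
Context {R : realType} {m : nat} (M : manifold R m).
Implicit Types f h : smooth_fun M.

(* Vector fields are the R-linear derivations of the algebra of smooth
   functions; tensor fields are accordingly the maps that are linear over
   smooth functions. *)
Record vfield := VField {
  vfield_fun :> smooth_fun M -> smooth_fun M;
  vfield_linear : forall (a : R) f h,
    vfield_fun (smooth_cst M a * f + h) =
    smooth_cst M a * vfield_fun f + vfield_fun h;
  vfield_leibniz : forall f h,
    vfield_fun (f * h) = vfield_fun f * h + f * vfield_fun h }.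

HB.instance Definition _ := gen_eqMixin vfield.
HB.instance Definition _ := gen_choiceMixin vfield.

Lemma vfieldP (X Y : vfield) : (forall f, X f = Y f) -> X = Y.
Proof.
case: X Y => [X lX dX] [Y lY dY] /= /funext XY; rewrite -XY in lY dY *.
by congr VField; exact: Prop_irrelevance.
Qed.

Lemma vfieldD (X : vfield) f h : X (f + h) = X f + X h.
Proof.
have one : smooth_cst M 1 = 1 by apply/val_inj.
by have := vfield_linear X 1 f h; rewrite one !mul1r.
Qed.

Fact vfield_zero_linear (a : R) f h (F := fun f => 0 : smooth_fun M) :
  F (smooth_cst M a * f + h) = smooth_cst M a * F f + F h.
Proof. by rewrite /F mulr0 addr0. Qed.
Fact vfield_zero_leibniz f h (F := fun f => 0 : smooth_fun M) :
  F (f * h) = F f * h + f * F h.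
Proof. by rewrite /F mulr0 mul0r addr0. Qed.
Definition vfield_zero : vfield :=
  VField vfield_zero_linear vfield_zero_leibniz.

Fact vfield_opp_linear (X : vfield) (a : R) f h (F := fun f => - X f) :
  F (smooth_cst M a * f + h) = smooth_cst M a * F f + F h.
Proof. by rewrite /F vfield_linear opprD mulrN. Qed.
Fact vfield_opp_leibniz (X : vfield) f h (F := fun f => - X f) :
  F (f * h) = F f * h + f * F h.
Proof. by rewrite /F vfield_leibniz opprD mulNr mulrN. Qed.
Definition vfield_opp (X : vfield) : vfield :=
  VField (vfield_opp_linear X) (vfield_opp_leibniz X).

Fact vfield_add_linear (X Y : vfield) (a : R) f h (F := fun f => X f + Y f) :
  F (smooth_cst M a * f + h) = smooth_cst M a * F f + F h.
Proof. by rewrite /F !vfield_linear mulrDr addrACA. Qed.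
Fact vfield_add_leibniz (X Y : vfield) f h (F := fun f => X f + Y f) :
  F (f * h) = F f * h + f * F h.
Proof. by rewrite /F !vfield_leibniz mulrDl mulrDr addrACA. Qed.
Definition vfield_add (X Y : vfield) : vfield :=
  VField (vfield_add_linear X Y) (vfield_add_leibniz X Y).

Fact vfield_scale_linear (u : smooth_fun M) (X : vfield) (a : R) f h
    (F := fun f => u * X f) :
  F (smooth_cst M a * f + h) = smooth_cst M a * F f + F h.
Proof. by rewrite /F vfield_linear mulrDr mulrCA. Qed.
Fact vfield_scale_leibniz (u : smooth_fun M) (X : vfield) f h
    (F := fun f => u * X f) :
  F (f * h) = F f * h + f * F h.
Proof. by rewrite /F vfield_leibniz mulrDr mulrA (mulrCA u f). Qed.
Definition vfield_scale (u : smooth_fun M) (X : vfield) : vfield :=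
  VField (vfield_scale_linear u X) (vfield_scale_leibniz u X).

Fact vfield_addA : associative vfield_add.
Proof. by move=> X Y Z; apply: vfieldP => f /=; rewrite addrA. Qed.
Fact vfield_addC : commutative vfield_add.
Proof. by move=> X Y; apply: vfieldP => f /=; rewrite addrC. Qed.
Fact vfield_add0 : left_id vfield_zero vfield_add.
Proof. by move=> X; apply: vfieldP => f /=; rewrite add0r. Qed.
Fact vfield_addN : left_inverse vfield_zero vfield_opp vfield_add.
Proof. by move=> X; apply: vfieldP => f /=; rewrite addNr. Qed.

HB.instance Definition _ := GRing.isZmodule.Build vfield
  vfield_addA vfield_addC vfield_add0 vfield_addN.

Fact vfield_scaleA u v X :
  vfield_scale u (vfield_scale v X) = vfield_scale (u * v) X.
Proof. by apply: vfieldP => f /=; rewrite mulrA. Qed.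
Fact vfield_scale1 : left_id 1 vfield_scale.
Proof. by move=> X; apply: vfieldP => f /=; rewrite mul1r. Qed.
Fact vfield_scaleDr : right_distributive vfield_scale +%R.
Proof. by move=> u X Y; apply: vfieldP => f /=; rewrite mulrDr. Qed.
Fact vfield_scaleDl X : {morph vfield_scale^~ X : u v / u + v}.
Proof. by move=> u v; apply: vfieldP => f /=; rewrite mulrDl. Qed.

HB.instance Definition _ := GRing.Zmodule_isLmodule.Build
  (smooth_fun M) vfield
  vfield_scaleA vfield_scale1 vfield_scaleDr vfield_scaleDl.

Fact lie_bracket_linear (X Y : vfield) (a : R) f h
    (F := fun f => X (Y f) - Y (X f)) :
  F (smooth_cst M a * f + h) = smooth_cst M a * F f + F h.
Proof. by rewrite /F !vfield_linear mulrBr opprD addrACA. Qed.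
Fact lie_bracket_leibniz (X Y : vfield) f h
    (F := fun f => X (Y f) - Y (X f)) :
  F (f * h) = F f * h + f * F h.
Proof.
rewrite /F !vfield_leibniz !vfieldD !vfield_leibniz mulrBl mulrBr.
have lem (V : zmodType) (a b c d e k : V) :
    (a + b + (c + d)) - (e + c + (b + k)) = a - e + (d - k).
  rewrite (addrC a b) (addrACA b) (addrC e c) (addrACA c) (addrC c b).
  by rewrite (opprD (b + c)) (addrACA (b + c)) subrr add0r opprD addrACA.
exact: lem.
Qed.
Definition lie_bracket (X Y : vfield) : vfield :=
  VField (lie_bracket_linear X Y) (lie_bracket_leibniz X Y).

End VectorFields.

Section Tensors.
Context {R : realType} {m : nat} (M : manifold R m).

Definition oneform := {linear vfield M -> (smooth_fun M)^o}.
Definition tensor11 := {linear vfield M -> vfield M}.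

(* The convention without the factor 1/2 *)
Definition ext_deriv (eta : oneform) (X Y : vfield M) : smooth_fun M :=
  X (eta Y) - Y (eta X) - eta (lie_bracket X Y).

Record riemannian_metric := RiemannianMetric {
  metric :> vfield M -> vfield M -> smooth_fun M;
  metric_sym : forall X Y, metric X Y = metric Y X;
  metric_linear : forall (f : smooth_fun M) X Y Z,
    metric (f *: X + Y) Z = f * metric X Z + metric Y Z;
  (* [exists f, X f p != 0] says that the tangent vector X_p is nonzero. *)
  metric_pos : forall (X : vfield M) (p : M),
    (exists f, X f p != 0) -> 0 < metric X X p }.

Record levi_civita (g : riemannian_metric) := LeviCivita {
  nabla :> vfield M -> vfield M -> vfield M;
  nabla_linear : forall (f : smooth_fun M) X Y Z,
    nabla (f *: X + Y) Z = f *: nabla X Z + nabla Y Z;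
  nabla_add : forall X Y Z, nabla X (Y + Z) = nabla X Y + nabla X Z;
  nabla_leibniz : forall (f : smooth_fun M) (X Y : vfield M),
    nabla X (f *: Y) = X f *: Y + f *: nabla X Y;
  nabla_torsion_free : forall X Y, nabla X Y - nabla Y X = lie_bracket X Y;
  nabla_metric : forall X Y Z : vfield M,
    X (g Y Z) = g (nabla X Y) Z + g Y (nabla X Z) }.

(* (nabla_X phi) Y *)
Definition cov_deriv11 (g : riemannian_metric) (D : levi_civita g)
    (phi : tensor11) (X Y : vfield M) : vfield M :=
  D X (phi Y) - phi (D X Y).

Record almost_contact_metric (phi : tensor11) (xi : vfield M) (eta : oneform)
    (g : riemannian_metric) : Prop := AlmostContactMetric {
  acm_phi2 : forall X, phi (phi X) = - X + (eta X : smooth_fun M) *: xi;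
  acm_eta_xi : eta xi = 1;
  acm_compat : forall X Y, g (phi X) (phi Y) = g X Y - eta X * eta Y }.

Definition nearly_kenmotsu (phi : tensor11) (eta : oneform)
    (g : riemannian_metric) (D : levi_civita g) : Prop :=
  forall X Y, cov_deriv11 D phi X Y + cov_deriv11 D phi Y X =
    - ((eta Y : smooth_fun M) *: phi X) - (eta X : smooth_fun M) *: phi Y.

(* Tangent vectors at q are represented by functionals on smooth functions; a
   distribution is given by its fibres. *)
Definition distribution := forall q : M, set (smooth_fun M -> R).

Definition ker_oneform (eta : oneform) : distribution := fun q =>
  [set v | exists X : vfield M,
     (eta X : smooth_fun M) q = 0 /\ v = (fun f => X f q)].

(* The i-th coordinate vector of the chart c at the point q *)
Definition coord_vector (c : chart M m) (i : 'I_m) (q : M) :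
    smooth_fun M -> R :=
  fun f => 'D_(delta_mx 0 i) (f \o chart_inv c) (c q).

(* Every point lies in a flat chart: one on whose domain the distribution is
   spanned by the first k coordinate vectors. *)
Definition completely_integrable (k : nat) (D : distribution) : Prop :=
  forall p : M, exists c, [/\ @atlas R m M c, chart_dom c p &
    forall q, chart_dom c q ->
      D q = [set v | exists a : 'I_m -> R,
        v = (fun f => \sum_(i < m | (i < k)%N) a i * coord_vector c i q f)]].

End Tensors.

(* Main.v *)
Require Import Defs.
From HB Require Import structures.
From mathcomp Require Import all_boot all_order all_algebra.
From mathcomp Require Import all_classical all_reals all_analysis.
From mathcomp Require Import perm ring lra.
Set Implicit Arguments.
Unset Strict Implicit.
Unset Printing Implicit Defensive.
Import Order.TTheory GRing.Theory Num.Theory.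
Import numFieldNormedType.Exports.
Local Open Scope ring_scope.

(* Write nabla_X xi = X - eta(X) xi + h X. The defining identity makes h skew and
   anticommuting with phi, with d eta (X, Y) = 2 g(h X, Y). Differentiating
   h phi + phi h = 0, and comparing the symmetrized curvature [R(X, xi), phi] with
   the expression of R(., .) xi through nabla h, one finds
     (nabla_X h) Y = g(h X + h^2 X, Y) xi - eta(Y) (h X + h^2 X) - 2 eta(X) h Y.
   Hence t = tr h^2 satisfies dt = - 4 t eta, so that t d eta = 0. Where t is not
   zero this gives h = 0, and where t = 0 positivity of g gives h = 0.
   So eta is closed, and by the Poincare lemma it is locally du. As eta(xi) = 1, u
   can replace one coordinate of a chart, and ker eta is spanned by the others. *)

(** * Nearly Kenmotsu structures on Lie-Rinehart algebras *)

(** The obstacle is nabla h: curvature yields only symmetrized combinations of it, mixed with nabla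
    phi. Both derivatives are therefore corrected to the transverse tensors [Qerr] and [Pform],
    which satisfy a linear system at each point. In that system [Pform X Y (h Z)] becomes cyclically
    invariant, while carrying phi once round the cycle changes its sign; so it vanishes, and [Qerr]
    with it. The constant 4 arises because each factor of h^2 contributes - 2 eta(X) to the
    derivative of t, the other terms of nabla h being traceless against h, as h xi = 0 and eta o h =
    0. In d(dt) = 0 the product of dt with eta drops out, since dt is itself a multiple of eta.
    Where t = 0, skewness matters: in an orthonormal basis t is minus the sum of the squares of the
    entries of h. The identities involve only derivations, metric and connection, hence the abstract
    algebra; they are checked at points, as linear arithmetic over the reals. Vector fields are
    derivations of global functions, so local frames enter only after multiplication by cutoffs. *)

(* A Lie-Rinehart algebra with a nondegenerate metric and its Levi-Civita
   connection; the bracket of X and Y is [conn X Y - conn Y X]. The ring of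
   functions K is separated by real-valued points. *)
Record metric_calculus (R : realFieldType) (K : comPzRingType)
    (V : lmodType K) := MetricCalculus {
  point : Type;
  ev : point -> K -> R;
  evD : forall p, {morph ev p : a b / a + b};
  evM : forall p, {morph ev p : a b / a * b};
  ev1 : forall p, ev p 1 = 1;
  ev_inj : forall a b, (forall p, ev p a = ev p b) -> a = b;
  der : V -> K -> K;
  der_linear : forall f X Y h, der (f *: X + Y) h = f * der X h + der Y h;
  derD : forall X f h, der X (f + h) = der X f + der X h;
  derM : forall X f h, der X (f * h) = der X f * h + f * der X h;
  dot : V -> V -> K;
  dotC : forall X Y, dot X Y = dot Y X;
  dot_linear : forall f X Y Z, dot (f *: X + Y) Z = f * dot X Z + dot Y Z;
  dot_inj : forall X Y, (forall Z, dot X Z = dot Y Z) -> X = Y;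
  conn : V -> V -> V;
  conn_linear : forall f X Y Z,
    conn (f *: X + Y) Z = f *: conn X Z + conn Y Z;
  connDr : forall X Y Z, conn X (Y + Z) = conn X Y + conn X Z;
  connZr : forall f X Y, conn X (f *: Y) = der X f *: Y + f *: conn X Y;
  conn_dot : forall X Y Z,
    der X (dot Y Z) = dot (conn X Y) Z + dot Y (conn X Z);
  der_bracket : forall X Y f,
    der (conn X Y - conn Y X) f = der X (der Y f) - der Y (der X f);
  jacobi : forall X Y Z (br := fun X Y => conn X Y - conn Y X),
    br X (br Y Z) + br Y (br Z X) + br Z (br X Y) = 0 }.

Section Calculus.
Context {R : realFieldType} {K : comPzRingType} {V : lmodType K}.
Context {c : metric_calculus R V}.
Implicit Types (f h : K) (X Y Z W : V) (p : point c).
Local Notation g := (dot c).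
Local Notation D := (conn c).

Lemma ev0 p : ev p 0 = 0.
Proof. by apply: (addrI (ev p 0)); rewrite -evD !addr0. Qed.
Lemma evN p f : ev p (- f) = - ev p f.
Proof. by apply: (addrI (ev p f)); rewrite -evD !subrr ev0. Qed.
Lemma ev2 p : ev p 2 = 2.
Proof. by rewrite evD ev1. Qed.
Definition evE p := (evD p, evN p, evM p, ev0 p, ev1 p, ev2 p).

Lemma derDl X Y f : der c (X + Y) f = der c X f + der c Y f.
Proof. by have := der_linear c 1 X Y f; rewrite scale1r mul1r. Qed.
Lemma der0l f : der c 0 f = 0.
Proof. by apply: (addrI (der c 0 f)); rewrite -derDl !addr0. Qed.
Lemma derZl h X f : der c (h *: X) f = h * der c X f.
Proof. by have := der_linear c h X 0 f; rewrite der0l !addr0. Qed.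
Lemma derNl X f : der c (- X) f = - der c X f.
Proof. by rewrite -scaleN1r derZl mulN1r. Qed.
Lemma der0 X : der c X 0 = 0.
Proof. by apply: (addrI (der c X 0)); rewrite -derD !addr0. Qed.
Lemma derN X f : der c X (- f) = - der c X f.
Proof. by apply: (addrI (der c X f)); rewrite -derD !subrr der0. Qed.
Lemma der1 X : der c X 1 = 0.
Proof.
have := derM c X 1 1; rewrite !mulr1 mul1r => e.
by apply: (addrI (der c X 1)); rewrite -e addr0.
Qed.

Lemma dotDl X Y Z : g (X + Y) Z = g X Z + g Y Z.
Proof. by have := dot_linear c 1 X Y Z; rewrite scale1r mul1r. Qed.
Lemma dot0l Z : g 0 Z = 0.
Proof. by apply: (addrI (g 0 Z)); rewrite -dotDl !addr0. Qed.
Lemma dotZl f X Z : g (f *: X) Z = f * g X Z.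
Proof. by have := dot_linear c f X 0 Z; rewrite dot0l !addr0. Qed.
Lemma dotNl X Z : g (- X) Z = - g X Z.
Proof. by rewrite -scaleN1r dotZl mulN1r. Qed.
Lemma dotDr X Y Z : g Z (X + Y) = g Z X + g Z Y.
Proof. by rewrite !(dotC c Z) dotDl. Qed.
Lemma dot0r Z : g Z 0 = 0.
Proof. by rewrite dotC dot0l. Qed.
Lemma dotZr f X Z : g Z (f *: X) = f * g Z X.
Proof. by rewrite !(dotC c Z) dotZl. Qed.
Lemma dotNr X Z : g Z (- X) = - g Z X.
Proof. by rewrite !(dotC c Z) dotNl. Qed.
Definition dotE := (dotDl, dotDr, dotNl, dotNr, dotZl, dotZr, dot0l, dot0r).

Lemma conn0l Z : D 0 Z = 0.
Proof.
have := conn_linear c 1 0 0 Z; rewrite !scale1r addr0 => h.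
by apply: (addrI (D 0 Z)); rewrite -h addr0.
Qed.
Lemma connDl X Y Z : D (X + Y) Z = D X Z + D Y Z.
Proof. by have := conn_linear c 1 X Y Z; rewrite !scale1r. Qed.
Lemma connZl f X Z : D (f *: X) Z = f *: D X Z.
Proof. by have := conn_linear c f X 0 Z; rewrite conn0l !addr0. Qed.
Lemma connNl X Z : D (- X) Z = - D X Z.
Proof. by rewrite -scaleN1r connZl scaleN1r. Qed.
Lemma conn0r X : D X 0 = 0.
Proof. by apply: (addrI (D X 0)); rewrite -connDr !addr0. Qed.
Lemma connNr X Z : D X (- Z) = - D X Z.
Proof. by apply: (addrI (D X Z)); rewrite -connDr !subrr conn0r. Qed.

Lemma conn_dotl X Y Z : g (D X Y) Z = der c X (g Y Z) - g Y (D X Z).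
Proof. by rewrite conn_dot addrK. Qed.

End Calculus.

Ltac pointwise p H := move: (f_equal (ev p) H);
  rewrite ?(evD, evN, evM, ev0, ev1, ev2).
Record contact_calculus (R : realFieldType) (K : comPzRingType)
    (V : lmodType K) := ContactCalculus {
  base :> metric_calculus R V;
  phi : V -> V;
  phiD : {morph phi : X Y / X + Y};
  phiZ : forall f X, phi (f *: X) = f *: phi X;
  xi : V;
  eta : V -> K;
  etaD : {morph eta : X Y / X + Y};
  etaZ : forall f X, eta (f *: X) = f * eta X;
  phi2 : forall X, phi (phi X) = - X + eta X *: xi;
  eta_xi : eta xi = 1;
  dot_phi : forall X Y,
    dot base (phi X) (phi Y) = dot base X Y - eta X * eta Y;
  nearly : forall X Y,
    conn base X (phi Y) - phi (conn base X Y) +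
    (conn base Y (phi X) - phi (conn base Y X)) =
    - (eta Y *: phi X) - eta X *: phi Y }.

(** [pwring] settles an identity in [K] at each point, [vring] an identity in [V] after pairing with
    an arbitrary vector; both end in ring identities over the field [R]. *)
Ltac pwring := match goal with c : contact_calculus _ _ |- _ =>
  let p := fresh "p" in apply: (ev_inj (m := c)) => p;
  rewrite ?(evD, evN, evM, ev0, ev1, ev2); ring end.
Ltac vring := match goal with c : contact_calculus _ _ |- _ =>
  let Z := fresh "Z" in apply: (dot_inj (m := c)) => Z;
  rewrite !dotE; pwring end.

(** * The shape operator of xi and its symmetries *)

Section Shape.
Context {R : realFieldType} {K : comPzRingType} {V : lmodType K}.
Context {c : contact_calculus R V}.
Implicit Types (f : K) (X Y Z W : V) (p : point c).
Local Notation g := (dot c).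
Local Notation D := (conn c).
Local Notation phi := (phi c).
Local Notation xi := (xi c).
Local Notation eta := (eta c).

Lemma eta0 : eta 0 = 0.
Proof. by apply: (addrI (eta 0)); rewrite -etaD !addr0. Qed.
Lemma etaN X : eta (- X) = - eta X.
Proof. by rewrite -scaleN1r etaZ mulN1r. Qed.
Lemma phi0 : phi 0 = 0.
Proof. by apply: (addrI (phi 0)); rewrite -phiD !addr0. Qed.
Lemma phiN X : phi (- X) = - phi X.
Proof. by rewrite -scaleN1r phiZ scaleN1r. Qed.
Definition tensorE := (phiD c, phiZ c, phiN, phi0, etaD c, etaZ c, etaN, eta0).

(** Since phi^2 xi = 0, computing phi^3 xi gives phi xi = a xi with a = eta(phi xi). Another phi
    gives a^2 = 0, and a = 0 because points take values in a field. *)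
Lemma phi_xi : phi xi = 0.
Proof.
have e2 : phi (phi xi) = 0 by rewrite phi2 eta_xi scale1r addNr.
have := phi2 c (phi xi); rewrite e2 phi0 => /esym/eqP.
rewrite addrC subr_eq0 => /eqP phixi.
have h : eta (phi xi) * eta (phi xi) = 0.
  have : phi (eta (phi xi) *: xi) = 0 by rewrite phixi.
  rewrite phiZ -phixi scalerA => /(congr1 eta).
  by rewrite !etaZ eta_xi mulr1 eta0 mulr1.
rewrite -phixi (_ : eta (phi xi) = 0) ?scale0r//.
apply: (ev_inj (m := c)) => p; move: (f_equal (ev p) h).
by rewrite evM ev0 => /eqP; rewrite mulf_eq0 orbb => /eqP.
Qed.

Lemma dot_xi X : g X xi = eta X.
Proof.
have := dot_phi c X xi; rewrite phi_xi dot0r eta_xi.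
by rewrite mulr1 => /esym/eqP; rewrite subr_eq0 => /eqP.
Qed.
Lemma dot_xil X : g xi X = eta X.
Proof. by rewrite dotC dot_xi. Qed.

(** Expand phi^3 X by applying phi^2 = - Id + eta xi to the outer or to the inner pair, and
    compare. *)
Lemma eta_phi X : eta (phi X) = 0.
Proof.
have := phi2 c (phi X); rewrite {1}(phi2 c X) phiD phiN phiZ phi_xi.
rewrite scaler0 addr0 => /eqP; rewrite addrC -subr_eq subrr => /eqP h.
by have := congr1 eta (esym h); rewrite etaZ eta_xi mulr1 => ->; rewrite eta0.
Qed.

Lemma phi_skew X Y : g (phi X) Y = - g X (phi Y).
Proof.
have := dot_phi c X (phi Y); rewrite eta_phi mulr0 subr0 => <-.
rewrite phi2 dotDr dotNr dotZr dot_xi eta_phi mulr0 addr0.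
by rewrite opprK.
Qed.

(** The value (nabla_X phi) Y, locked so that rewriting by linearity leaves it whole and [lra] can
    treat it as an unknown. *)
Definition covphi X Y := locked (D X (phi Y) - phi (D X Y)).
Lemma covphiE X Y : covphi X Y = D X (phi Y) - phi (D X Y).
Proof. by rewrite /covphi -lock. Qed.
Local Notation P := covphi.
Local Notation A X := (D X xi).

Lemma eta_A X : eta (A X) = 0.
Proof.
have := conn_dot c X xi xi; rewrite dot_xi dot_xil eta_xi der1 !dot_xi => h.
by apply: (ev_inj (m := c)) => p; pointwise p h => h'; lra.
Qed.

Lemma eta_conn X Y : eta (D X Y) = der c X (eta Y) - g Y (A X).
Proof. by rewrite -!dot_xi conn_dotl. Qed.

Lemma covphi_xi X : P X xi = - phi (A X).
Proof. by rewrite !covphiE phi_xi conn0r add0r. Qed.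

(** At (xi, xi) the nearly Kenmotsu identity reads - 2 phi (nabla_xi xi) = 0, and phi^2 acts as - Id
    on nabla_xi xi, which is orthogonal to xi. *)
Lemma conn_xi_xi : A xi = 0.
Proof.
have h : phi (A xi) = 0.
  have := nearly c xi xi; rewrite !phi_xi scaler0 oppr0 addr0 conn0r => h.
  apply: (dot_inj (m := c)) => Z; have := f_equal (dot c ^~ Z) h.
  rewrite /= !dotE => h'; apply: (ev_inj (m := c)) => p.
  by pointwise p h' => h''; lra.
have := phi2 c (A xi); rewrite h phi0 eta_A scale0r addr0.
by move/eqP; rewrite eq_sym oppr_eq0 => /eqP.
Qed.

Lemma covphi_xil X : P xi X = phi (A X) - phi X.
Proof.
have := nearly c X xi; rewrite -!covphiE covphi_xi !phi_xi scaler0 subr0 eta_xi.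
by rewrite scale1r => /(canRL (addKr _)); rewrite opprK.
Qed.

Lemma covphi_skew X Y Z : g (P X Y) Z = - g Y (P X Z).
Proof.
rewrite !covphiE !dotE !phi_skew !conn_dotl !phi_skew.
have -> : g Y (D X (phi Z)) = der c X (g Y (phi Z)) - g (D X Y) (phi Z).
  by rewrite conn_dotl opprB addrC subrK.
have -> : g Y (phi (D X Z)) = - g (phi Y) (D X Z) by rewrite phi_skew opprK.
by rewrite conn_dotl derN; pwring.
Qed.

(** The covariant derivative along X of phi^2 = - Id + eta xi. *)
Lemma covphi_phi X Y :
  P X (phi Y) + phi (P X Y) = g Y (A X) *: xi + eta Y *: A X.
Proof. by rewrite !covphiE !tensorE !phi2 connDr connNr connZr eta_conn; vring. Qed.

(** On a Kenmotsu manifold nabla_X xi = X - eta(X) xi; this is the deviation from that value. *)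
Definition shape X := locked (A X - X + eta X *: xi).
Lemma shapeE X : shape X = A X - X + eta X *: xi.
Proof. by rewrite /shape -lock. Qed.
Local Notation h := shape.

Lemma shapeD X Y : h (X + Y) = h X + h Y.
Proof. by rewrite !shapeE connDl !tensorE; vring. Qed.
Lemma shapeZ f X : h (f *: X) = f *: h X.
Proof. by rewrite !shapeE connZl !tensorE; vring. Qed.
Lemma shapeN X : h (- X) = - h X.
Proof. by rewrite -scaleN1r shapeZ scaleN1r. Qed.
Lemma conn_xiE X : A X = h X + X - eta X *: xi.
Proof. by rewrite shapeE; vring. Qed.

Lemma eta_shape X : eta (h X) = 0.
Proof. by rewrite !shapeE !tensorE eta_A eta_xi; pwring. Qed.

Lemma shape_xi : h xi = 0.
Proof. by rewrite !shapeE conn_xi_xi eta_xi scale1r add0r addNr. Qed.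

(** Along xi the right-hand side of [covphi_phi] vanishes and nabla_xi phi is phi h. Hence phi h phi
    = - phi^2 h = h, and one more phi gives the anticommutation. *)
Lemma shape_phi X : h (phi X) = - phi (h X).
Proof.
have := covphi_phi xi X; rewrite conn_xi_xi dot0r !covphi_xil scale0r scaler0.
rewrite addr0 !conn_xiE !tensorE !eta_phi !phi_xi !phi2.
rewrite !tensorE ?eta_shape.
rewrite ?phi_xi ?scaler0 ?scale0r => h0.
have h1 : phi (h (phi X)) = h X.
  apply: (dot_inj (m := c)) => Z; have := f_equal (dot c ^~ Z) h0.
  rewrite /= !dotE => h'; apply: (ev_inj (m := c)) => p.
  by pointwise p h' => h''; lra.
have := phi2 c (h (phi X)); rewrite h1 eta_shape scale0r addr0 => ->.
by rewrite opprK.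
Qed.

(** As the derivative of a skew tensor, nabla_xi phi = phi h is skew; with the anticommutation, h is
    skew on the image of phi. The remaining direction xi is killed by h and orthogonal to its
    image. *)
Lemma shape_skew X Y : g (h X) Y = - g X (h Y).
Proof.
have sk U W : g (h (phi U)) W = - g (phi U) (h W).
  have := covphi_skew xi U W.
  rewrite !covphi_xil !conn_xiE !tensorE !phi_xi !dotE shape_phi.
  rewrite !dotE !phi_skew => h0; apply: (ev_inj (m := c)) => p.
  by pointwise p h0 => h'; lra.
have := sk (phi X) Y; rewrite !phi2 shapeD shapeN shapeZ shape_xi !dotE.
rewrite dot_xil eta_shape => h0; apply: (ev_inj (m := c)) => p.
by pointwise p h0 => h'; lra.
Qed.

(** The part X - eta(X) xi of nabla xi is self-adjoint and cancels; the skew part h is counted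
    twice. *)
Lemma d_eta_shape X Y :
  der c X (eta Y) - der c Y (eta X) - eta (D X Y - D Y X) = 2 * g (h X) Y.
Proof.
rewrite !tensorE !eta_conn !conn_xiE !dotE !dot_xi shape_skew (dotC c Y).
rewrite shape_skew (dotC c Y X); pwring.
Qed.

End Shape.

(** * Curvature and the derivatives of phi and h *)

Section Curvature.
Context {R : realFieldType} {K : comPzRingType} {V : lmodType K}.
Context {c : contact_calculus R V}.
Implicit Types (f : K) (X Y Z W : V) (p : point c).
Local Notation g := (dot c).
Local Notation D := (conn c).
Local Notation phi := (phi c).
Local Notation xi := (xi c).
Local Notation eta := (eta c).
Local Notation P := (covphi (c := c)).
Local Notation h := (shape (c := c)).
Local Notation A X := (D X xi).

Definition curv X Y Z :=
  locked (D X (D Y Z) - D Y (D X Z) - D (D X Y - D Y X) Z).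
Lemma curvE X Y Z :
  curv X Y Z = D X (D Y Z) - D Y (D X Z) - D (D X Y - D Y X) Z.
Proof. by rewrite /curv -lock. Qed.

Lemma curv_anti X Y Z : curv X Y Z = - curv Y X Z.
Proof. by rewrite !curvE !connDl !connNl; vring. Qed.

Lemma bianchi X Y Z : curv X Y Z + curv Y Z X + curv Z X Y = 0.
Proof.
have := jacobi c X Y Z; rewrite /= !curvE !connDl !connDr !connNl !connNr => j.
rewrite -j; vring.
Qed.

Lemma curv_skew X Y Z W : g (curv X Y Z) W = - g (curv X Y W) Z.
Proof.
rewrite [g _ Z]dotC !curvE !dotE !conn_dotl !derD !derN der_bracket.
by pwring.
Qed.

(** The classical octahedron argument: four Bianchi identities combined with the two antisymmetries,
    all supplied as linear equations between reals. *)
Lemma curv_pair X Y Z W : g (curv X Y Z) W = g (curv Z W X) Y.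
Proof.
have b X1 Y1 Z1 W1 p : ev p (g (curv X1 Y1 Z1) W1) + ev p (g (curv Y1 Z1 X1) W1)
    + ev p (g (curv Z1 X1 Y1) W1) = 0.
  by rewrite -!evD -!dotDl bianchi dot0l ev0.
have a X1 Y1 Z1 W1 p :
    ev p (g (curv X1 Y1 Z1) W1) = - ev p (g (curv Y1 X1 Z1) W1).
  by rewrite curv_anti dotNl evN.
have s X1 Y1 Z1 W1 p :
    ev p (g (curv X1 Y1 Z1) W1) = - ev p (g (curv X1 Y1 W1) Z1).
  by rewrite curv_skew evN.
apply: (ev_inj (m := c)) => p.
have := b X Y Z W p; have := b Y Z W X p; have := b Z W X Y p.
have := b W X Y Z p.
have := a X Y Z W p; have := a Z W X Y p; have := s X Y Z W p.
have := s Z W X Y p; have := s Y Z X W p; have := s Z X Y W p.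
have := s Z W Y X p; have := s W Y Z X p; have := s Y Z W X p.
have := s W X Z Y p; have := s X Z W Y p; have := s W X Y Z p.
have := s X Y W Z p; have := s Y W X Z p.
have := a X W Y Z p; have := a Y Z X W p; have := a X Z Y W p.
have := a Y W X Z p; have := a X Z W Y p; have := a Y W Z X p.
have := a W X Y Z p; have := a W X Z Y p.
by lra.
Qed.

Definition covshape X Y := locked (D X (h Y) - h (D X Y)).
Local Notation Q := covshape.
Lemma covshapeE X Y : Q X Y = D X (h Y) - h (D X Y).
Proof. by rewrite /covshape -lock. Qed.

Lemma dotphir X Y : g X (phi Y) = - g (phi X) Y.
Proof. by rewrite phi_skew opprK. Qed.
Lemma dotshaper X Y : g X (h Y) = - g (h X) Y.
Proof. by rewrite shape_skew opprK. Qed.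

Lemma covshape_skew X Y Z : g (Q X Y) Z = - g Y (Q X Z).
Proof.
rewrite !covshapeE !dotE !dotshaper !conn_dotl !shape_skew.
have -> : g Y (D X (h Z)) = der c X (g Y (h Z)) - g (D X Y) (h Z).
  by rewrite conn_dotl opprB addrC subrK.
by rewrite conn_dotl dotshaper derN; pwring.
Qed.

Lemma covshape_xi X : Q X xi = - h (A X).
Proof. by rewrite covshapeE shape_xi conn0r add0r. Qed.

Lemma covshape_phi X Y : Q X (phi Y) + phi (Q X Y) + h (P X Y) + P X (h Y) = 0.
Proof.
rewrite !covshapeE !covphiE !tensorE !shapeD !shapeN !shape_phi connNr.
by vring.
Qed.

(** The antisymmetrized derivative of nabla xi = Id - eta xi + h; the term eta xi produces d eta and
    the terms in nabla xi. *)
Lemma curv_xi X Y : curv X Y xi =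
  Q X Y - Q Y X - (2 * g (h X) Y) *: xi - eta Y *: A X + eta X *: A Y.
Proof.
rewrite -d_eta_shape curvE !covshapeE !conn_xiE.
rewrite !connDr !connNr !connZr !shapeD !shapeN !tensorE ?conn_xiE; vring.
Qed.

(** Closedness of the 2-form g(h ., .), which is half of d eta. It comes from the first Bianchi
    identity paired with xi, where the terms of [curv_xi] without nabla h add up to zero. *)
Lemma covshape_cycle X Y Z : g (Q X Y) Z + g (Q Y Z) X + g (Q Z X) Y = 0.
Proof.
have b : g (curv X Y xi) Z + g (curv Y Z xi) X + g (curv Z X xi) Y = 0.
  by rewrite !(curv_skew _ _ xi) -!opprD -!dotDl bianchi dot0l oppr0.
apply: (ev_inj (m := c)) => p.
have s X1 Y1 Z1 : ev p (g (Q X1 Y1) Z1) = - ev p (g (Q X1 Z1) Y1).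
  by rewrite covshape_skew evN dotC.
have t X1 Y1 : ev p (g (h X1) Y1) = - ev p (g (h Y1) X1).
  by rewrite shape_skew evN dotC.
move: (f_equal (ev p) b); rewrite !curv_xi !conn_xiE !dotE !dot_xil !evE.
have := s X Y Z; have := s Y Z X; have := s Z X Y.
rewrite (t X Y) (t Y Z) (t X Z) (dotC c Y X) (dotC c Z X) (dotC c Z Y).
lra.
Qed.

Lemma covphiDl X Y Z : P (X + Y) Z = P X Z + P Y Z.
Proof. by rewrite !covphiE !connDl !tensorE; vring. Qed.
Lemma covphiZl f X Z : P (f *: X) Z = f *: P X Z.
Proof. by rewrite !covphiE !connZl !tensorE; vring. Qed.
Lemma covphiNl X Z : P (- X) Z = - P X Z.
Proof. by rewrite -scaleN1r covphiZl scaleN1r. Qed.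

Lemma nearlyP X Y : P X Y + P Y X = - (eta Y *: phi X) - eta X *: phi Y.
Proof. by rewrite !covphiE nearly. Qed.

Lemma conn_phi X Y : D X (phi Y) = P X Y + phi (D X Y).
Proof. by rewrite covphiE subrK. Qed.

Lemma covphi_xil_shape X : P xi X = phi (h X).
Proof.
by rewrite covphi_xil conn_xiE !tensorE phi_xi; vring.
Qed.

(** The commutator of R(X, xi) with phi contains a second derivative of phi. Symmetrizing makes it
    computable, because the nearly Kenmotsu identity can be differentiated along xi ([n3]). *)
Lemma curv_phi_sym X Y :
  curv X xi (phi Y) - phi (curv X xi Y) +
  (curv Y xi (phi X) - phi (curv Y xi X)) =
  P X (h Y) + P Y (h X) + phi (Q X Y) + phi (Q Y X) - P (A X) Y - P (A Y) X
  + eta Y *: phi (h X) + eta X *: phi (h Y).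
Proof.
have n3 : D xi (P X Y) + D xi (P Y X) =
   - (der c xi (eta Y) *: phi X + eta Y *: (phi (h X) + phi (D xi X)))
   - (der c xi (eta X) *: phi Y + eta X *: (phi (h Y) + phi (D xi Y))).
  rewrite -connDr nearlyP connDr !connNr !connZr !conn_phi.
  by rewrite !covphi_xil_shape; vring.
have e1 U : eta (D xi U) = der c xi (eta U).
  by rewrite eta_conn conn_xi_xi dot0r subr0.
have n1 := nearlyP X (D xi Y); have n2 := nearlyP (D xi X) Y.
rewrite !e1 in n1 n2.
(* Before symmetrization, [D xi (P U W)] carries the only second derivative of phi. *)
have E U W : curv U xi (phi W) - phi (curv U xi W) = P U (h W) + phi (Q U W)
   - P (A U) W + P U (D xi W) + P (D xi U) W - D xi (P U W).
  rewrite !curvE !covshapeE !conn_phi !connDr !covphi_xil_shape.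
  rewrite !conn_phi !covphi_xil_shape !connDl !connNl !covphiDl !covphiNl.
  by rewrite !tensorE; vring.
rewrite !E; apply: (dot_inj (m := c)) => Z; apply: (ev_inj (m := c)) => p.
move: (f_equal (fun U => ev p (g U Z)) n1) (f_equal (fun U => ev p (g U Z)) n2)
  (f_equal (fun U => ev p (g U Z)) n3).
rewrite /= !dotE !evE; lra.
Qed.

End Curvature.

(** * The derivative of the shape operator *)

Section ShapeDerivative.
Context {R : realFieldType} {K : comPzRingType} {V : lmodType K}.
Context {c : contact_calculus R V}.
Implicit Types (f : K) (X Y Z W : V) (p : point c).
Local Notation phi := (phi c).
Local Notation xi := (xi c).
Local Notation P := (covphi (c := c)).
Local Notation Q := (covshape (c := c)).
Local Notation h := (shape (c := c)).
Local Notation A X := (conn c X xi).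

Section AtPoint.
Variable p : point c.
Local Notation e X := (ev p (eta c X)).
Local Notation G X Y := (ev p (dot c X Y)).

(* Difference between [nabla h] and the value given in the header. *)
Definition Qerr X Y Z : R :=
  G (Q X Y) Z + 2 * e X * G (h Y) Z - G (h X) Y * e Z + e Y * G (h X) Z
  - G (h (h X)) Y * e Z + e Y * G (h (h X)) Z.

(* The part of [nabla phi] transverse to [xi]: the defining identity of nearly
   Kenmotsu structures makes it a 3-form. *)
Definition Pform X Y Z : R :=
  G (P X Y) Z - G (phi X) Y * e Z + e Y * G (phi X) Z
  - e X * G (phi (h Y)) Z + e Y * G (phi (h X)) Z - G (phi (h X)) Y * e Z.

Lemma GC X Y : G X Y = G Y X. Proof. by rewrite dotC. Qed.
Lemma G_phi X Y : G (phi X) Y = - G (phi Y) X.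
Proof. by rewrite phi_skew evN GC. Qed.
Lemma G_h X Y : G (h X) Y = - G (h Y) X.
Proof. by rewrite shape_skew evN GC. Qed.
Lemma G_hh X Y : G (h (h X)) Y = G (h (h Y)) X.
Proof. by rewrite (shape_skew (h X)) (shape_skew (h Y)) (dotC c (h X)). Qed.
Lemma G_phih X Y : G (phi (h X)) Y = - G (phi (h Y)) X.
Proof. by rewrite phi_skew (shape_skew X) opprK shape_phi dotNr evN GC. Qed.
Lemma G_phihh X Y : G (phi (h (h X))) Y = - G (phi (h (h Y))) X.
Proof.
rewrite phi_skew (shape_skew (h X)) opprK shape_phi dotNr (shape_skew X) opprK.
by rewrite shape_phi dotNr evN GC.
Qed.
Lemma G_P X Y Z : G (P X Y) Z = - G (P X Z) Y.
Proof. by rewrite covphi_skew evN GC. Qed.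
Lemma G_Q X Y Z : G (Q X Y) Z = - G (Q X Z) Y.
Proof. by rewrite covshape_skew evN GC. Qed.
Lemma e_phi X : e (phi X) = 0. Proof. by rewrite eta_phi ev0. Qed.
Lemma e_h X : e (h X) = 0. Proof. by rewrite eta_shape ev0. Qed.
Lemma e_xi : e xi = 1. Proof. by rewrite eta_xi ev1. Qed.
Lemma G_xi X : G X xi = e X. Proof. by rewrite dot_xi. Qed.
Lemma G_xil X : G xi X = e X. Proof. by rewrite dot_xil. Qed.

Definition lowerE := (@dotE _ _ _ c, evE p, e_phi, e_h, e_xi, @phi_xi _ _ _ c,
  @shape_xi _ _ _ c, G_xi, G_xil, @tensorE _ _ _ c, @shapeD _ _ _ c,
  @shapeZ _ _ _ c, @shapeN _ _ _ c, @shape_phi _ _ _ c, @phi2 _ _ _ c,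
  @dotphir _ _ _ c, @dotshaper _ _ _ c).

Lemma Pform_skew23 X Y Z : Pform X Y Z = - Pform X Z Y.
Proof.
by rewrite /Pform (G_P X Y Z) (G_phih Y Z); ring.
Qed.

(** The nearly Kenmotsu identity, whose right-hand side is absorbed by the correction terms of
    [Pform]. *)
Lemma Pform_skew12 X Y Z : Pform X Y Z = - Pform Y X Z.
Proof.
rewrite /Pform; have := f_equal (fun U => G U Z) (nearlyP (c := c) X Y).
rewrite /= !lowerE (G_phi Y X) (G_phih Y X); lra.
Qed.

Lemma Pform_xi Y Z : Pform xi Y Z = 0.
Proof. by rewrite /Pform covphi_xil_shape !lowerE; lra. Qed.

(** By [covphi_phi], nabla_X phi anticommutes with phi up to terms in xi; since phi is skew, phi
    then passes between the arguments without a sign. *)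
Lemma Pform_phi X Y Z : Pform X (phi Y) Z = Pform X Y (phi Z).
Proof.
have := f_equal (fun U => G U Z) (covphi_phi (c := c) X Y).
rewrite /Pform /= !conn_xiE !lowerE.
rewrite (GC Y X) (G_h X Y) (G_phih X Y); lra.
Qed.

Lemma Qerr_skew X Y Z : Qerr X Y Z = - Qerr X Z Y.
Proof. by rewrite /Qerr (G_Q X Y Z) (G_h Y Z); ring. Qed.

Definition canon X Y := (GC Y X, G_phi Y X, G_h Y X, G_hh Y X, G_phih Y X,
  G_phihh Y X).

Lemma Q_cycle X Y Z : G (Q X Y) Z + G (Q Y Z) X + G (Q Z X) Y = 0.
Proof. by rewrite -!evD covshape_cycle ev0. Qed.

Lemma Qerr_cycle X Y Z : Qerr X Y Z + Qerr Y Z X + Qerr Z X Y = 0.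
Proof.
have := Q_cycle X Y Z.
by rewrite /Qerr ?(canon X Y, canon X Z, canon Y Z); lra.
Qed.

(** The value (nabla_X h) xi = - h (nabla_X xi) is known outright; it dictates the terms in h + h^2
    of [Qerr]. *)
Lemma Qerr_xi2 X Z : Qerr X xi Z = 0.
Proof. by rewrite /Qerr covshape_xi conn_xiE !lowerE; lra. Qed.

Lemma Qerr_xi3 X Z : Qerr X Z xi = 0.
Proof. by rewrite Qerr_skew Qerr_xi2 oppr0. Qed.

Lemma Qerr_phi2 X Y Z : Qerr X Y (phi (phi Z)) = - Qerr X Y Z.
Proof. by have := Qerr_xi3 X Y; rewrite /Qerr !lowerE; nra. Qed.

Lemma Qerr_anticomm X Y Z :
  Qerr X (phi Y) Z - Qerr X Y (phi Z) = Pform X Y (h Z) - Pform X (h Y) Z.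
Proof.
have := f_equal (fun U => G U Z) (covshape_phi (c := c) X Y).
by rewrite /Qerr /Pform /= !lowerE ?(canon X Y, canon X Z, canon Y Z); lra.
Qed.

Lemma G_curv_xi X Y Z : G (curv (c := c) X xi Y) Z = - G (curv (c := c) Y Z xi) X.
Proof. by rewrite curv_pair curv_skew evN. Qed.

(* Pair symmetry turns [curv X xi Y] into [curv Y Z xi], which [curv_xi] expresses
   through [nabla h]; [curv_phi_sym] then becomes a relation without curvature. *)
Lemma Qerr_curv X Y Z : Qerr X Y (phi Z) + Qerr Y X (phi Z) =
  Pform X (h Y) Z - Pform (h X) Y Z.
Proof.
have := f_equal (fun U => G U Z) (covshape_phi (c := c) X Y).
have := f_equal (fun U => G U Z) (covshape_phi (c := c) Y X).
have := f_equal (fun U => G U Z) (nearlyP (c := c) X Y).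
have := f_equal (fun U => G U (h Z)) (nearlyP (c := c) X Y).
have := f_equal (fun U => G U Z) (nearlyP (c := c) X (h Y)).
have := f_equal (fun U => G U Z) (nearlyP (c := c) Y (h X)).
have := f_equal (fun U => G U Z) (curv_phi_sym (c := c) X Y).
rewrite /= !(dotE (c := c)) !(phi_skew (curv (c := c) _ _ _)) ?(evE (c := c) p).
rewrite !G_curv_xi !curv_xi !conn_xiE !covphiDl !covphiNl !covphiZl.
rewrite !covphi_xil_shape.
have := Q_cycle X (phi Y) Z; have := Q_cycle X Y (phi Z).
have := Q_cycle Y (phi X) Z; have := Q_cycle Y X (phi Z).
have := G_Q Z (phi Y) X; have := G_Q (phi Z) Y X.
have := G_Q Z (phi X) Y; have := G_Q (phi Z) X Y.
have := G_Q (phi Y) Z X; have := G_Q Y (phi Z) X.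
have := G_Q (phi X) Z Y; have := G_Q X (phi Z) Y.
have := G_Q X (phi Y) Z; have := G_Q Y (phi X) Z.
have := G_Q X Y (phi Z); have := G_Q Y X (phi Z).
rewrite /Qerr /Pform /= !lowerE ?(canon X Y, canon X Z, canon Y Z).
lra.
Qed.

End AtPoint.
End ShapeDerivative.

Section ShapeDerivative2.
Context {R : realFieldType} {K : comPzRingType} {V : lmodType K}.
Context {c : contact_calculus R V}.
Implicit Types (f : K) (X Y Z W : V) (p : point c).
Local Notation phi := (phi c).
Local Notation xi := (xi c).
Local Notation P := (covphi (c := c)).
Local Notation Q := (covshape (c := c)).
Local Notation h := (shape (c := c)).
Local Notation A X := (conn c X xi).

Section AtPoint.
Variable p : point c.
Local Notation e X := (ev p (eta c X)).
Local Notation G X Y := (ev p (dot c X Y)).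

Local Notation Qerr := (Qerr p).
Local Notation Pform := (Pform p).

Lemma Pform_cyc X Y Z : Pform X Y Z = Pform Y Z X.
Proof. by rewrite Pform_skew12 Pform_skew23 opprK. Qed.

Lemma Pform_xi3 X Y : Pform X Y xi = 0.
Proof. by rewrite -Pform_cyc Pform_xi. Qed.

Lemma Pform_phi2 X Y Z : Pform X Y (phi (phi Z)) = - Pform X Y Z.
Proof. by have := Pform_xi3 X Y; rewrite /Pform !lowerE; nra. Qed.

Lemma Pform_shape_phi X Y Z : Pform X Y (h (phi Z)) = - Pform X Y (phi (h Z)).
Proof. by rewrite /Pform !lowerE; lra. Qed.

Lemma Pform_phi12 X Y Z : Pform (phi X) Y Z = Pform X (phi Y) Z.
Proof. by rewrite (Pform_cyc (phi X)) -Pform_phi -Pform_cyc -Pform_phi. Qed.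

(** The tensor [T] turns out to be cyclically invariant. But phi moves between its first two
    arguments with a plus sign and into the third with a minus sign, so one turn round the cycle
    negates [T] on the image of phi. As phi^2 acts by - 1, [T] is zero. *)
Lemma Pform_shape X Y Z : Pform X Y (h Z) = 0.
Proof.
pose T U V W := Pform U V (h W).
have Tsk U1 V1 W1 : T U1 V1 W1 = - T V1 U1 W1 by exact: Pform_skew12.
have T1 U1 V1 W1 : T (phi U1) V1 W1 = T U1 (phi V1) W1 by exact: Pform_phi12.
have T2 U1 V1 W1 : T U1 V1 (phi W1) = - T U1 (phi V1) W1.
  by rewrite /T Pform_shape_phi Pform_phi.
have T3 U1 V1 W1 : T U1 (phi (phi V1)) W1 = - T U1 V1 W1.
  by rewrite /T -(Pform_cyc (h W1)) Pform_phi2 Pform_cyc.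
have c1 U1 V1 W1 : Pform U1 (h V1) W1 = T W1 U1 V1 by rewrite -Pform_cyc.
have c2 U1 V1 W1 : Pform (h U1) V1 W1 = T V1 W1 U1 by rewrite Pform_cyc.
(* As for the Koszul formula: [Qerr] is skew in its last two arguments, its symmetrization in the
   first two is given by [Qerr_curv], and the cyclic identity then determines it. *)
have n3 U1 V1 W1 : 3 * Qerr U1 V1 W1 = - T (phi W1) U1 V1 + T V1 (phi W1) U1
    + T (phi V1) U1 W1 - T W1 (phi V1) U1.
  have := Qerr_curv p U1 V1 (phi W1).
  have := Qerr_curv p U1 W1 (phi V1).
  rewrite !Qerr_phi2 !c1 !c2.
  have := Qerr_cycle p U1 V1 W1; have := Qerr_skew p U1 V1 W1.
  by have := Qerr_skew p V1 U1 W1; have := Qerr_skew p W1 U1 V1; lra.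
(* Inserting [n3] into the anticommutation relation eliminates [Qerr] and leaves a relation for [T]
   alone. *)
have Tcyc U1 V1 W1 : T U1 V1 W1 = T W1 U1 V1.
  have := Qerr_anticomm p U1 V1 W1; have := n3 U1 (phi V1) W1.
  have := n3 U1 V1 (phi W1); rewrite ?(T1, T2, T3).
  rewrite c1 -[Pform U1 V1 (h W1)]/(T U1 V1 W1).
  rewrite (Tsk V1 U1) (Tsk W1 V1).
  by lra.
have T0 U1 V1 W1 : T U1 (phi V1) W1 = 0.
  have e : T U1 V1 (phi W1) = - T U1 V1 (phi W1).
    by rewrite {1}Tcyc T1 Tcyc T2 Tcyc.
  by have := T2 U1 V1 W1; lra.
apply: oppr_inj; rewrite oppr0 -[Pform X Y (h Z)]/(T X Y Z) -T3; exact: T0.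
Qed.

(** Once the right-hand side of [Qerr_curv] is zero, [Qerr] is totally skew, and its vanishing
    cyclic sum is three times itself. *)
Lemma Qerr0 X Y Z : Qerr X Y Z = 0.
Proof.
have n2 U1 V1 W1 : Qerr U1 V1 W1 + Qerr V1 U1 W1 = 0.
  have := Qerr_curv p U1 V1 (phi W1); rewrite !Qerr_phi2.
  by rewrite -(Pform_cyc (phi W1) U1) (Pform_cyc (h U1)) !Pform_shape; lra.
have := Qerr_cycle p X Y Z; have := n2 X Y Z; have := n2 X Z Y.
by rewrite (Qerr_skew p X Z) (Qerr_skew p Y X) (Qerr_skew p Z X); lra.
Qed.

End AtPoint.

Lemma covshapeP X Y : Q X Y = (dot c (h X) Y + dot c (h (h X)) Y) *: xi
  - eta c Y *: (h X + h (h X)) - (2 * eta c X) *: h Y.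
Proof.
apply: (dot_inj (m := c)) => Z; apply: (ev_inj (m := c)) => p.
have := Qerr0 p X Y Z; rewrite /Qerr !dotE !dot_xil !evE; lra.
Qed.

End ShapeDerivative2.

(** * The trace of the squared shape operator *)

(** Gram-Schmidt by induction on the size: the Schur complement of the first entry is again positive
    definite. *)
Lemma posdef_orthonormal (F : rcfType) n (G : 'M[F]_n) : G^T = G ->
  (forall x : 'rV[F]_n, x != 0 -> 0 < (x *m G *m x^T) 0 0) ->
  exists S : 'M[F]_n, S *m G *m S^T = 1%:M.
Proof.
elim: n G => [|n IH] G Gsym Gpos; first by exists 0; apply/matrixP => -[].
have Gs i j : G i j = G j i by rewrite -{1}Gsym mxE.
pose G1 : 'M[F]_(1 + n) := G.
have Gpos1 : forall x : 'rV_(1 + n), x != 0 -> 0 < (x *m G1 *m x^T) 0 0 := Gpos.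
pose a := G1 0 0; pose b : 'rV_n := ursubmx G1; pose D : 'M[F]_n := drsubmx G1.
have Gb : G1 = block_mx a%:M b b^T D.
  rewrite -[LHS]submxK; congr block_mx.
    by rewrite [LHS]mx11_scalar !mxE !lshift0.
  by apply/matrixP => i j; rewrite !mxE; apply: Gs.
have a0 : 0 < a.
  have := Gpos1 (row_mx 1 0); rewrite Gb mul_row_block.
  rewrite !mul1mx !mul0mx !addr0 tr_row_mx mul_row_col trmx1 trmx0 mulmx1 mulmx0.
  rewrite addr0 mxE mulr1n; apply.
  apply/eqP => /(congr1 (fun M : 'rV_(1 + n) => M 0 (lshift n 0))).
  by rewrite row_mxEl !mxE => /eqP; rewrite oner_eq0.
have [S' HS'] : exists S : 'M[F]_n, S *m (D - a^-1 *: (b^T *m b)) *m S^T = 1%:M.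
  apply: IH.
    rewrite linearB linearZ /= trmx_mul trmxK; congr (_ - _).
    by apply/matrixP => i j; rewrite !mxE; apply: Gs.
  (* The first entry of [y] makes it G-orthogonal to the first basis vector, so that its G-square
     equals that of [x] for the Schur complement. *)
  move=> x x0; pose y : 'rV_(1 + n) := row_mx (- a^-1 *: (x *m b^T)) x.
  have : y != 0.
    apply: contra_neq x0 => y0.
    by rewrite -(row_mxKr (- a^-1 *: (x *m b^T)) x) -/y y0 linear0.
  move/Gpos1; rewrite Gb mul_row_block tr_row_mx mul_row_col.
  rewrite mul_mx_scalar scalerA mulrN mulfV ?gt_eqF// scaleN1r addNr mul0mx add0r.
  by rewrite mulmxBr -scalemxAr -scalemxAl mulmxA scaleNr addrC.
pose s := (Num.sqrt a)^-1.
suff : exists S : 'M[F]_(1 + n), S *m G1 *m S^T = 1%:M by [].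
(* The first row normalizes the first basis vector; the others are the rows of [S'] extended as [y]
   was. *)
exists (block_mx s%:M 0 (- a^-1 *: (S' *m b^T)) S').
rewrite Gb tr_block_mx !mulmx_block !mul0mx !addr0 trmx0 tr_scalar_mx.
rewrite !mulmx0 !addr0.
have e1 : - a^-1 *: (S' *m b^T) *m a%:M + S' *m b^T = 0.
  by rewrite mul_mx_scalar scalerA mulrN mulfV ?gt_eqF// scaleN1r addNr.
rewrite e1 !mul0mx !add0r scalar_mx_block; congr block_mx.
- rewrite !mul_mx_scalar !scale_scalar_mx; congr (_%:M).
  by rewrite mulrCA -expr2 exprVn sqr_sqrtr ?ltW// mulfV ?gt_eqF.
- rewrite linearZ /= trmx_mul trmxK -!mulmxA !mul_scalar_mx (scalerA a) mulrN.
  by rewrite mulfV ?gt_eqF// scaleN1r scalerN addNr.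
- rewrite -HS'; congr (_ *m _); rewrite mulmxBr addrC; congr (_ + _).
  by rewrite -scalemxAl scaleNr -scalemxAr mulmxA.
Qed.

(** In a G-orthonormal basis A becomes an antisymmetric B, and tr B^2 is minus the sum of the
    squares of its entries. *)
Lemma skew_trace_eq0 (F : rcfType) n (G A : 'M[F]_n) : G^T = G ->
  (forall x : 'rV[F]_n, x != 0 -> 0 < (x *m G *m x^T) 0 0) ->
  (A *m G)^T = - (A *m G) -> \tr (A *m A) = 0 -> A = 0.
Proof.
move=> Gs Gpos AG trA; have [S HS] := posdef_orthonormal Gs Gpos.
have [] := mulmx1_unit HS; rewrite unitmx_mul => /andP[uS uG] uST.
have [B defB] : exists B, B = S *m A *m invmx S by eexists.
have AE : A = invmx S *m B *m S by rewrite defB !mulmxA mulVmx// mul1mx mulmxKV.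
have GS : G *m S^T = invmx S.
  by apply: (can_inj (mulKmx uS)); rewrite mulmxA HS mulmxV.
have BE : B = S *m (A *m G) *m S^T by rewrite -!mulmxA GS mulmxA.
have Bs : B^T = - B.
  by rewrite BE trmx_mul (trmx_mul S) trmxK AG mulNmx mulmxN mulmxA.
have trB : \tr (B *m B) = 0.
  rewrite defB -[S *m A *m _ *m _]mulmxA (mulmxA (invmx S)) (mulmxA (invmx S)).
  by rewrite mulVmx// mul1mx -!mulmxA mxtrace_mulC -!mulmxA mulVmx// mulmx1.
have B0 : B = 0.
  apply/matrixP => i j; rewrite mxE.
  have : \sum_i \sum_j B i j ^+ 2 = 0.
    transitivity (- \tr (B *m B)); last by rewrite trB oppr0.
    rewrite /mxtrace -sumrN; apply: eq_bigr => k _.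
    rewrite mxE -sumrN; apply: eq_bigr => l _.
    have := congr1 (fun N : 'M[F]_n => N k l) Bs; rewrite !mxE => ->.
    by rewrite mulrN opprK.
  move/eqP; rewrite psumr_eq0 => [/allP/(_ i)|k _]; last first.
    by apply: sumr_ge0 => l _; exact: sqr_ge0.
  rewrite mem_index_enum => /(_ isT); rewrite psumr_eq0 => [/allP/(_ j)|l _].
    by rewrite mem_index_enum => /(_ isT); rewrite /= sqrf_eq0 => /eqP.
  exact: sqr_ge0.
by rewrite AE B0 mulmx0 mul0mx.
Qed.

Section Trace.
Context {R : rcfType} {K : comPzRingType} {V : lmodType K}.
Context {c : contact_calculus R V}.
Context {m : nat} {E : 'I_m -> V} {x : 'I_m -> K} {psi : K} {cst : R -> K}.
Implicit Types (f : K) (X Y Z W : V) (p q : point c).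
Local Notation d := (der c).
Local Notation g := (dot c).
Local Notation D := (conn c).
Local Notation xi := (xi c).
Local Notation Q := (covshape (c := c)).
Local Notation h := (shape (c := c)).
(** Coordinates and their fields are dual only near a point, while [V] consists of global fields.
    Multiplied by a cutoff [psi] the local relations hold globally, and they can be used wherever
    [psi] is nonzero. *)
Hypothesis frame : forall Y, psi *: Y = \sum_i (psi * d Y (x i)) *: E i.
Hypothesis dual : forall i j, psi * d (E i) (x j) = psi * (i == j)%:R.

Lemma ev_sum (I : finType) q (F : I -> K) :
  ev q (\sum_i F i) = \sum_i ev q (F i).
Proof. by apply: (big_morph _ (evD q) (ev0 q)). Qed.
Lemma der_sum (I : finType) X (F : I -> K) :
  d X (\sum_i F i) = \sum_i d X (F i).
Proof. by apply: (big_morph _ (derD c X) (der0 X)). Qed.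
Lemma ev_nat q n : ev q n%:R = n%:R.
Proof. by elim: n => [|n IH]; rewrite ?ev0// !mulrSr evD ev1 IH. Qed.
Lemma der_nat X n : d X n%:R = 0.
Proof. by elim: n => [|n IH]; rewrite ?der0// mulrSr derD der1 IH addr0. Qed.

Section AtPoint.
Variable q : point c.
Hypothesis psiq : ev q psi != 0.

Lemma frame_ev (w : V -> K) (Y : V) :
  (forall f X Y, w (f *: X + Y) = f * w X + w Y) ->
  ev q (w Y) = \sum_i ev q (d Y (x i)) * ev q (w (E i)).
Proof.
move=> wl.
have w0 : w 0 = 0.
  have := wl 1 0 0; rewrite scale1r addr0 mul1r => e.
  by apply: (addrI (w 0)); rewrite -e addr0.
have wD : {morph w : X Y / X + Y}.
  by move=> X1 X2; have := wl 1 X1 X2; rewrite scale1r mul1r.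
have wZ f X : w (f *: X) = f * w X by have := wl f X 0; rewrite w0 !addr0.
apply: (mulfI psiq); rewrite -evM -wZ frame (big_morph _ wD w0) ev_sum mulr_sumr.
by apply: eq_bigr => i _; rewrite wZ !evM mulrA.
Qed.

Lemma dual_ev i j : ev q (d (E i) (x j)) = (i == j)%:R.
Proof. by apply: (mulfI psiq); rewrite -evM dual evM ev_nat. Qed.

(** Differentiate [dual]: at q the terms with the derivative of [psi] agree on both sides, and [psi]
    is nonzero there. *)
Lemma dual_der X i j : ev q (d X (d (E i) (x j))) = 0.
Proof.
have : ev q (d X (psi * d (E i) (x j))) = ev q (d X (psi * (i == j)%:R)).
  by rewrite dual.
rewrite !derM der_nat mulr0 addr0 evD !evM dual_ev ev_nat => /(canRL (addKr _)).
by rewrite addNr => /eqP; rewrite mulf_eq0 (negPf psiq) => /eqP.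
Qed.

Definition shape_trace : K := \sum_i d (h (h (E i))) (x i).

Lemma frame_trace (Z : V) (w : V -> K) :
  (forall f X Y, w (f *: X + Y) = f * w X + w Y) ->
  \sum_i ev q (w (E i)) * ev q (d Z (x i)) = ev q (w Z).
Proof.
by move=> wl; rewrite (frame_ev _ wl); apply: eq_bigr => i _; rewrite mulrC.
Qed.

Lemma shape_trace_der X :
  ev q (d X shape_trace) = - 4 * ev q (eta c X) * ev q shape_trace.
Proof.
rewrite der_sum ev_sum.
pose hh Y := h (h Y).
have hhl f Y Z : hh (f *: Y + Z) = f *: hh Y + hh Z.
  by rewrite /hh !shapeD !shapeZ.
have dl i f Y Z : d (f *: Y + Z) (x i) = f * d Y (x i) + d Z (x i).
  exact: der_linear.
(* [om i] is the covariant derivative along X of the differential of [x i]. *)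
pose om i Y := d X (d Y (x i)) - d (D X Y) (x i).
have oml i f Y Z : om i (f *: Y + Z) = f * om i Y + om i Z.
  rewrite /om dl derD derM connDr connZr !derDl !derZl.
  by apply: (ev_inj (m := c)) => p; rewrite ?evE; ring.
have step i : ev q (d X (d (hh (E i)) (x i))) =
   ev q (om i (hh (E i))) + ev q (d (hh (D X (E i))) (x i))
   + ev q (d (Q X (h (E i)) + h (Q X (E i))) (x i)).
  rewrite -!evD; congr (ev q _); rewrite /om !covshapeE /hh !shapeD !shapeN.
  by rewrite !derDl !derNl; apply: (ev_inj (m := c)) => p; rewrite ?evE; ring.
under eq_bigr => i _ do rewrite step.
rewrite !big_split /=.
(* The derivatives of the coframe and of the frame contribute opposite sums, so only the derivative
   of h^2 is left. *)
have -> : \sum_i ev q (om i (hh (E i))) = - \sum_i \sum_k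
    ev q (d (hh (E i)) (x k)) * ev q (d (D X (E k)) (x i)).
  rewrite -sumrN; apply: eq_bigr => i _; rewrite (frame_ev _ (oml i)) -sumrN.
  by apply: eq_bigr => k _; rewrite /om evD dual_der add0r evN mulrN.
have -> : \sum_i ev q (d (hh (D X (E i))) (x i)) = \sum_i \sum_k
    ev q (d (hh (E i)) (x k)) * ev q (d (D X (E k)) (x i)).
  rewrite exchange_big /=; apply: eq_bigr => i _.
  rewrite (frame_ev (w := fun Y => d (hh Y) (x i))) => [|f Y Z].
    by apply: eq_bigr => k _; rewrite mulrC.
  by rewrite hhl dl.
rewrite addNr add0r.
under eq_bigr => i _.
  rewrite !covshapeP ?eta_shape ?shapeD ?shapeN ?shapeZ ?shape_xi ?shapeD
    ?scaler0 ?add0r ?scale0r ?subr0.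
  rewrite !derDl ?derNl ?derZl ?derDl ?evE.
  rewrite (_ : _ + _ = ev q (g (h X) (h (E i)) + g (h (h X)) (h (E i)))
     * ev q (d xi (x i))
     + (- 1 * (ev q (eta c (E i)) * ev q (d (h (h X) + h (h (h X))) (x i)))
     + - 4 * ev q (eta c X) * ev q (d (h (h (E i))) (x i)))); last first.
    by rewrite !derDl ?evE; ring.
  over.
rewrite !big_split /= -!mulr_sumr.
(* The rank-one terms have traces g(h X + h^2 X, h xi) and - eta(h^2 X + h^3 X), both zero. *)
rewrite (frame_trace xi (w := fun Y => g (h X) (h Y) + g (h (h X)) (h Y))).
  rewrite (frame_trace _ (w := eta c)) => [|f Y Z]; last first.
    by rewrite etaD etaZ.
  rewrite shape_xi !dot0r etaD !eta_shape !evE.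
  rewrite -ev_sum -/shape_trace; ring.
move=> f Y Z; rewrite !shapeD !shapeZ !dotDr !dotZr.
by apply: (ev_inj (m := c)) => p; rewrite ?evE; ring.
Qed.

End AtPoint.

(* Apply [d o d = 0] to [d t = - 4 t eta]. *)
Lemma shape_trace_closed p X Y : ev p psi != 0 ->
  ev p shape_trace * ev p (g (h X) Y) = 0.
Proof.
move=> psip.
(* The formula for dt is available where [psi] is nonzero; multiplied by [psi] it holds everywhere
   and can be differentiated again. *)
have z U : psi * (d U shape_trace + 4 * eta c U * shape_trace) = 0.
  apply: (ev_inj (m := c)) => q; rewrite ev0 evM.
  have [->|psiq] := eqVneq (ev q psi) 0; first by rewrite mul0r.
  by rewrite evD (shape_trace_der psiq) !evM (ev_nat q 4); ring.
have e4 : ev p 4 = 4 := ev_nat p 4.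
have d2 U W : ev p (d W (d U shape_trace)) = - (4 * (ev p (d W (eta c U)) *
    ev p shape_trace + ev p (eta c U) * ev p (d W shape_trace))).
  have lz s : psi * s = 0 -> ev p (d W s) = 0.
    move=> s0; have /eqP := f_equal (ev p) s0.
    rewrite evM ev0 mulf_eq0 (negPf psip) /= => /eqP s1.
    have := f_equal (fun a => ev p (d W a)) s0.
    rewrite /= der0 derM ev0 evD !evM s1 mulr0 add0r => /eqP.
    by rewrite mulf_eq0 (negPf psip) /= => /eqP.
  have := lz _ (z U).
  have d4 : d W 4 = 0 := der_nat W 4.
  move: (4 : K) d4 e4 => k d4 e4.
  by rewrite derD !derM d4 ?(evD, evM, ev0) e4; lra.
have b := f_equal (ev p) (der_bracket c X Y shape_trace).
have := f_equal (ev p) (d_eta_shape (c := c) X Y).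
rewrite (shape_trace_der psip) in b.
move: b; rewrite evD evN !d2 !(shape_trace_der psip) !evE => b de.
have {}de : ev p (g (h X) Y) = (ev p (d X (eta c Y)) - ev p (d Y (eta c X))
   - ev p (eta c (D X Y - D Y X))) / 2 by rewrite ?evE; lra.
rewrite de; lra.
Qed.

Hypothesis evK : forall p a, ev p (cst a) = a.
Hypothesis pos : forall p X f, ev p (d X f) != 0 -> 0 < ev p (g X X).

Lemma shape_eq0 p X Y : ev p psi != 0 -> ev p (g (h X) Y) = 0.
Proof.
move=> psip; have := shape_trace_closed X Y psip => /eqP.
rewrite mulf_eq0 => /orP[/eqP tr0|/eqP//].
pose G : 'M[R]_m := \matrix_(i, j) ev p (g (E i) (E j)).
pose A : 'M[R]_m := \matrix_(i, j) ev p (d (h (E i)) (x j)).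
have gl Z f X1 X2 : g (f *: X1 + X2) Z = f * g X1 Z + g X2 Z.
  by rewrite dotDl dotZl.
have AG i j : (A *m G) i j = ev p (g (h (E i)) (E j)).
  rewrite mxE (frame_ev psip (w := g ^~ (E j)) _ (gl (E j))).
  by apply: eq_bigr => k _; rewrite !mxE.
have A0 : A = 0.
  apply: (skew_trace_eq0 (G := G)).
  - by apply/matrixP => i j; rewrite !mxE dotC.
  (* A nonzero [u] gives a constant combination of the frame, detected at p by a coordinate [x j]
     with nonzero entry; positivity of the metric applies to it. *)
  - move=> u u0; pose U : V := \sum_i cst (u 0 i) *: E i.
    have UE Z : ev p (g U Z) = \sum_i u 0 i * ev p (g (E i) Z).
      rewrite (big_morph (g ^~ Z) (fun a b => dotDl a b Z) (dot0l Z)) ev_sum.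
      by apply: eq_bigr => i _; rewrite dotZl evM evK.
    have -> : (u *m G *m u^T) 0 0 = ev p (g U U).
      rewrite UE mxE; apply: eq_bigr => j _; rewrite [in LHS]mxE mulrC !mxE.
      rewrite dotC UE; congr (_ * _).
      by apply: eq_bigr => i _; rewrite !mxE dotC.
    have [j uj] : exists j, u 0 j != 0.
      apply/existsP; apply: contraNT u0; rewrite negb_exists => /forallP u0.
      apply/eqP/rowP => j; rewrite mxE; apply/eqP.
      by have := u0 j; rewrite negbK.
    apply: (pos (f := x j)).
    rewrite (big_morph (d ^~ (x j)) (fun a b => derDl a b _) (der0l _)) ev_sum.
    rewrite (bigD1 j) //= big1 ?addr0 => [|i ij].
      by rewrite derZl evM evK dual_ev// eqxx mulr1.
    by rewrite derZl evM dual_ev// (negPf ij) mulr0.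
  - apply/matrixP => i j; rewrite [LHS]mxE [RHS]mxE !AG.
    by rewrite shape_skew dotC evN.
  - rewrite -tr0 /mxtrace /shape_trace ev_sum; apply: eq_bigr => i _.
    rewrite mxE (frame_ev psip (w := fun Y => d (h Y) (x i)) (h (E i))).
      by apply: eq_bigr => k _; rewrite !mxE.
    by move=> f X1 X2; rewrite shapeD shapeZ der_linear.
rewrite (frame_ev psip (w := fun U => g (h U) Y) X) => [|f X1 X2].
  apply: big1 => i _; rewrite (frame_ev psip (w := g ^~ Y) _ (gl Y)).
  rewrite big1 ?mulr0// => k _.
  by have := congr1 (fun B : 'M[R]_m => B i k) A0; rewrite !mxE => ->; rewrite mul0r.
by rewrite shapeD shapeZ gl.
Qed.

End Trace.

(** * Calculus on boxes *)

Local Open Scope classical_set_scope.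
Local Open Scope ring_scope.

Section Line.
Context {R : realType} {V : normedModType R}.
Implicit Types (f : V -> R) (x v : V).

Lemma line_quotient f x v t :
  (fun h : R => h^-1 *: (((fun s : R => f (x + s *: v)) \o shift t) (h *: 1) -
     f (x + t *: v))) =
  (fun h : R => h^-1 *: ((f \o shift (x + t *: v)) (h *: v) - f (x + t *: v))).
Proof.
apply/funext => h /=; congr (_ *: (f _ - _)).
by rewrite [h *: 1]mulr1 scalerDl addrCA addrA addrAC.
Qed.

Lemma derivable_line f x v t :
  derivable (fun s : R => f (x + s *: v)) t 1 <-> derivable f (x + t *: v) v.
Proof. by rewrite /derivable line_quotient. Qed.

Lemma derive_line f x v t :
  'D_1 (fun s : R => f (x + s *: v)) t = 'D_v f (x + t *: v).
Proof. by rewrite /derive line_quotient. Qed.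

(** The two bounds on t say that it lies between 0 and a, for either sign of a. *)
Lemma mvt_line f x v (a : R) :
  (forall t, `|t| <= `|a| -> 0 <= t * a -> derivable f (x + t *: v) v) ->
  exists t, [/\ `|t| <= `|a|, 0 <= t * a &
    f (x + a *: v) - f x = 'D_v f (x + t *: v) * a].
Proof.
move=> df; pose F s := f (x + s *: v).
have dF t : `|t| <= `|a| -> 0 <= t * a -> derivable F t 1.
  by move=> h1 h2; apply/derivable_line; exact: df.
have cF t : `|t| <= `|a| -> 0 <= t * a -> {for t, continuous F}.
  by move=> h1 h2; apply/differentiable_continuous/derivable1_diffP; exact: dF.
have -> : f x = F 0 by rewrite /F scale0r addr0.
rewrite -[f (x + a *: v)]/(F a).
have [a0|a0] := lerP 0 a.
  have range t : t \in `[0, a] -> `|t| <= `|a| /\ 0 <= t * a.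
    rewrite in_itv /= => /andP[t0 ta]; rewrite !ger0_norm//; split=> //.
    exact: mulr_ge0.
  have [||t ta e] := @MVT_segment R F (fun t => 'D_1 F t) 0 a a0.
  - by move=> t /subset_itv_oo_cc/range[h1 h2]; apply: DeriveDef => //; exact: dF.
  - apply: continuous_in_subspaceT => t /set_mem/=/range[h1 h2]; exact: cF.
  have [h1 h2] := range _ ta; exists t; split=> //.
  by rewrite e subr0 derive_line.
have a0' := ltW a0.
have range t : t \in `[a, 0] -> `|t| <= `|a| /\ 0 <= t * a.
  rewrite in_itv /= => /andP[ta t0]; rewrite !ler0_norm ?lerN2//; split=> //.
  exact: mulr_le0.
have [||t ta e] := @MVT_segment R F (fun t => 'D_1 F t) a 0 a0'.
- by move=> t /subset_itv_oo_cc/range[h1 h2]; apply: DeriveDef => //; exact: dF.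
- apply: continuous_in_subspaceT => t /set_mem/=/range[h1 h2]; exact: cF.
have [h1 h2] := range _ ta; exists t; split=> //.
by rewrite -opprB e sub0r derive_line mulrN opprK.
Qed.

End Line.

Section Box.
Context {R : realType} {m : nat}.
Implicit Types (f : 'rV[R]_m -> R) (x y z : 'rV[R]_m) (U : set 'rV[R]_m).
Local Notation e_ i := (delta_mx 0 i : 'rV[R]_m).

Lemma ball_rowP x r y : 0 < r ->
  ball x r y <-> forall j, `|x 0 j - y 0 j| < r.
Proof.
by move=> r0; split=> [[_ b] j|b]; [exact: b|split=> // i j; rewrite ord1; exact: b].
Qed.

Lemma open_ballP U x : open U -> U x ->
  exists2 r : R, 0 < r & ball x r `<=` U.
Proof.
move=> oU Ux; have : nbhs x U by exact: open_nbhs_nbhs.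
by move/nbhs_ballP => [r /= r0 h]; exists r.
Qed.

(** Pass from x to y by changing one coordinate at a time, with the one-variable theorem on each
    edge. The bounds make the intermediate points converge to x as y does. *)
Lemma mvt_box f x0 (r : R) x y :
  (forall z j, ball x0 r z -> derivable f z (e_ j)) ->
  ball x0 r x -> ball x0 r y ->
  exists2 th : 'I_m -> 'rV[R]_m,
    forall j i, `|th j 0 i - x 0 i| <= `|y 0 i - x 0 i| &
    f y - f x = \sum_j 'D_(e_ j) f (th j) * (y 0 j - x 0 j).
Proof.
move=> df xb yb; have r0 : 0 < r by case: xb.
pose z k : 'rV[R]_m := \row_i (if (i < k)%N then y 0 i else x 0 i).
have zS (j : 'I_m) : z j.+1 = z j + (y 0 j - x 0 j) *: e_ j.
  apply/rowP => i; rewrite !mxE eqxx /= ltnS leq_eqVlt -val_eqE /=.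
  have [ij|ij] /= := eqVneq (i : nat) j; last first.
    by rewrite mulr0 addr0.
  by have -> : i = j by [apply: val_inj]; rewrite ltnn mulr1 addrC subrK.
have step (j : 'I_m) : exists th : 'rV[R]_m,
    (forall i, `|th 0 i - x 0 i| <= `|y 0 i - x 0 i|) /\
    f (z j.+1) - f (z j) = 'D_(e_ j) f th * (y 0 j - x 0 j).
  have bnd t : `|t| <= `|y 0 j - x 0 j| -> 0 <= t * (y 0 j - x 0 j) ->
      (forall i, `|(z j + t *: e_ j) 0 i - x 0 i| <= `|y 0 i - x 0 i|) /\
      ball x0 r (z j + t *: e_ j).
    move=> t1 t2; split=> [i|].
      rewrite !mxE eqxx /= -val_eqE /=; case: (ssrnat.ltngtP i j) => [||ij].
      - by rewrite mulr0 addr0.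
      - by rewrite mulr0 addr0 subrr normr0.
      - have -> : i = j by apply: val_inj.
        by rewrite mulr1 addrAC subrr add0r.
    apply/(ball_rowP _ _ r0) => i; rewrite !mxE eqxx /= -val_eqE /=.
    case: (ssrnat.ltngtP i j) => [||ij].
    - by rewrite mulr0 addr0 => _; move/(ball_rowP _ _ r0): yb; apply.
    - by rewrite mulr0 addr0 => _; move/(ball_rowP _ _ r0): xb; apply.
    - have -> : i = j by apply: val_inj.
      move/(ball_rowP _ _ r0): xb => /(_ j); move/(ball_rowP _ _ r0): yb => /(_ j).
      rewrite mulr1 !ltr_norml => /andP[y1 y2] /andP[x1 x2].
      have [yx|yx|yx] := ltgtP (y 0 j) (x 0 j).
      + have : t <= 0.
          rewrite -(pmulr_lle0 _ (_ : 0 < x 0 j - y 0 j)) ?subr_gt0//.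
          by rewrite -opprB mulrN oppr_le0.
        move: t1; rewrite (ltr0_norm (_ : y 0 j - x 0 j < 0)) ?subr_lt0//.
        by move=> t1 t0; rewrite ler0_norm// in t1; apply/andP; split; lra.
      + have : 0 <= t by rewrite -(pmulr_lge0 _ (_ : 0 < y 0 j - x 0 j)) ?subr_gt0.
        move: t1; rewrite (gtr0_norm (_ : 0 < y 0 j - x 0 j)) ?subr_gt0//.
        by move=> t1 t0; rewrite ger0_norm// in t1; apply/andP; split; lra.
      + move: t1; rewrite yx subrr normr0 normr_le0 => /eqP ->.
        by rewrite addr0 x1 x2.
  have [t [t1 t2 e]] : exists t, [/\ `|t| <= `|y 0 j - x 0 j|,
      0 <= t * (y 0 j - x 0 j) & f (z j + (y 0 j - x 0 j) *: e_ j) - f (z j) =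
      'D_(e_ j) f (z j + t *: e_ j) * (y 0 j - x 0 j)].
    apply: mvt_line => t t1 t2; apply: df; exact: (bnd t t1 t2).2.
  by exists (z j + t *: e_ j); rewrite zS e; split=> //; exact: (bnd t t1 t2).1.
have {}step (j : 'I_m) : {th : 'rV[R]_m |
    (forall i, `|th 0 i - x 0 i| <= `|y 0 i - x 0 i|) /\
    f (z j.+1) - f (z j) = 'D_(e_ j) f th * (y 0 j - x 0 j)}.
  exact: cid.
exists (fun j => sval (step j)) => [j i|]; first exact: (svalP (step j)).1.
under eq_bigr => j _ do rewrite -(svalP (step j)).2.
rewrite -(big_mkord xpredT (fun j => f (z j.+1) - f (z j))) telescope_sumr//.
congr (f _ - f _); apply/rowP => i; rewrite !mxE ?ltn0//.
by rewrite ltn_ord.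
Qed.

End Box.

(** * Chain rule along a curve *)

Section Curve.
Context {R : realType} {m : nat}.
Implicit Types (f : 'rV[R]_m -> R) (x y z : 'rV[R]_m) (U : set 'rV[R]_m).
Local Notation e_ i := (delta_mx 0 i : 'rV[R]_m).

Lemma cvg_row {T : Type} {F : set_system T} {FF : Filter F}
    (g : T -> 'rV[R]_m) (l : 'rV[R]_m) :
  (forall j, g t 0 j @[t --> F] --> l 0 j) -> g @ F --> l.
Proof.
move=> gl; apply/cvg_ballP => eps e0; near=> t; apply/ball_rowP => //.
near: t; apply: filter_forall => j; move/cvgrPdist_lt: (gl j); exact.
Unshelve. all: by end_near. Qed.

Lemma cvg_sum {T I : Type} {F : set_system T} {FF : Filter F} (r : seq I)
    (g : I -> T -> R) (l : I -> R) :
  (forall j, g j @ F --> l j) ->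
  (fun t => \sum_(j <- r) g j t) @ F --> \sum_(j <- r) l j.
Proof.
move=> gl; elim: r => [|i r IH].
  by rewrite big_nil; under eq_fun do rewrite big_nil; exact: cvg_cst.
rewrite big_cons; under eq_fun do rewrite big_cons.
exact: cvgD (gl i) IH.
Qed.

(** [mvt_box] expresses the increment through partial derivatives at intermediate points that tend
    to [c t0], so continuity of the partial derivatives there is enough. *)
Lemma chain_curve f U (c : R -> 'rV[R]_m) (t0 : R) (dc : 'I_m -> R) :
  open U -> U (c t0) ->
  (forall x j, U x -> derivable f x (e_ j)) ->
  (forall j, {for c t0, continuous (fun x => 'D_(e_ j) f x)}) ->
  (forall j, is_derive t0 1 (fun t => c t 0 j) (dc j)) ->
  is_derive t0 1 (fun t => f (c t)) (\sum_j 'D_(e_ j) f (c t0) * dc j).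
Proof.
move=> oU Uc df cdf dcj.
have [r r0 rU] := open_ballP oU Uc.
have cc : {for t0, continuous c}.
  apply: cvg_row => j; have [/derivable1_diffP + _] := dcj j.
  exact: differentiable_continuous.
have ex h : exists th : 'I_m -> 'rV[R]_m, ball (c t0) r (c (h + t0)) ->
    (forall j i, `|th j 0 i - c t0 0 i| <= `|c (h + t0) 0 i - c t0 0 i|) /\
    f (c (h + t0)) - f (c t0) =
      \sum_j 'D_(e_ j) f (th j) * (c (h + t0) 0 j - c t0 0 j).
  have [b|nb] := pselect (ball (c t0) r (c (h + t0))); last first.
    by exists (fun _ => 0).
  have [th th1 th2] := @mvt_box R m f (c t0) r (c t0) (c (h + t0))
    (fun z j bz => df z j (rU _ bz)) (ballxx _ r0) b.
  by exists th.
have {}ex h : {th : 'I_m -> 'rV[R]_m | ball (c t0) r (c (h + t0)) ->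
    (forall j i, `|th j 0 i - c t0 0 i| <= `|c (h + t0) 0 i - c t0 0 i|) /\
    f (c (h + t0)) - f (c t0) =
      \sum_j 'D_(e_ j) f (th j) * (c (h + t0) 0 j - c t0 0 j)}.
  exact: cid.
pose th h := sval (ex h).
have cs : c (h + t0) @[h --> 0^'] --> c t0.
  have : c (h + t0) @[h --> (0 : R)] --> c t0.
    have h0 : (h + t0) @[h --> (0 : R)] --> t0.
      rewrite -{2}(add0r t0); apply: cvgD; [exact: cvg_id|exact: cvg_cst].
    exact: (@cvg_comp _ _ _ (fun h => h + t0) c _ _ _ h0 cc).
  exact: cvg_within_filter.
have nb eps : 0 < eps -> \forall h \near 0^', ball (c t0) eps (c (h + t0)).
  by move=> e0; move/cvg_ballP: cs; exact.
have thc j : th h j @[h --> 0^'] --> c t0.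
  apply/cvg_ballP => eps e0; near=> h; apply/ball_rowP => // i.
  have hr : ball (c t0) r (c (h + t0)) by near: h; exact: nb.
  have he : ball (c t0) eps (c (h + t0)) by near: h; exact: nb.
  rewrite distrC (le_lt_trans ((svalP (ex h) hr).1 j i))// distrC.
  by case: he => _; exact.
have quot : (fun h =>
    h^-1 *: (((fun t => f (c t)) \o shift t0) (h *: 1) - f (c t0)))
    @ 0^' --> \sum_j 'D_(e_ j) f (c t0) * dc j.
  pose q h := \sum_j 'D_(e_ j) f (th h j) *
     (h^-1 *: (((fun t => c t 0 j) \o shift t0) (h *: 1) - c t0 0 j)).
  have qc : q @ 0^' --> \sum_j 'D_(e_ j) f (c t0) * dc j.
    apply: cvg_sum => j; apply: cvgM.
      exact: (@cvg_comp _ _ _ (fun h => th h j) (fun x => 'D_(e_ j) f x) _ _ _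
        (thc j) (cdf j)).
    by have [dd <-] := dcj j.
  apply: cvg_trans qc; apply: near_eq_cvg; near=> h.
  have hr : ball (c t0) r (c (h + t0)) by near: h; exact: nb.
  rewrite /q /= [h *: 1]mulr1 (svalP (ex h) hr).2 scaler_sumr.
  by apply: eq_bigr => j _; rewrite -scalerAr.
by apply: DeriveDef; [apply/cvg_ex; eexists; exact: quot|exact: cvg_lim quot].
Unshelve. all: by end_near. Qed.

End Curve.

(** * Functions of class C^k *)

Section CkTheory.
Context {R : realType} {m : nat}.
Implicit Types (f : 'rV[R]_m -> R) (x y z : 'rV[R]_m) (U V : set 'rV[R]_m).
Local Notation e_ i := (delta_mx 0 i : 'rV[R]_m).

Lemma CkS k U V f : V `<=` U -> Ck k U f -> Ck k V f.
Proof.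
move=> VU; elim: k f => [|k IH] f [cf H]; first by split=> // x /VU/cf.
split=> [x /VU/cf//|i]; have [df cdf] := H i.
by split=> [x /VU/df//|]; exact: IH.
Qed.

Lemma Ck_continuous k U f x : Ck k U f -> U x -> {for x, continuous f}.
Proof. by case: k => [|k] [cf _]; exact: cf. Qed.

Lemma Ck_Ck1 k U f : Ck k.+1 U f -> Ck 1 U f.
Proof.
move=> [cf H]; split=> // i; have [df cdf] := H i; split=> //; split=> // x.
exact: Ck_continuous cdf.
Qed.

(** [Ck] speaks of derivatives of the total function at points of the set, so V may be any set
    containing x. *)
Lemma Ck_local k U f :
  (forall x, U x -> exists V, V x /\ Ck k V f) -> Ck k U f.
Proof.
elim: k f => [|k IH] f loc /=.
  by split=> // x /loc[V [Vx [cf _]]]; exact: cf.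
split=> [x /loc[V [Vx [cf _]]]|i]; first exact: cf.
split=> [x /loc[V [Vx [_ /(_ i)[df _]]]]|]; first exact: df.
by apply: IH => x /loc[V [Vx [_ /(_ i)[_ df]]]]; exists V.
Qed.

Lemma Ck_sum k U (I : Type) (r : seq I) (F : I -> 'rV[R]_m -> R) : open U ->
  (forall i, Ck k U (F i)) -> Ck k U (fun x => \sum_(i <- r) F i x).
Proof.
move=> oU CF; elim: r => [|i r IH].
  by under eq_fun do rewrite big_nil; exact: Ck_cst.
by under eq_fun do rewrite big_cons; exact: CkD.
Qed.

Lemma Ck_prod k U (I : Type) (r : seq I) (F : I -> 'rV[R]_m -> R) : open U ->
  (forall i, Ck k U (F i)) -> Ck k U (fun x => \prod_(i <- r) F i x).
Proof.
move=> oU CF; elim: r => [|i r IH].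
  by under eq_fun do rewrite big_nil; exact: Ck_cst.
by under eq_fun do rewrite big_cons; exact: CkM.
Qed.

Lemma CkN k U f : open U -> Ck k U f -> Ck k U (fun x => - f x).
Proof.
move=> oU Cf; apply: Ck_ext (CkM oU (Ck_cst k U (-1)) Cf) => // x _.
by rewrite mulN1r.
Qed.

Lemma CkB k U f g : open U -> Ck k U f -> Ck k U g ->
  Ck k U (fun x => f x - g x).
Proof. by move=> oU Cf Cg; apply: CkD => //; exact: CkN. Qed.

Lemma CkV k U f : open U -> (forall x, U x -> f x != 0) -> Ck k U f ->
  Ck k U (fun x => (f x)^-1).
Proof.
move=> oU f0; elim: k => [|k IH] Cf.
  split=> // x Ux; exact: (cvgV (f0 x Ux) (Cf.1 x Ux)).
split=> [x Ux|i]; first exact: (cvgV (f0 x Ux) (Cf.1 x Ux)).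
have [df ddf] := Cf.2 i; split=> [x Ux|].
  by apply: derivableV; [exact: f0|exact: df].
have Cfi := IH (CkW Cf).
apply: Ck_ext (CkN oU (CkM oU (CkM oU Cfi Cfi) ddf)) => // x Ux.
rewrite deriveV; [|exact: f0|exact: df].
by rewrite -mulNr -invfM expr2.
Qed.

Lemma derive_coord i j x : is_derive x (e_ i) (fun y => y 0 j) (i == j)%:R.
Proof.
have q : (fun h : R => h^-1 *: (((fun y => y 0 j) \o shift x) (h *: e_ i) - x 0 j))
    @ 0^' --> ((i == j)%:R : R).
  apply: (@cvg_trans _ ((cst (i == j)%:R : R -> R) @ 0^')); last exact: cvg_cst.
  apply: near_eq_cvg; near=> h; have h0 : h != 0 by near: h; exact: nbhs_dnbhs_neq.
  rewrite /= !mxE eqxx addrK /= [j == i]eq_sym.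
  by rewrite /GRing.scale /= mulrA mulVf// mul1r.
by apply: DeriveDef; [apply/cvg_ex; eexists; exact: q|exact: cvg_lim q].
Unshelve. all: by end_near. Qed.

Lemma Ck_coord k U j : Ck k U (fun x => x 0 j).
Proof.
have c0 x : {for x, continuous (fun x : 'rV[R]_m => x 0 j)}.
  exact: coord_continuous.
case: k => [|k] /=; first by split=> // x _; exact: c0.
split=> [x _|i]; first exact: c0.
split=> [x _|]; first by have [] := derive_coord i j x.
have -> : (fun x => 'D_(e_ i) (fun y : 'rV[R]_m => y 0 j) x) = fun=> (i == j)%:R.
  by apply/funext => x; have [] := derive_coord i j x.
exact: Ck_cst.
Qed.

(** The outer function comes with the tower of its derivatives, so the induction can pass from [F l]
    to [F l.+1]. *)
Lemma Ck_comp1 k l U f (F : nat -> R -> R) : open U ->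
  (forall l (t : R), is_derive t (1 : R) (F l) (F l.+1 t)) ->
  Ck k U f -> Ck k U (fun x => F l (f x)).
Proof.
move=> oU dF.
have cF i t : {for t, continuous (F i)}.
  apply/differentiable_continuous/derivable1_diffP; by have [] := dF i t.
have cFf (g : 'rV[R]_m -> R) (i : nat) x : {for x, continuous g} ->
    {for x, continuous (fun x => F i (g x))}.
  by move=> cg; apply: (@cvg_comp _ _ _ g (F i)); [exact: cg|exact: cF].
elim: k l f => [|k IH] l f Cf; first by split=> // x Ux; exact: cFf (Cf.1 x Ux).
split=> [x Ux|i]; first exact: cFf (Cf.1 x Ux).
have [df ddf] := Cf.2 i.
have D x : U x -> is_derive x (e_ i) (fun x => F l (f x))
    (F l.+1 (f x) * 'D_(e_ i) f x).
  move=> Ux.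
  have d1 : is_derive (0 : R) 1 (fun s : R => f (x + s *: e_ i)) ('D_(e_ i) f x).
    apply: DeriveDef; last by rewrite derive_line scale0r addr0.
    by apply/derivable_line; rewrite scale0r addr0; exact: df.
  have d2 : is_derive ((fun s : R => f (x + s *: e_ i)) 0) 1 (F l) (F l.+1 (f x)).
    by rewrite scale0r addr0; exact: dF.
  have [d3 e3] := is_derive1_comp d2 d1.
  apply: DeriveDef.
    by have /(derivable_line (fun x => F l (f x))) := d3; rewrite scale0r addr0.
  rewrite -e3.
  by rewrite (derive_line (fun x => F l (f x))) scale0r addr0.
split=> [x Ux|]; first by have [] := D x Ux.
apply: Ck_ext (CkM oU (IH l.+1 f (CkW Cf)) ddf) => // x Ux.
by have [_ ->] := D x Ux.
Qed.

Lemma smooth_onS U V f : V `<=` U -> smooth_on U f -> smooth_on V f.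
Proof. by move=> VU sf k; apply: CkS VU (sf k). Qed.

Lemma smooth_derive U f i : smooth_on U f -> smooth_on U (fun x => 'D_(e_ i) f x).
Proof. by move=> sf k; have [_ /(_ i)[]] := sf k.+1. Qed.

Lemma smooth_derivable U f i x : smooth_on U f -> U x -> derivable f x (e_ i).
Proof. by move=> sf Ux; have [_ /(_ i)[df _]] := sf 1; exact: df. Qed.

Lemma smooth_continuous U f x : smooth_on U f -> U x -> {for x, continuous f}.
Proof. by move=> sf Ux; have [cf _] := sf 0; exact: cf. Qed.

End CkTheory.

Section Composition.
Context {R : realType} {m n : nat}.
Implicit Types (f : 'rV[R]_m -> R) (G : 'rV[R]_n -> 'rV[R]_m).

Lemma is_derive_comp U f G x v (dG : 'I_m -> R) : open U -> Ck 1 U f ->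
  U (G x) -> (forall j, is_derive x v (fun x => G x 0 j) (dG j)) ->
  is_derive x v (fun x => f (G x)) (\sum_j 'D_(delta_mx 0 j) f (G x) * dG j).
Proof.
move=> oU Cf UGx dGx.
pose c (s : R) := G (x + s *: v).
have c0 : c 0 = G x by rewrite /c scale0r addr0.
have [|x' j Ux'|j|j|d e] := @chain_curve R m f U c 0 dG oU.
- by rewrite c0.
- by have [df _] := Cf.2 j; exact: df.
- by have [_ [cd _]] := Cf.2 j; apply: cd; rewrite c0.
- have [d <-] := dGx j; apply: DeriveDef.
    by apply/(derivable_line (fun x => G x 0 j)); rewrite scale0r addr0.
  by rewrite (derive_line (fun x => G x 0 j)) scale0r addr0.
rewrite c0 in e; apply: DeriveDef.
  by have /(derivable_line (fun x => f (G x))) := d; rewrite scale0r addr0.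
by rewrite -e (derive_line (fun x => f (G x))) scale0r addr0.
Qed.

Lemma Ck_comp k U V f G : open U -> open V -> Ck k U f ->
  (forall j, Ck k V (fun x => G x 0 j)) -> (forall x, V x -> U (G x)) ->
  Ck k V (fun x => f (G x)).
Proof.
move=> oU oV + + VU.
have cfG (g : 'rV[R]_m -> R) x : (forall x, U x -> {for x, continuous g}) ->
    (forall j, {for x, continuous (fun x => G x 0 j)}) -> V x ->
    {for x, continuous (fun x => g (G x))}.
  move=> cg cG Vx; apply: (@cvg_comp _ _ _ G g); last exact: (cg _ (VU x Vx)).
  exact: (@cvg_row R m _ (nbhs x) (nbhs_filter x) G (G x) cG).
elim: k f => [|k IH] f Cf CG.
  split=> // x Vx; apply: (cfG f x _ _ Vx) => [y Uy|j]; first exact: Cf.1.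
  exact: (CG j).1.
split=> [x Vx|i].
  apply: (cfG f x _ _ Vx) => [y Uy|j]; first exact: Cf.1.
  exact: (CG j).1.
have D x : V x -> is_derive x (delta_mx 0 i) (fun x => f (G x))
    (\sum_j 'D_(delta_mx 0 j) f (G x) * 'D_(delta_mx 0 i) (fun x => G x 0 j) x).
  move=> Vx; apply: is_derive_comp oU _ (VU x Vx) _.
    exact: Ck_Ck1 Cf.
  move=> j; have [dG _] := (CG j).2 i; apply: DeriveDef => //; exact: dG.
split=> [x Vx|]; first by have [] := D x Vx.
have CS : Ck k V (fun x => \sum_j 'D_(delta_mx 0 j) f (G x) *
    'D_(delta_mx 0 i) (fun x => G x 0 j) x).
  apply: Ck_sum => // j; apply: CkM => //.
    apply: (IH (fun y => 'D_(delta_mx 0 j) f y)); first by have [_] := Cf.2 j.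
    by move=> l; exact: CkW (CG l).
  by have [_] := (CG j).2 i.
by apply: Ck_ext CS => // x Vx; have [_ ->] := D x Vx.
Qed.

End Composition.

(** * Plateau functions *)

Section FlatExponential.
Context {R : realType}.
Implicit Types (p q : {poly R}) (t x y : R).

(** The polynomial factor makes the family closed under differentiation; [p = 1] is the usual flat
    function. *)
Definition flat_exp p x := if 0 < x then p.[x^-1] * expR (- x^-1) else 0.

Lemma poly_expRN_bound q : exists2 C, 0 <= C &
  forall y, 1 <= y -> `|q.[y] * expR (- y)| <= C.
Proof.
(* For y at least 1 the polynomial is at most its coefficient sum times y^(n+1), and y^(n+1) /
   (n+1)! is a term of the exponential series. *)
pose n := size q; pose C := (\sum_(i < n) `|q`_i|) * n.+1`!%:R.
have C0 : 0 <= C by rewrite mulr_ge0 ?sumr_ge0.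
exists C => // y y1; have y0 : 0 <= y by apply: le_trans y1.
rewrite normrM (gtr0_norm (expR_gt0 _)) expRN ler_pdivrMr ?expR_gt0//.
have q1 : `|q.[y]| <= (\sum_(i < n) `|q`_i|) * y ^+ n.+1.
  rewrite horner_coef mulr_suml (le_trans (ler_norm_sum _ _ _))//.
  apply: ler_sum => i _; rewrite normrM ler_wpM2l// normrX ger0_norm//.
  by apply: ler_weXn2l => //; rewrite leqW// ltnW//.
apply: le_trans q1 _; rewrite /C -mulrA ler_wpM2l ?sumr_ge0//.
rewrite -ler_pdivrMl ?ltr0n ?fact_gt0// mulrC.
by apply: le_trans (expR_ge1Dxn n y0); rewrite lerDr.
Qed.

Lemma is_derive_flat_exp p x :
  is_derive x (1 : R) (flat_exp p) (flat_exp ('X^2 * (p - p^`())) x).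
Proof.
have [x0|x0|->] := ltgtP x 0.
- rewrite {2}/flat_exp ltNge (ltW x0)/=.
  apply: near_eq_is_derive (is_derive_cst 0 x 1).
  near=> y; rewrite /flat_exp ltNge ltW//=; near: y; exact: lt_nbhsl.
- rewrite {2}/flat_exp x0.
  have dV : is_derive x (1 : R) (fun y : R => y^-1) (- x ^- 2).
    have x0' : x != 0 by rewrite gt_eqF.
    apply: DeriveDef; first exact: (@derivableV R R id x 1).
    by rewrite (@deriveV R R id x 1)// derive_id [LHS]mulr1.
  have d1 : is_derive x (1 : R) (fun y => p.[y^-1]) (p^`().[x^-1] * - x ^- 2).
    exact: (@is_derive1_comp R (horner p) (fun y : R => y^-1)).
  have d2 : is_derive x (1 : R) (fun y => expR (- y^-1)) (expR (- x^-1) * - - x ^- 2).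
    have dN : is_derive x (1 : R) (fun y : R => - y^-1) (- - x ^- 2).
      exact: (is_deriveN dV).
    exact: (@is_derive1_comp R expR (fun y : R => - y^-1) _ _ _ (is_derive_expR _) dN).
  have d3 := is_deriveM d1 d2.
  apply: (@near_eq_is_derive _ _ _ (fun y => p.[y^-1] * expR (- y^-1))).
    near=> y; rewrite /flat_exp ifT//; near: y; exact: lt_nbhsr.
  apply: is_derive_eq d3 _.
  rewrite !hornerE /GRing.scale /= exprVn; ring.
(* At 0 the quotient is h times the value at 1/h of X^2 p times the exponential, hence at most C
   |h|. *)
- have [C C0 hC] := poly_expRN_bound ('X^2 * p).
  rewrite {2}/flat_exp ltxx.
  have q : (fun h : R => h^-1 *: ((flat_exp p \o shift 0) (h *: 1) - flat_exp p 0))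
      @ 0^' --> (0 : R).
    apply/cvgrPdist_le => eps e0; near=> h.
    rewrite sub0r normrN /= {2}/flat_exp ltxx subr0 addr0 [h *: 1]mulr1.
    rewrite /flat_exp; case: ifPn => [h0|_]; last by rewrite scaler0 normr0 ltW.
    have h1 : h < 1.
      apply: le_lt_trans (ler_norm _) _; near: h.
      by apply: dnbhs0_lt.
    have hV : 1 <= h^-1 by rewrite invf_ge1// ltW.
    have := hC _ hV; rewrite !hornerE => b.
    have -> : h^-1 *: (p.[h^-1] * expR (- h^-1)) =
      h * (h^-1 ^+ 2 * p.[h^-1] * expR (- h^-1)).
      by rewrite /GRing.scale /=; field; rewrite gt_eqF.
    rewrite normrM (le_trans (ler_wpM2l _ b))//.
    have : `|h| < eps / (C + 1).
      near: h; apply: dnbhs0_lt; apply: divr_gt0 => //; lra.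
    rewrite ltr_pdivlMr; last lra.
    by move=> hC1; apply: ltW; apply: le_lt_trans hC1; apply: ler_wpM2l => //; lra.
  by apply: DeriveDef; [apply/cvg_ex; eexists; exact: q|exact: cvg_lim q].
Unshelve. all: by end_near. Qed.

End FlatExponential.

Section Bump.
Context {R : realType} {m : nat}.
Implicit Types (f : 'rV[R]_m -> R) (x y c : 'rV[R]_m) (U : set 'rV[R]_m).

Let e : R -> R := flat_exp 1.

Lemma flat_exp_gt0 (t : R) : 0 < t -> 0 < e t.
Proof. by move=> t0; rewrite /e /flat_exp t0 hornerC mul1r expR_gt0. Qed.
Lemma flat_exp_le0 (t : R) : t <= 0 -> e t = 0.
Proof. by move=> t0; rewrite /e /flat_exp ltNge t0. Qed.
Lemma flat_exp_ge0 (t : R) : 0 <= e t.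
Proof.
by have [/flat_exp_le0->|/flat_exp_gt0/ltW] := lerP t 0.
Qed.

Definition smooth_step (t : R) := e t / (e t + e (1 - t)).

Lemma smooth_step_den (t : R) : 0 < e t + e (1 - t).
Proof.
have [t0|t0] := lerP t 0; last by rewrite ltr_wpDr ?flat_exp_ge0// flat_exp_gt0.
by rewrite ltr_wpDl ?flat_exp_ge0// flat_exp_gt0//; lra.
Qed.

Lemma smooth_step0 t : t <= 0 -> smooth_step t = 0.
Proof. by move=> t0; rewrite /smooth_step (flat_exp_le0 t0) mul0r. Qed.

Lemma smooth_step1 t : 1 <= t -> smooth_step t = 1.
Proof.
move=> t1; have := smooth_step_den t; rewrite /smooth_step.
rewrite (@flat_exp_le0 (1 - t)) ?addr0; last lra.
by move=> t0; rewrite divff// gt_eqF.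
Qed.

Lemma Ck_smooth_step k U f : open U -> Ck k U f ->
  Ck k U (fun x => smooth_step (f x)).
Proof.
move=> oU Cf.
pose F l : R -> R := flat_exp (iter l (fun p => 'X^2 * (p - p^`())) 1).
have dF l (t : R) : is_derive t (1 : R) (F l) (F l.+1 t).
  exact: is_derive_flat_exp.
have C0 := Ck_comp1 0 oU dF Cf.
have C1 := Ck_comp1 0 oU dF (CkB oU (Ck_cst k U 1) Cf).
apply: CkM => //; apply: CkV => // [x _|]; last exact: CkD.
by rewrite gt_eqF// smooth_step_den.
Qed.

Lemma plateau c (r : R) : 0 < r -> exists chi : 'rV[R]_m -> R,
  [/\ smooth_on setT chi,
      forall x, (forall j, `|x 0 j - c 0 j| <= r) -> chi x = 1 &
      forall x, chi x != 0 -> forall j, `|x 0 j - c 0 j| < 2 * r].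
Proof.
move=> r0.
(* In each coordinate both arguments are at least 1 up to distance r, and one of them is nonpositive
   from distance 2 r on. *)
pose chi x := \prod_(j < m) (smooth_step (2 - r^-1 * (x 0 j - c 0 j)) *
  smooth_step (2 + r^-1 * (x 0 j - c 0 j))).
exists chi; split=> [k|x xr|x].
- apply: Ck_prod => [|j]; first exact: openT.
  have Cl : Ck k setT (fun x : 'rV[R]_m => r^-1 * (x 0 j - c 0 j)).
    apply: CkM (Ck_cst _ _ _) (CkB openT (Ck_coord _ _ _) (Ck_cst _ _ _)).
    exact: openT.
  apply: CkM; first exact: openT.
    apply: Ck_smooth_step; first exact: openT.
    by apply: CkB (Ck_cst _ _ _) Cl; exact: openT.
  apply: Ck_smooth_step; first exact: openT.
  by apply: CkD (Ck_cst _ _ _) Cl; exact: openT.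
- apply: big1 => j _; have := xr j; rewrite ler_norml => /andP[h1 h2].
  have : r^-1 * (x 0 j - c 0 j) <= 1 by rewrite mulrC ler_pdivrMr// mul1r.
  have : - 1 <= r^-1 * (x 0 j - c 0 j) by rewrite mulrC ler_pdivlMr// mulN1r.
  by move=> h3 h4; rewrite !smooth_step1 ?mulr1//; lra.
- move=> + j; apply: contra_neqT; rewrite -leNgt => jr; apply/eqP.
  rewrite /chi (bigD1 j)//= mulf_eq0; apply/orP; left.
  rewrite mulf_eq0; apply/orP; move: jr; rewrite ler_normr => /orP[] jr.
    left; apply/eqP/smooth_step0.
    by rewrite subr_le0 mulrC ler_pdivlMr.
  right; apply/eqP/smooth_step0.
  rewrite mulrC -lerBrDl sub0r ler_pdivrMr// mulNr; lra.
Qed.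

End Bump.

(** * Hadamard and Poincare lemmas *)

Section Box.
Context {R : realType} {m : nat}.
Implicit Types (F : 'rV[R]_m -> R) (x y q : 'rV[R]_m) (r : R).
Local Notation e_ i := (delta_mx 0 i : 'rV[R]_m).

Definition cbox q r : set 'rV[R]_m := [set x | forall j, `|x 0 j - q 0 j| <= r].

Lemma cbox_compact q r : compact (cbox q r).
Proof.
have -> : cbox q r = [set x | forall j, `[q 0 j - r, q 0 j + r]%classic (x 0 j)].
  apply/seteqP; split=> x bx j; have := bx j; rewrite /= in_itv /= ler_distl//.
exact: (@rV_compact R m (fun j => `[q 0 j - r, q 0 j + r]%classic)
  (fun j => @segment_compact R _ _)).
Qed.

Lemma cbox_ball q r s : r < s -> 0 < s -> cbox q r `<=` ball q s.
Proof.
move=> rs s0 x bx; apply/(ball_rowP _ _ s0) => j.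
by rewrite distrC (le_lt_trans (bx j)).
Qed.

Lemma cbox_bounded q r F : (forall x, cbox q r x -> {for x, continuous F}) ->
  exists2 B, 0 <= B & forall x, cbox q r x -> `|F x| <= B.
Proof.
move=> cF; have : compact (F @` cbox q r).
  apply: continuous_compact; last exact: cbox_compact.
  by apply: continuous_in_subspaceT => x /set_mem; exact: cF.
move/compact_bounded => [B [Br hB]]; exists (`|B| + 1) => [|x bx].
  by rewrite addr_ge0.
apply: (hB (`|B| + 1)); last by exists x.
by rewrite (le_lt_trans (ler_norm _))// ltrDl.
Qed.

End Box.

Section Radial.
Context {R : realType} {m : nat} (q : 'rV[R]_m) (r : R).
Implicit Types (F : 'rV[R]_m -> R) (x y : 'rV[R]_m).
Local Notation e_ i := (delta_mx 0 i : 'rV[R]_m).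
Local Notation mu := (@lebesgue_measure R).
Hypothesis r0 : 0 < r.

(** The weight t^k is there because each derivative in x brings out a factor t. *)
Definition radial k F x : R :=
  \int[mu]_(t in `[0, 1]) (t ^+ k * F (q + t *: (x - q))).

Lemma segment_cbox s x t : 0 <= t <= 1 -> cbox q s x ->
  cbox q s (q + t *: (x - q)).
Proof.
move=> /andP[t0 t1] bx j; rewrite !mxE addrAC subrr add0r normrM (ger0_norm t0).
by have := bx j; apply: le_trans; rewrite ler_piMl.
Qed.

Lemma ball_cbox x : ball q r x -> exists2 s, s < r & cbox q s x /\ 0 <= s.
Proof.
move=> /(ball_rowP _ _ r0) bx.
exists (\big[Num.max/0]_j `|x 0 j - q 0 j|); last split.
- by apply/bigmax_ltP; split=> // j _; rewrite distrC.
- by move=> j; apply: le_bigmax.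
- by apply: bigmax_ge_id.
Qed.

Lemma segment_ball x t : 0 <= t <= 1 -> ball q r x -> ball q r (q + t *: (x - q)).
Proof.
move=> t01 /ball_cbox[s sr [sx s0]]; apply: (cbox_ball sr r0).
exact: segment_cbox.
Qed.

Lemma line_continuous F x (t : R) : {for q + t *: x, continuous F} ->
  {for t, continuous (fun t : R => F (q + t *: x))}.
Proof.
move=> cF; apply: (@cvg_comp _ _ _ (fun t : R => q + t *: x) F); last exact: cF.
by apply: cvgD; [exact: cvg_cst|apply: cvgZr_tmp; exact: cvg_id].
Qed.

Lemma integrand_continuous k F x (t : R) : 0 <= t <= 1 ->
  (forall x, ball q r x -> {for x, continuous F}) -> ball q r x ->
  {for t, continuous (fun t : R => t ^+ k * F (q + t *: (x - q)))}.
Proof.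
move=> t01 cF bx.
have h1 : {for t, continuous (fun t : R => t ^+ k)} by exact: exprn_continuous.
have h2 : {for t, continuous (fun t : R => F (q + t *: (x - q)))}.
  by apply: line_continuous; apply: cF; exact: segment_ball.
exact: (cvgM h1 h2).
Qed.

Lemma integrand_integrable k F x :
  (forall x, ball q r x -> {for x, continuous F}) -> ball q r x ->
  mu.-integrable `[0, 1] (EFin \o (fun t => t ^+ k * F (q + t *: (x - q)))).
Proof.
move=> cF bx; apply: continuous_compact_integrable; first exact: segment_compact.
apply: continuous_in_subspaceT => t /set_mem/=; rewrite in_itv /= => t01.
exact: integrand_continuous.
Qed.

Lemma radial_bound k F s x (B : R) :
  (forall x, ball q r x -> {for x, continuous F}) -> ball q r x ->
  cbox q s x -> (forall x, cbox q s x -> `|F x| <= B) ->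
  `|radial k F x| <= B.
Proof.
move=> cF bx sx FB; have iF := integrand_integrable k cF bx.
apply: (le_trans (le_normr_Rintegral _ iF)); first exact: measurable_itv.
have -> : B = \int[mu]_(_ in `[0, 1]) B.
  rewrite Rintegral_cst//= lebesgue_measure_itv/= lte01 oppr0 adde0 /= mulr1//.
apply: le_Rintegral => //.
- exact: integrable_norm.
- apply: continuous_compact_integrable; first exact: segment_compact.
  by apply: continuous_in_subspaceT => t _; exact: cvg_cst.
- move=> t /=; rewrite in_itv /= => /andP[t0 t1].
  rewrite normrM normrX (ger0_norm t0).
  have h : `|F (q + t *: (x - q))| <= B.
    by apply: FB; apply: segment_cbox => //; rewrite t0.
  apply: le_trans h; rewrite ler_piMl// exprn_ile1//.
Qed.

Lemma radial_derive k F j x : Ck 1 (ball q r) F -> ball q r x ->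
  is_derive x (e_ j) (radial k F) (radial k.+1 (fun x => 'D_(e_ j) F x) x).
Proof.
move=> [cF /(_ j)[dF [cdF _]]] bx.
have [s sr [sx s0]] := ball_cbox bx.
(* Moving x by at most [dl] keeps the segments in a closed box inside the ball, where compactness
   bounds the partial derivative and so dominates the integrand. *)
pose dl := (r - s) / 2; have dl0 : 0 < dl by rewrite divr_gt0// subr_gt0.
have sdr : s + dl < r by rewrite /dl; lra.
have near_x (u : R) : `|u| <= dl -> cbox q (s + dl) (x + u *: e_ j).
  move=> ud i; rewrite !mxE eqxx /=.
  rewrite (_ : _ - _ = x 0 i - q 0 i + u * (i == j)%:R); last by rewrite addrAC.
  apply: le_trans (ler_normD _ _) _; apply: lerD; first exact: sx.
  by case: eqP => _; rewrite ?mulr1// mulr0 normr0 ltW.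
have ball_x u : `|u| <= dl -> ball q r (x + u *: e_ j).
  by move=> /near_x; exact: cbox_ball.
have [B B0 FB] : exists2 B, 0 <= B &
    forall x, cbox q (s + dl) x -> `|'D_(e_ j) F x| <= B.
  apply: (@cbox_bounded _ _ _ _ (fun x => 'D_(e_ j) F x)) => y /(cbox_ball sdr r0).
  exact: cdF.
pose f (u t : R) := t ^+ k * F (q + t *: (x + u *: e_ j - q)).
have df u t : `|u| <= dl -> 0 <= t <= 1 -> is_derive u (1 : R) (f^~ t)
    (t ^+ k.+1 * 'D_(e_ j) F (q + t *: (x + u *: e_ j - q))).
  move=> ud t01.
  have E v : q + t *: (x + v *: e_ j - q) = (q + t *: (x - q)) + (t * v) *: e_ j.
    by rewrite addrAC scalerDr scalerA addrA.
  have -> : f^~ t = (fun v => t ^+ k * F ((q + t *: (x - q)) + (t * v) *: e_ j)).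
    by apply/funext => v; rewrite /f E.
  have d1 : is_derive (t * u) (1 : R)
      (fun w : R => F ((q + t *: (x - q)) + w *: e_ j))
      ('D_(e_ j) F (q + t *: (x + u *: e_ j - q))).
    rewrite E; apply: DeriveDef; last by rewrite derive_line.
    by apply/derivable_line; rewrite -E; apply: dF; exact/segment_ball/ball_x.
  have d2 : is_derive u (1 : R) (fun v : R => t * v) t.
    by have := is_deriveZ t (is_derive_id u (1 : R)); rewrite [t *: 1]mulr1.
  have d3 := @is_derive1_comp R _ (fun v : R => t * v) u _ _ d1 d2.
  have d4 : is_derive u (1 : R)
      (fun v => t ^+ k * F ((q + t *: (x - q)) + (t * v) *: e_ j))
      (t ^+ k * ('D_(e_ j) F (q + t *: (x + u *: e_ j - q)) * t)).
    exact: (is_deriveZ (t ^+ k) d3).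
  by apply: is_derive_eq d4 _; rewrite exprSr; ring.
pose I : set R := `]- dl, dl[%classic.
have Idl u : I u -> `|u| <= dl.
  by rewrite /I /= in_itv /= => /andP[u1 u2]; rewrite ler_norml !ltW.
have I0 : I 0 by rewrite /I /= in_itv /= oppr_lt0 dl0.
have int u : I u -> mu.-integrable `[0, 1] (EFin \o f u).
  by move=> /Idl/ball_x; exact: integrand_integrable.
have der u t : I u -> `[0, 1]%classic t -> derivable (f^~ t) u 1.
  by move=> /Idl ud; rewrite /= in_itv /= => /(df _ _ ud)[].
have p1 u t : `|u| <= dl -> 0 <= t <= 1 -> partial1of2 f u t =
     t ^+ k.+1 * 'D_(e_ j) F (q + t *: (x + u *: e_ j - q)).
  by move=> ud t01; rewrite partial1of2E; have [_ ->] := df _ _ ud t01.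
have iB : mu.-integrable `[0, 1] (EFin \o (fun=> B)).
  apply: continuous_compact_integrable; first exact: segment_compact.
  by apply: continuous_in_subspaceT => t _; exact: cvg_cst.
have ub u t : I u -> `[0, 1]%classic t -> `|partial1of2 f u t| <= B.
  move=> /Idl ud; rewrite /= in_itv /= => t01; rewrite p1//.
  have := FB _ (segment_cbox t01 (near_x u ud)).
  case/andP: t01 => t0 t1; rewrite normrM normrX (ger0_norm t0) => h.
  by apply: le_trans h; rewrite ler_piMl// exprn_ile1.
have dd := @derivable_under_integral R _ _ mu f _ (measurable_itv _) 0 _ _ I0
  int der (fun=> B) (fun _ => B0) iB ub.
have ee := @differentiation_under_integral R _ _ mu f _ (measurable_itv _) 0 _ _ I0
  int der (fun=> B) (fun _ => B0) iB ub.
have Ef : (fun u => \int[mu]_(t in `[0, 1]) f u t) =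
    (fun u => radial k F (x + u *: e_ j)) by [].
rewrite Ef in dd ee; apply: DeriveDef.
  by have /derivable_line := dd; rewrite scale0r addr0.
have := derive_line (radial k F) x (e_ j) 0; rewrite scale0r addr0 => <-.
rewrite -derive1E ee; apply: eq_Rintegral => t /set_mem/=.
by rewrite in_itv /= => t01; rewrite p1 ?scale0r ?addr0// normr0 ltW.
Qed.

(** The partial derivatives given by [radial_derive] are bounded near x, so the mean value theorem
    yields a Lipschitz estimate. *)
Lemma radial_continuous k F x : Ck 1 (ball q r) F -> ball q r x ->
  {for x, continuous (radial k F)}.
Proof.
move=> CF bx; have [s sr [sx s0]] := ball_cbox bx.
pose dl := (r - s) / 2; have dl0 : 0 < dl by rewrite divr_gt0// subr_gt0.
have s'r : s + dl < r by rewrite /dl; lra.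
have sub y : ball x dl y -> cbox q (s + dl) y.
  move=> /(ball_rowP _ _ dl0) h j; rewrite -(subrKA (x 0 j)).
  apply: le_trans (ler_normD _ _) _; rewrite addrC; apply: lerD; first exact: sx.
  by rewrite distrC ltW.
have subr y : ball x dl y -> ball q r y by move=> /sub; exact: cbox_ball.
have cd j y : ball q r y -> {for y, continuous (fun x => 'D_(e_ j) F x)}.
  by have [_ /(_ j)[_ [cdF _]]] := CF; exact: cdF.
have ex j : exists B, 0 <= B /\ forall y, cbox q (s + dl) y -> `|'D_(e_ j) F y| <= B.
  have [B B0 h] := @cbox_bounded _ _ q (s + dl) (fun x => 'D_(e_ j) F x)
    (fun y by_ => cd j y (cbox_ball s'r r0 by_)).
  by exists B.
have {}ex j := cid (ex j).
pose B j := sval (ex j).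
have lip y : ball x dl y ->
    `|radial k F y - radial k F x| <= \sum_j B j * `|y 0 j - x 0 j|.
  move=> by_.
  have dr z j : ball x dl z -> derivable (radial k F) z (e_ j).
    by move=> /subr bz; have [] := radial_derive k j CF bz.
  have [th th1 ->] := mvt_box dr (ballxx _ dl0) by_.
  apply: le_trans (ler_norm_sum _ _ _) _; apply: ler_sum => j _.
  rewrite normrM ler_wpM2r//.
  have bth : ball x dl (th j).
    apply/(ball_rowP _ _ dl0) => i; rewrite distrC (le_lt_trans (th1 j i))//.
    by rewrite distrC; case: by_ => _; exact.
  have [_ ->] := radial_derive k j CF (subr _ bth).
  apply: (radial_bound k.+1 (cd j) (subr _ bth) (sub _ bth)).
  exact: (svalP (ex j)).2.
have c0 : (fun y : 'rV[R]_m => \sum_j B j * `|y 0 j - x 0 j|) @ x --> (0 : R).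
  have e : \sum_j B j * `|x 0 j - x 0 j| = 0.
    by rewrite big1// => j _; rewrite subrr normr0 mulr0.
  rewrite -[X in _ --> X]e.
  apply: (@cvg_sum R _ _ _ (nbhs_filter x) _
    (fun j (y : 'rV[R]_m) => B j * `|y 0 j - x 0 j|)
    (fun j => B j * `|x 0 j - x 0 j|)) => j.
  apply: cvgM; first exact: cvg_cst.
  apply: cvg_norm; apply: cvgB; last exact: cvg_cst.
  exact: coord_continuous.
suff : radial k F @ x --> radial k F x by [].
have FF := nbhs_filter x.
apply: (proj2 (@cvgrPdist_lt _ _ _ _ FF _ _)) => eps e0; near=> y.
rewrite distrC (le_lt_trans (lip y _))//.
  by near: y; apply/nbhs_ballP; exists dl.
apply: le_lt_trans (ler_norm _) _.
near: y; have /cvgrPdist_lt/(_ _ e0) := c0.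
by apply: filterS => y; rewrite sub0r normrN.
Unshelve. all: by end_near. Qed.

Lemma Ck_radial l k F : smooth_on (ball q r) F -> Ck l (ball q r) (radial k F).
Proof.
elim: l k F => [|l IH] k F sF.
  by split=> // x bx; apply: radial_continuous => //; exact: sF 1.
split=> [x bx|j]; first by apply: radial_continuous => //; exact: sF 1.
split=> [x bx|]; first by have [] := radial_derive k j (sF 1) bx.
have oB : open (ball q r) by exact: ball_open.
apply: Ck_ext (IH k.+1 _ (smooth_derive j sF)) => // x bx.
by have [_ ->] := radial_derive k j (sF 1) bx.
Qed.

Lemma ftc01 (f F : R -> R) :
  (forall t : R, 0 <= t <= 1 -> is_derive t (1 : R) F (f t)) ->
  (forall t : R, 0 <= t <= 1 -> {for t, continuous f}) ->
  \int[mu]_(t in `[0, 1]) f t = F 1 - F 0.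
Proof.
move=> dF cf.
have cF t : 0 <= t <= 1 -> {for t, continuous F}.
  move=> t01; apply/differentiable_continuous/derivable1_diffP.
  by have [] := dF t t01.
rewrite /Rintegral (@continuous_FTC2 R f F 0 1)//=.
- by apply: continuous_in_subspaceT => t /set_mem/=; rewrite in_itv /=; exact: cf.
- split=> [t||].
  + by rewrite in_itv /= => /andP[t0 t1]; have [] := dF t; rewrite // !ltW.
  + by apply: cvg_at_right_filter; apply: cF; rewrite lexx ler01.
  + by apply: cvg_at_left_filter; apply: cF; rewrite lexx ler01.
- move=> t; rewrite in_itv /= => /andP[t0 t1]; rewrite derive1E.
  by have [|_ ->] := dF t; rewrite // !ltW.
Qed.

Lemma integrable_scale (a : R) (f : R -> R) :
  mu.-integrable `[0, 1] (EFin \o f) ->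
  mu.-integrable `[0, 1] (EFin \o (fun t => a * f t)).
Proof.
move=> fi; have -> : EFin \o (fun t => a * f t) = (fun t => a%:E * (f t)%:E)%E.
  by apply/funext => t /=; rewrite EFinM.
by apply: integrableZl => //; exact: measurable_itv.
Qed.

Lemma Rintegral_sum (I : Type) (s : seq I) (f : I -> R -> R) :
  (forall i, mu.-integrable `[0, 1] (EFin \o f i)) ->
  mu.-integrable `[0, 1] (EFin \o (fun t => \sum_(i <- s) f i t)) /\
  \int[mu]_(t in `[0, 1]) (\sum_(i <- s) f i t) =
    \sum_(i <- s) \int[mu]_(t in `[0, 1]) f i t.
Proof.
move=> fi; elim: s => [|i s [IH1 IH2]].
  have -> : (fun t : R => \sum_(i <- [::]) f i t) = fun=> 0.
    by apply/funext => t; rewrite big_nil.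
  by rewrite big_nil Rintegral_cst//= mul0r; split=> //; exact: integrable0.
have -> : (fun t : R => \sum_(j <- i :: s) f j t) =
    (fun t => f i t + \sum_(j <- s) f j t).
  by apply/funext => t; rewrite big_cons.
rewrite big_cons; split; last by rewrite RintegralD// IH2.
by apply: (integrableD _ (fi i) IH1); exact: measurable_itv.
Qed.

Lemma is_derive_segment F x (t : R) : Ck 1 (ball q r) F -> ball q r x -> 0 <= t <= 1 ->
  is_derive t (1 : R) (fun t : R => F (q + t *: (x - q)))
    (\sum_j 'D_(e_ j) F (q + t *: (x - q)) * (x 0 j - q 0 j)).
Proof.
move=> CF bx t01; have bt := segment_ball t01 bx.
apply: (chain_curve (U := ball q r) (c := fun t => q + t *: (x - q))) => //.
- exact: ball_open.
- by move=> y j; have [_ /(_ j)[dF _]] := CF; exact: dF.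
- by move=> j; have [_ /(_ j)[_ [cdF _]]] := CF; exact: cdF.
move=> j; have -> : (fun s : R => (q + s *: (x - q)) 0 j) =
    (fun s => q 0 j + s * (x 0 j - q 0 j)) by apply/funext => s; rewrite !mxE.
have d1 := is_deriveM (is_derive_id t (1 : R)) (is_derive_cst (x 0 j - q 0 j) t (1 : R)).
have := is_deriveD (is_derive_cst (q 0 j) t (1 : R)) d1.
by move/is_derive_eq; apply; rewrite add0r scaler0 add0r [_%:A]mulr1.
Qed.

(** The fundamental theorem of calculus along the segment from q to x. *)
Lemma hadamard F x : smooth_on (ball q r) F -> ball q r x ->
  F x - F q = \sum_j (x 0 j - q 0 j) * radial 0 (fun x => 'D_(e_ j) F x) x.
Proof.
move=> sF bx; have cD j y : ball q r y -> {for y, continuous (fun x => 'D_(e_ j) F x)}.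
  exact: smooth_continuous (smooth_derive j sF).
have ij j := integrand_integrable 0 (cD j) bx.
have -> : F x - F q = \int[mu]_(t in `[0, 1])
    (\sum_j (x 0 j - q 0 j) * (t ^+ 0 * 'D_(e_ j) F (q + t *: (x - q)))).
  have -> : F x - F q = F (q + 1 *: (x - q)) - F (q + 0 *: (x - q)).
    by rewrite scale1r scale0r addr0 subrKC.
  symmetry; apply: (@ftc01 (fun t => \sum_j (x 0 j - q 0 j) *
      (t ^+ 0 * 'D_(e_ j) F (q + t *: (x - q)))) (fun t => F (q + t *: (x - q)))).
  - move=> t t01; apply: is_derive_eq (is_derive_segment (sF 1) bx t01) _.
    by apply: eq_bigr => j _; rewrite mul1r mulrC.
  - move=> t t01; apply: (@cvg_sum R _ _ _ (nbhs_filter t)) => j.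
    have := integrand_continuous (k := 0) t01 (cD j) bx.
    exact: (cvgM (cvg_cst (x 0 j - q 0 j))).
have [|_ ->] := @Rintegral_sum _ (index_enum 'I_m) (fun j t =>
   (x 0 j - q 0 j) * (t ^+ 0 * 'D_(e_ j) F (q + t *: (x - q)))).
  by move=> j; exact: integrable_scale (ij j).
by apply: eq_bigr => j _; rewrite RintegralZl.
Qed.

Lemma poincare (a : 'I_m -> 'rV[R]_m -> R) :
  (forall i, smooth_on (ball q r) (a i)) ->
  (forall i j x, ball q r x -> 'D_(e_ i) (a j) x = 'D_(e_ j) (a i) x) ->
  exists2 u : 'rV[R]_m -> R, smooth_on (ball q r) u &
  forall i x, ball q r x -> 'D_(e_ i) u x = a i x.
Proof.
move=> sa closed; have oB : open (ball q r) by exact: ball_open.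
(* The homotopy formula: the integral of the form along the segment from q to x. *)
exists (fun x => \sum_j (x 0 j - q 0 j) * radial 0 (a j) x).
  move=> k; apply: Ck_sum => // j; apply: CkM => //; last exact: Ck_radial.
  by apply: CkB => //; [exact: Ck_coord|exact: Ck_cst].
move=> i x bx.
have cD j y : ball q r y -> {for y, continuous (fun x => 'D_(e_ j) (a i) x)}.
  exact: smooth_continuous (smooth_derive j (sa i)).
have ij j := integrand_integrable 1 (cD j) bx.
have ca y : ball q r y -> {for y, continuous (a i)}.
  exact: smooth_continuous (sa i).
have i0 := integrand_integrable 0 ca bx.
have dj j : is_derive x (e_ i) (fun x => (x 0 j - q 0 j) * radial 0 (a j) x)
    ((x 0 j - q 0 j) * radial 1 (fun x => 'D_(e_ j) (a i) x) x
     + (i == j)%:R * radial 0 (a j) x).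
  have -> : radial 1 (fun x => 'D_(e_ j) (a i) x) x =
      radial 1 (fun x => 'D_(e_ i) (a j) x) x.
    apply: eq_Rintegral => t /set_mem/=; rewrite in_itv /= => t01.
    by rewrite closed//; exact: segment_ball.
  have d1 := is_deriveB (derive_coord i j x) (is_derive_cst (q 0 j) x (e_ i)).
  have d2 := is_deriveM d1 (radial_derive 0 i (sa j 1) bx).
  by apply: is_derive_eq d2 _; rewrite subr0 /GRing.scale /= (mulrC (radial _ _ _)).
have -> : 'D_(e_ i) (fun x => \sum_j (x 0 j - q 0 j) * radial 0 (a j) x) x =
    \sum_j ((x 0 j - q 0 j) * radial 1 (fun x => 'D_(e_ j) (a i) x) x
     + (i == j)%:R * radial 0 (a j) x).
  have -> : (fun x => \sum_j (x 0 j - q 0 j) * radial 0 (a j) x) =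
     \sum_j (fun x => (x 0 j - q 0 j) * radial 0 (a j) x).
    by apply/funext => y; rewrite fct_sumE.
  rewrite derive_sum => [|j]; last by have [] := dj j.
  by apply: eq_bigr => j _; have [_ ->] := dj j.
rewrite big_split /= [X in _ + X](bigD1 i)//= eqxx mul1r [X in _ + (_ + X)]big1 ?addr0.
  (* After closedness has exchanged the indices, the derivative of the primitive is the integral of
     d/dt of t a_i(q + t (x - q)). *)
  have -> : a i x = \int[mu]_(t in `[0, 1])
     (\sum_j (x 0 j - q 0 j) * (t ^+ 1 * 'D_(e_ j) (a i) (q + t *: (x - q)))
      + t ^+ 0 * a i (q + t *: (x - q))).
    have -> : a i x = 1 * a i (q + 1 *: (x - q)) - 0 * a i (q + 0 *: (x - q)).
      by rewrite scale1r mul0r mul1r subrKC subr0.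
    symmetry; apply: (@ftc01 (fun t => \sum_j (x 0 j - q 0 j) *
      (t ^+ 1 * 'D_(e_ j) (a i) (q + t *: (x - q))) + t ^+ 0 * a i (q + t *: (x - q)))
      (fun t => t * a i (q + t *: (x - q)))).
    - move=> t t01.
      have d := is_deriveM (is_derive_id t (1 : R)) (is_derive_segment (sa i 1) bx t01).
      apply: is_derive_eq d _; rewrite /GRing.scale /= mulr1 expr0 mul1r mulr_sumr.
      by congr (_ + _); apply: eq_bigr => j _; rewrite expr1; ring.
    - move=> t t01; apply: cvgD; last exact: (integrand_continuous (k := 0) t01 ca bx).
      apply: (@cvg_sum R _ _ _ (nbhs_filter t)) => j.
      have := integrand_continuous (k := 1) t01 (cD j) bx.
      exact: (cvgM (cvg_cst (x 0 j - q 0 j))).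
  have [|is_ es] := @Rintegral_sum _ (index_enum 'I_m) (fun j t =>
     (x 0 j - q 0 j) * (t ^+ 1 * 'D_(e_ j) (a i) (q + t *: (x - q)))).
    by move=> j; exact: integrable_scale (ij j).
  rewrite RintegralD// es; congr (_ + _).
  by apply: eq_bigr => j _; rewrite RintegralZl.
by move=> j ji; rewrite eq_sym (negPf ji) mul0r.
Qed.

End Radial.

(** * Taking a function as a coordinate *)

Section Straightening.
Context {R : realType} {m : nat} (k l : 'I_m) (u : 'rV[R]_m -> R).
Context (y0 : 'rV[R]_m) (r : R).
Implicit Types (x y z w : 'rV[R]_m).
Local Notation e_ i := (delta_mx 0 i : 'rV[R]_m).
Local Notation V := (ball y0 r).
Hypothesis r0 : 0 < r.
Hypothesis su : smooth_on V u.
Hypothesis du : forall y, V y -> 0 < 'D_(e_ k) u y.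

(** [u] takes slot l and the coordinate y_k is dropped, y_l moving to slot k; the transposition
    covers the case k = l as well. *)
Definition straight y : 'rV[R]_m :=
  \row_i (if i == l then u y else y 0 (tperm k l i)).
Local Notation Psi := straight.

Lemma straight_l y : Psi y 0 l = u y.
Proof. by rewrite mxE eqxx. Qed.

Lemma tperm_neq i : i != l -> tperm k l i != k.
Proof. by apply: contra_neq => e; rewrite -(tpermK k l i) e tpermL. Qed.

Lemma straight_neq y j : j != k -> Psi y 0 (tperm k l j) = y 0 j.
Proof.
move=> jk; rewrite mxE tpermK; case: eqP => // e.
by rewrite -(tpermK k l j) e tpermR eqxx in jk.
Qed.

(** V is convex, so the segment stays inside it and the positive derivative along e_k applies. *)
Lemma straight_mono y (s t : R) : V (y + s *: e_ k) -> V (y + t *: e_ k) ->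
  s < t -> u (y + s *: e_ k) < u (y + t *: e_ k).
Proof.
move=> Vs Vt st.
have seg v : 0 <= v <= t - s -> V (y + s *: e_ k + v *: e_ k).
  move=> /andP[v0 vt]; rewrite -addrA -scalerDl; apply/(ball_rowP _ _ r0) => j.
  move/(ball_rowP _ _ r0): Vs => /(_ j); move/(ball_rowP _ _ r0): Vt => /(_ j).
  rewrite !mxE eqxx /=; case: eqP => _; last by rewrite !mulr0.
  by rewrite !mulr1 !ltr_norml => /andP[a1 a2] /andP[b1 b2]; apply/andP; split; lra.
have ts : 0 < t - s by rewrite subr_gt0.
have rng v : `|v| <= `|t - s| -> 0 <= v * (t - s) -> 0 <= v <= t - s.
  rewrite (gtr0_norm ts) pmulr_lge0// => h v0; rewrite v0 /=.
  by rewrite ger0_norm in h.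
have [|v [v1 v2 e]] := @mvt_line R _ u (y + s *: e_ k) (e_ k) (t - s).
  by move=> v v1 v2; apply: smooth_derivable su _; apply: seg; exact: rng.
rewrite -subr_gt0; move: e; rewrite -addrA -scalerDl subrKC => ->.
by rewrite pmulr_lgt0//; apply: du; apply: seg; exact: rng.
Qed.

Lemma straight_inj y z : V y -> V z -> Psi y = Psi z -> y = z.
Proof.
move=> Vy Vz e.
have off j : j != k -> y 0 j = z 0 j.
  by move=> jk; rewrite -!(straight_neq _ jk) e.
have yz : y = z + (y 0 k - z 0 k) *: e_ k.
  apply/rowP => j; rewrite !mxE eqxx /=.
  have [->|jk] := eqVneq j k; first by rewrite mulr1 subrKC.
  by rewrite mulr0 addr0 off.
have zz : z = z + 0 *: e_ k by rewrite scale0r addr0.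
have uu : u y = u z by rewrite -!straight_l e.
have [h|h|h] := ltgtP (y 0 k - z 0 k) 0.
- have := @straight_mono z _ 0 _ _ h; rewrite -yz -zz uu ltxx.
  by move=> /(_ Vy Vz).
- have := @straight_mono z 0 _ _ _ h; rewrite -yz -zz uu ltxx.
  by move=> /(_ Vz Vy).
- by rewrite yz h scale0r addr0.
Qed.

(** Only one coordinate of the preimage is unknown, so the intermediate value theorem along e_k
    replaces the inverse function theorem. *)
Lemma straight_onto y1 (eps : R) : V y1 -> 0 < eps ->
  exists2 dl : R, 0 < dl & forall w, ball (Psi y1) dl w ->
    exists y, [/\ V y, ball y1 eps y & Psi y = w].
Proof.
move=> Vy1 eps0.
have [rho rho0 rhoV] := open_ballP (ball_open y0 r) Vy1.
pose e1 := Num.min eps rho / 2.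
have e10 : 0 < e1 by rewrite divr_gt0// lt_min eps0.
have e1e : e1 < eps.
  apply: (@lt_le_trans _ _ (Num.min eps rho)); last by rewrite ge_min lexx.
  by rewrite /e1 ltr_pdivrMr// ltr_pMr ?ltr1n// lt_min eps0.
have e1r : e1 < rho.
  apply: (@lt_le_trans _ _ (Num.min eps rho)); last by rewrite ge_min lexx orbT.
  by rewrite /e1 ltr_pdivrMr// ltr_pMr ?ltr1n// lt_min eps0.
have inV z : (forall j, `|z 0 j - y1 0 j| <= e1) -> V z.
  by move=> h; apply: rhoV; exact: (cbox_ball e1r rho0).
have pV s : `|s| <= e1 -> V (y1 + s *: e_ k).
  move=> se; apply: inV => j; rewrite !mxE eqxx /= addrAC subrr add0r.
  by case: eqP => _; rewrite ?mulr1// mulr0 normr0 ltW.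
have y1E : y1 = y1 + 0 *: e_ k by rewrite scale0r addr0.
pose yl := y1 + (- e1) *: e_ k; pose yh := y1 + e1 *: e_ k.
have Vl : V yl by apply: pV; rewrite normrN gtr0_norm.
have Vh : V yh by apply: pV; rewrite gtr0_norm.
have ul : u yl < u y1.
  have -> : u y1 = u (y1 + 0 *: e_ k) by rewrite -y1E.
  by apply: straight_mono; rewrite -?y1E// oppr_lt0.
have uh : u y1 < u yh.
  have -> : u y1 = u (y1 + 0 *: e_ k) by rewrite -y1E.
  by apply: straight_mono; rewrite -?y1E.
(* Half of the smaller gap: if [w 0 l] and the end values of [u] each move by less than [al], then
   [w 0 l] stays strictly between them. *)
pose al := Num.min (u yh - u y1) (u y1 - u yl) / 2.
have al0 : 0 < al by rewrite divr_gt0// lt_min !subr_gt0 ul uh.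
have alh : 2 * al <= u yh - u y1.
  by rewrite /al mulrC divfK// ge_min lexx.
have all : 2 * al <= u y1 - u yl.
  by rewrite /al mulrC divfK// ge_min lexx orbT.
have cu z : V z -> exists2 d : R, 0 < d & forall y, ball z d y -> `|u z - u y| < al.
  move=> Vz; have cz := smooth_continuous su Vz.
  have /cvgrPdist_lt/(_ _ al0)/nbhs_ballP[d /= d0 h] : u @ z --> u z by exact: cz.
  by exists d.
have [dlo dlo0 hlo] := cu _ Vl; have [dhi dhi0 hhi] := cu _ Vh.
pose dl := Num.min (Num.min dlo dhi) (Num.min al e1).
have dl0 : 0 < dl by rewrite !lt_min dlo0 dhi0 al0.
have [d1 d2 d3 d4] : [/\ dl <= dlo, dl <= dhi, dl <= al & dl <= e1].
  by split; rewrite /dl !ge_min lexx ?orbT.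
exists dl => // w /(ball_rowP _ _ dl0) bw.
(* All coordinates but the k-th are dictated by [w]; it remains to solve [u (z s) = w 0 l] for s. *)
pose z (s : R) : 'rV[R]_m := \row_j (if j == k then s else w 0 (tperm k l j)).
have zj s j : j != k -> `|z s 0 j - y1 0 j| < dl.
  move=> jk; rewrite mxE (negPf jk) -(straight_neq _ jk) distrC; exact: bw.
have zk s : z s 0 k = s by rewrite mxE eqxx.
have zV s : `|s - y1 0 k| <= e1 -> V (z s).
  move=> se; apply: inV => j; have [->|jk] := eqVneq j k; first by rewrite zk.
  by apply: ltW; apply: lt_le_trans d4; exact: zj.
have zb (s d : R) : `|s| <= e1 -> dl <= d -> 0 < d ->
    ball (y1 + s *: e_ k) d (z (y1 0 k + s)).
  move=> se dd d0; apply/(ball_rowP _ _ d0) => j.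
  have [->|jk] := eqVneq j k.
    by rewrite zk !mxE !eqxx /= mulr1 subrr normr0.
  rewrite distrC; apply: lt_le_trans dd.
  have -> : (y1 + s *: e_ k) 0 j = y1 0 j.
    by rewrite !mxE eqxx (negPf jk) /= mulr0 addr0.
  exact: zj.
have flo : u (z (y1 0 k - e1)) < w 0 l.
  have := hlo _ (zb (- e1) dlo _ d1 dlo0); rewrite normrN gtr0_norm// lexx => /(_ isT).
  have := bw l; rewrite straight_l !ltr_norml => /andP[a1 a2] /andP[b1 b2].
  lra.
have fhi : w 0 l < u (z (y1 0 k + e1)).
  have := hhi _ (zb e1 dhi _ d2 dhi0); rewrite gtr0_norm// lexx => /(_ isT).
  have := bw l; rewrite straight_l !ltr_norml => /andP[a1 a2] /andP[b1 b2].
  lra.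
have itvE s : s \in `[y1 0 k - e1, y1 0 k + e1] -> `|s - y1 0 k| <= e1.
  by rewrite in_itv /= ler_distl.
have cz : {within `[y1 0 k - e1, y1 0 k + e1], continuous (fun s => u (z s))}.
  apply: continuous_in_subspaceT => s /set_mem/itvE/zV Vz.
  apply: (@cvg_comp _ _ _ z u _ (nbhs (z s))); last exact: smooth_continuous su Vz.
  apply: (@cvg_row R m _ (nbhs s) (nbhs_filter s) z (z s)) => j.
  have [->|jk] := eqVneq j k.
    have -> : (fun t => z t 0 k) = id by apply/funext => t; rewrite zk.
    by rewrite zk; exact: cvg_id.
  have -> : (fun t => z t 0 j) = fun=> w 0 (tperm k l j).
    by apply/funext => t; rewrite mxE (negPf jk).
  by rewrite mxE (negPf jk); exact: cvg_cst.
have ab : y1 0 k - e1 <= y1 0 k + e1 by lra.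
have [|s sI us] := @IVT R _ _ _ (w 0 l) ab cz.
  by rewrite ge_min le_max (ltW flo) (ltW fhi) orbT.
have se := itvE _ sI.
exists (z s); split; first exact: zV.
- apply/(ball_rowP _ _ eps0) => j; rewrite distrC; have [->|jk] := eqVneq j k.
    by rewrite zk (le_lt_trans se).
  by apply: lt_trans e1e; apply: lt_le_trans d4; exact: zj.
- apply/rowP => i; rewrite mxE; case: eqP => [->//|/eqP il].
  by rewrite mxE (negPf (tperm_neq il)) tpermK.
Qed.

End Straightening.

Section StraighteningInverse.
Context {R : realType} {m : nat} (k l : 'I_m) (u : 'rV[R]_m -> R).
Context (y0 : 'rV[R]_m) (r : R).
Implicit Types (x y z w : 'rV[R]_m).
Local Notation e_ i := (delta_mx 0 i : 'rV[R]_m).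
Local Notation V := (ball y0 r).
Hypothesis r0 : 0 < r.
Hypothesis su : smooth_on V u.
Hypothesis du : forall y, V y -> 0 < 'D_(e_ k) u y.
Local Notation Psi := (straight k l u).

(** The default [y0] is taken off the image of V. *)
Definition unstraight w : 'rV[R]_m := xget y0 [set y | V y /\ Psi y = w].
Local Notation Phi := unstraight.

Lemma unstraightP w : (Psi @` V) w -> V (Phi w) /\ Psi (Phi w) = w.
Proof.
by move=> [y Vy e]; rewrite /Phi; case: xgetP => [z _ //|/(_ y)]; case.
Qed.

Lemma unstraightK y : V y -> Phi (Psi y) = y.
Proof.
move=> Vy; have [|V1 e] := @unstraightP (Psi y); first by exists y.
exact: (straight_inj r0 su du V1 Vy e).
Qed.

Lemma open_straight : open (Psi @` V).
Proof.
rewrite openE => _ [y Vy <-]; have [dl dl0 h] := straight_onto l r0 su du Vy r0.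
by apply/nbhs_ballP; exists dl => // w /h[z [Vz _ <-]]; exists z.
Qed.

Lemma unstraight_continuous w : (Psi @` V) w -> {for w, continuous Phi}.
Proof.
move=> Vw; have [V1 e] := unstraightP Vw.
apply: (proj2 (@cvg_ballP R _ _ _ (nbhs_filter w) Phi (Phi w))) => eps eps0.
have [dl dl0 h] := straight_onto l r0 su du V1 eps0.
rewrite e in h; apply/nbhs_ballP; exists dl => // w' /h[z [Vz bz <-]].
by rewrite /= unstraightK.
Qed.

Lemma smooth_straight j : smooth_on V (fun y => Psi y 0 j).
Proof.
have -> : (fun y => Psi y 0 j) = if j == l then u else fun y => y 0 (tperm k l j).
  by apply/funext => y; rewrite mxE; case: eqP.
by case: eqP => // _ d; exact: Ck_coord.
Qed.

(* Partial derivative along [e_ i] of the j-th coordinate of the inverse, as a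
   function on [V]; for [j = k] it comes from the implicit function theorem. *)
Definition jac i j y : R := if j == k then
    ((i == l)%:R - \sum_(j' | j' != k) 'D_(e_ j') u y * (i == tperm k l j')%:R)
      / 'D_(e_ k) u y
  else (i == tperm k l j)%:R.

Lemma smooth_jac i j : smooth_on V (jac i j).
Proof.
move=> d; have oV : open V by exact: ball_open.
have [->|jk] := eqVneq j k; last first.
  have -> : jac i j = fun=> (i == tperm k l j)%:R.
    by apply/funext => y; rewrite /jac (negPf jk).
  exact: Ck_cst.
have -> : jac i k = fun y => ((i == l)%:R - \sum_(j' | j' != k)
    'D_(e_ j') u y * (i == tperm k l j')%:R) * ('D_(e_ k) u y)^-1.
  by apply/funext => y; rewrite /jac eqxx.
have Cd j' : Ck d V (fun y => 'D_(e_ j') u y) by exact: (smooth_derive j' su d).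
apply: CkM => //; last first.
  by apply: CkV => // y Vy; rewrite gt_eqF// du.
apply: CkB => //; first exact: Ck_cst.
have -> : (fun y => \sum_(j' | j' != k) 'D_(e_ j') u y * (i == tperm k l j')%:R) =
    (fun y => \sum_j' ('D_(e_ j') u y * (i == tperm k l j')%:R * (j' != k)%:R)).
  apply/funext => y; rewrite big_mkcond; apply: eq_bigr => j' _.
  by case: (j' != k); rewrite ?mulr1 ?mulr0.
apply: Ck_sum => // j'; apply: CkM => //; last exact: Ck_cst.
by apply: CkM => //; exact: Ck_cst.
Qed.

(** Continuity of the inverse suffices. The increments of its coordinates other than the k-th are
    explicit, and [mvt_box] applied to [u] is a linear equation for the k-th, solvable because the
    derivative along e_k is nonzero. *)
Lemma derive_unstraight i j w : (Psi @` V) w ->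
  is_derive w (e_ i) (fun w => Phi w 0 j) (jac i j (Phi w)).
Proof.
move=> Vw; have [V1 e1] := unstraightP Vw.
have cP : Phi @ w --> Phi w by exact: unstraight_continuous.
pose W h : 'rV[R]_m := h *: e_ i + w.
have cW : W h @[h --> 0^'] --> w.
  have : W h @[h --> (0 : R)] --> w.
    have h0 : h *: e_ i @[h --> (0 : R)] --> (0 : 'rV[R]_m).
      by rewrite -(scale0r (e_ i)); apply: cvgZr_tmp; exact: cvg_id.
    suff : W h @[h --> (0 : R)] --> 0 + w by rewrite add0r.
    by apply: cvgD h0 _; exact: cvg_cst.
  exact: cvg_within_filter.
have nV : \forall h \near 0^', (Psi @` V) (W h).
  exact: (cW _ (open_nbhs_nbhs (conj open_straight Vw))).
have cPW : Phi (W h) @[h --> 0^'] --> Phi w.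
  exact: (@cvg_comp _ _ _ W Phi _ (nbhs w) _ cW cP).
have off h j' : (Psi @` V) (W h) -> j' != k ->
    Phi (W h) 0 j' - Phi w 0 j' = h * (i == tperm k l j')%:R.
  move=> Vh jk; have [V2 e2] := unstraightP Vh.
  rewrite -!(straight_neq l u _ jk) e1 e2 !mxE eqxx /= addrK eq_sym.
  by [].
have quotE h : (fun h : R => h^-1 *: (((fun w => Phi w 0 j) \o shift w) (h *: e_ i)
    - Phi w 0 j)) h = h^-1 * (Phi (W h) 0 j - Phi w 0 j) by [].
suff q : (fun h : R => h^-1 *: (((fun w => Phi w 0 j) \o shift w) (h *: e_ i)
    - Phi w 0 j)) @ 0^' --> (jac i j (Phi w) : R).
  by apply: DeriveDef; [apply/cvg_ex; eexists; exact: q|exact: cvg_lim q].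
have [jk|jk] := eqVneq j k; last first.
  apply: (@cvg_trans _ ((cst (jac i j (Phi w)) : R -> R) @ 0^')); last exact: cvg_cst.
  apply: near_eq_cvg; near=> h; have h0 : h != 0 by near: h; exact: nbhs_dnbhs_neq.
  have Vh : (Psi @` V) (W h) by near: h; exact: nV.
  by rewrite quotE off// mulrA mulVf// mul1r /jac (negPf jk).
rewrite jk in quotE *.
have ex h : exists th : 'I_m -> 'rV[R]_m, (Psi @` V) (W h) ->
    (forall j i, `|th j 0 i - Phi w 0 i| <= `|Phi (W h) 0 i - Phi w 0 i|) /\
    u (Phi (W h)) - u (Phi w) =
      \sum_j 'D_(e_ j) u (th j) * (Phi (W h) 0 j - Phi w 0 j).
  have [Vh|Vh] := pselect ((Psi @` V) (W h)); last by exists (fun _ => 0).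
  have [V2 e2] := unstraightP Vh.
  have [th th1 th2] := mvt_box (fun z j bz => smooth_derivable (i := j) su bz) V1 V2.
  by exists th.
have /choice[th thP] := ex.
have thc j' : th h j' @[h --> 0^'] --> Phi w.
  apply/cvg_ballP => eps eps0; near=> h; apply/ball_rowP => // i'.
  have Vh : (Psi @` V) (W h) by near: h; exact: nV.
  have bh : ball (Phi w) eps (Phi (W h)).
    by near: h; move/cvg_ballP: cPW; exact.
  rewrite distrC (le_lt_trans ((thP h Vh).1 j' i'))// distrC.
  by case: bh => _; exact.
have thD j' : 'D_(e_ j') u (th h j') @[h --> 0^'] --> 'D_(e_ j') u (Phi w).
  apply: (@cvg_comp _ _ _ (fun h => th h j') (fun y => 'D_(e_ j') u y) _ _ _ (thc j')).
  exact: smooth_continuous (smooth_derive j' su) V1.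
pose q h := ((i == l)%:R - \sum_(j' | j' != k)
   'D_(e_ j') u (th h j') * (i == tperm k l j')%:R) / 'D_(e_ k) u (th h k).
have qc : q @ 0^' --> (jac i k (Phi w) : R).
  rewrite /jac eqxx; apply: cvgM.
    apply: cvgB; first exact: cvg_cst.
    rewrite big_mkcond /=.
    have -> : (fun h => \sum_(j' | j' != k)
        'D_(e_ j') u (th h j') * (i == tperm k l j')%:R) =
      (fun h => \sum_j' (if j' != k then
        'D_(e_ j') u (th h j') * (i == tperm k l j')%:R else 0)).
      by apply/funext => h; rewrite big_mkcond.
    apply: cvg_sum => j'; case: (j' != k); last exact: cvg_cst.
    by apply: cvgM; [exact: thD|exact: cvg_cst].
  by apply: cvgV; [rewrite gt_eqF// du|exact: thD].
apply: cvg_trans qc; apply: near_eq_cvg; near=> h.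
have h0 : h != 0 by near: h; exact: nbhs_dnbhs_neq.
have Vh : (Psi @` V) (W h) by near: h; exact: nV.
have [V2 e2] := unstraightP Vh.
have Dk : 0 < 'D_(e_ k) u (th h k).
  near: h; exact: (cvgr_gt _ (thD k)) (du V1).
rewrite quotE.
have := (thP h Vh).2; rewrite -!(straight_l k l) e1 e2.
rewrite (bigD1 k)//=.
have -> : W h 0 l - w 0 l = h * (i == l)%:R.
  by rewrite !mxE eqxx /= addrK eq_sym.
have -> : \sum_(j' < m | j' != k)
    'D_(e_ j') u (th h j') * (Phi (W h) 0 j' - Phi w 0 j') =
  h * \sum_(j' | j' != k) 'D_(e_ j') u (th h j') * (i == tperm k l j')%:R.
  by rewrite mulr_sumr; apply: eq_bigr => j' jk'; rewrite off// mulrCA.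
move/eqP; rewrite -subr_eq -mulrBr => /eqP e.
rewrite /q; apply: (mulfI (lt0r_neq0 Dk)).
by rewrite [RHS]mulrCA -e [RHS]mulrA mulVf// mul1r mulrC divfK// gt_eqF.
Unshelve. all: by end_near. Qed.

(** A partial derivative of f o Phi is again a smooth function on V composed with Phi, so the
    induction runs over all f at once. *)
Lemma smooth_unstraight f : smooth_on V f -> smooth_on (Psi @` V) (fun w => f (Phi w)).
Proof.
move=> + d; elim: d f => [|d IH] f sf.
  split=> // w Vw; apply: (@cvg_comp _ _ _ Phi f _ (nbhs (Phi w))).
    exact: unstraight_continuous.
  exact: smooth_continuous sf (unstraightP Vw).1.
split=> [w Vw|i].
  apply: (@cvg_comp _ _ _ Phi f _ (nbhs (Phi w))).
    exact: unstraight_continuous.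
  exact: smooth_continuous sf (unstraightP Vw).1.
have oV : open V by exact: ball_open.
have D w : (Psi @` V) w -> is_derive w (e_ i) (fun w => f (Phi w))
    (\sum_j 'D_(e_ j) f (Phi w) * jac i j (Phi w)).
  move=> Vw; apply: (is_derive_comp oV (sf 1) (unstraightP Vw).1) => j.
  exact: derive_unstraight.
split=> [w Vw|]; first by have [] := D w Vw.
apply: (@Ck_ext R m d _ (fun w => \sum_j 'D_(e_ j) f (Phi w) * jac i j (Phi w))).
- exact: open_straight.
- by move=> w Vw; have [_ ->] := D w Vw.
apply: (IH (fun y => \sum_j 'D_(e_ j) f y * jac i j y)) => d'.
apply: Ck_sum => // j; apply: CkM => //; last exact: smooth_jac.
exact: smooth_derive.
Qed.

End StraighteningInverse.

(** * Vector fields in charts *)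

Section ChartTopology.
Context {R : realType} {T : topologicalType} {m : nat} (c : @chart R T m).
Implicit Types (W : set 'rV[R]_m) (O : set T).

Lemma chart_continuous_at p : chart_dom c p -> {for p, continuous c}.
Proof.
move=> cp; have := @chart_cont _ _ _ c.
rewrite continuous_open_subspace; last exact: chart_dom_open.
by apply; rewrite inE.
Qed.

Lemma chart_inv_continuous_at x : chart_im c x -> {for x, continuous (chart_inv c)}.
Proof.
move=> cx; have := @chart_inv_cont _ _ _ c.
rewrite continuous_open_subspace; last exact: chart_im_open.
by apply; rewrite inE.
Qed.

Lemma open_chart_preimage W : open W -> open (chart_dom c `&` c @^-1` W).
Proof.
move=> oW; rewrite openE => p [cp Wp]; apply: filterI.
  by apply: open_nbhs_nbhs; split=> //; exact: chart_dom_open.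
by apply: (chart_continuous_at cp); exact: open_nbhs_nbhs.
Qed.

Lemma open_chart_image O : open O -> open (c @` (chart_dom c `&` O)).
Proof.
move=> oO; rewrite openE => _ [p [cp Op] <-].
have icp : chart_im c (c p) by exists p.
have n1 : nbhs (c p) (chart_im c).
  by apply: open_nbhs_nbhs; split=> //; exact: chart_im_open.
have n2 : nbhs (c p) (chart_inv c @^-1` O).
  apply: (chart_inv_continuous_at icp); rewrite (chart_mapK cp).
  exact: open_nbhs_nbhs.
apply: filterS (filterI n1 n2) => _ [[q cq <-] /=]; rewrite (chart_mapK cq) => Oq.
by exists q.
Qed.

Lemma chart_inj p q : chart_dom c p -> chart_dom c q -> c p = c q -> p = q.
Proof. by move=> cp cq e; rewrite -(chart_mapK cp) e chart_mapK. Qed.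

Lemma chart_invP x : chart_im c x -> chart_dom c (chart_inv c x) /\ c (chart_inv c x) = x.
Proof. by move=> [p cp <-]; rewrite chart_mapK. Qed.

End ChartTopology.

(** * Cutoffs and extension by zero *)

Section Smooth.
Context {R : realType} {m : nat} {M : manifold R m}.
Implicit Types (p q : M) (c : @chart R M m) (F : 'rV[R]_m -> R).

Lemma is_smooth_local (f : M -> R) :
  (forall p, exists c, exists W, [/\ @atlas R m M c, chart_dom c p, open W, W (c p) &
    smooth_on W (f \o chart_inv c)]) -> is_smooth f.
Proof.
move=> loc c' ac' k; apply: Ck_local => _ [p cp' <-].
have [c [W [ac cp oW Wcp sf]]] := loc p.
pose O := chart_dom c `&` c @^-1` W.
have oO : open O by exact: open_chart_preimage.
pose V := c' @` (chart_dom c' `&` O).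
have oV : open V by exact: open_chart_image.
exists V; split; first by exists p.
have sG j : Ck k V (fun x => c (chart_inv c' x) 0 j).
  apply: CkS (atlas_smooth ac' ac j k) => _ [q [cq' [cq _]] <-].
  by exists q.
have VW x : V x -> W (c (chart_inv c' x)).
  by move=> [q [cq' [cq Wq]] <-]; rewrite (chart_mapK cq').
apply: Ck_ext (Ck_comp oW oV (sf k) sG VW) => // _ [q [cq' [cq Wq]] <-] /=.
by rewrite (chart_mapK cq') (chart_mapK cq).
Qed.

Lemma smooth_funE (f : smooth_fun M) c : @atlas R m M c ->
  smooth_on (chart_im c) (f \o chart_inv c).
Proof. by move=> ac; have /asboolP := smooth_fun_prop f; exact. Qed.

Definition cutoff c (chi F : 'rV[R]_m -> R) : M -> R :=
  fun q => if `[< chart_dom c q >] then chi (c q) * F (c q) else 0.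

Lemma cutoff_dom c chi F q : chart_dom c q -> cutoff c chi F q = chi (c q) * F (c q).
Proof. by move=> cq; rewrite /cutoff asboolT. Qed.

Lemma cutoff_out c chi F q : ~ chart_dom c q -> cutoff c chi F q = 0.
Proof. by move=> cq; rewrite /cutoff asboolF. Qed.

Lemma is_smooth_cutoff c chi F (x : 'rV[R]_m) (r s : R) W : @atlas R m M c ->
  smooth_on setT chi -> (forall y, chi y != 0 -> cbox x s y) ->
  s < r -> 0 < r -> ball x r `<=` W -> open W -> W `<=` chart_im c ->
  smooth_on W F -> is_smooth (cutoff c chi F).
Proof.
move=> ac schi chi0 sr r0 rW oW Wc sF.
(* [K] is compact, hence closed as M is Hausdorff; near a point outside it the cutoff is identically
   zero, even at the boundary of the chart domain. *)
pose K := chart_inv c @` cbox x s.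
have sW : cbox x s `<=` W by move=> y /(cbox_ball sr r0)/rW.
have Kc : closed K.
  apply: compact_closed; first exact: mfd_hausdorff.
  apply: continuous_compact; last exact: cbox_compact.
  apply: continuous_in_subspaceT => y /set_mem/sW/Wc.
  exact: chart_inv_continuous_at.
apply: is_smooth_local => p; have [[y sy yp]|Kp] := pselect (K p).
  have [cp cpy] := chart_invP (Wc _ (sW _ sy)).
  rewrite yp in cp cpy; exists c, W; split=> //; first by rewrite cpy; exact: sW.
  move=> k; apply: Ck_ext (CkM oW (CkS (@subsetT _ _) (schi k)) (sF k)) => //.
  by move=> z /Wc/chart_invP[cz cze]; rewrite /= cutoff_dom// cze.
have [c1 ac1 c1p] := @atlas_cover R m M p.
exists c1; exists (c1 @` (chart_dom c1 `&` ~` K)); split=> //.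
- by apply: open_chart_image; exact: closed_openC.
- by exists p.
move=> k; have oW1 : open (c1 @` (chart_dom c1 `&` ~` K)).
  by apply: open_chart_image; exact: closed_openC.
apply: Ck_ext (Ck_cst k _ 0) => // _ [q [c1q Kq] <-] /=.
rewrite (chart_mapK c1q); have [cq|cq] := pselect (chart_dom c q); last first.
  by rewrite cutoff_out.
rewrite cutoff_dom//; have [->|] := eqVneq (chi (c q)) 0; first by rewrite mul0r.
by move/chi0 => bq; case: Kq; exists (c q) => //; rewrite chart_mapK.
Qed.

Record chart_bump c (p : M) (W : set 'rV[R]_m) := ChartBump {
  bump_rad : R;
  bump_out : R;
  bump_fct : 'rV[R]_m -> R;
  bump_rad_gt0 : 0 < bump_rad;
  bump_out_gt : bump_rad < bump_out;
  bump_smooth : smooth_on setT bump_fct;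
  bump1 : forall y, ball (c p) bump_rad y -> bump_fct y = 1;
  bump_supp : forall y, bump_fct y != 0 -> cbox (c p) (2 * bump_rad) y;
  bump_out2 : 2 * bump_rad < bump_out;
  bump_sub : ball (c p) bump_out `<=` W }.

Lemma chart_bump_ex c p W : open W -> W (c p) -> inhabited (chart_bump c p W).
Proof.
move=> oW Wp; have [s s0 sW] := open_ballP oW Wp.
(* A quarter keeps the support radius 2 r strictly below s. *)
pose r := s / 4; have r0 : 0 < r by rewrite divr_gt0.
have [chi [schi chi1 chi0]] := plateau (c p) r0.
constructor; apply: (@ChartBump _ _ _ r s chi) => //.
- by rewrite /r; lra.
- move=> y /(ball_rowP _ _ r0) b; apply: chi1 => j.
  by rewrite distrC ltW.
- by move=> y /chi0 h j; rewrite ltW.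
- by rewrite /r; lra.
Qed.

Lemma cutoff_smooth c p W (b : chart_bump c p W) F : @atlas R m M c ->
  open W -> W `<=` chart_im c -> smooth_on W F ->
  is_smooth (cutoff c (bump_fct b) F).
Proof.
move=> ac oW Wc sF.
have r0 := bump_rad_gt0 b; have r1 := bump_out_gt b.
apply: (@is_smooth_cutoff c _ F (c p) (bump_out b) (2 * bump_rad b) W) => //.
- exact: bump_smooth.
- exact: bump_supp.
- exact: bump_out2.
- exact: lt_trans r1.
- exact: bump_sub.
Qed.

Lemma smooth_extension c p W F : @atlas R m M c -> chart_dom c p ->
  open W -> W (c p) -> W `<=` chart_im c -> smooth_on W F ->
  exists (f : smooth_fun M) (O : set M), [/\ open O, O p, O `<=` chart_dom c &
    forall q, O q -> f q = F (c q)].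
Proof.
move=> ac cp oW Wp Wc sF; have [b] := chart_bump_ex oW Wp.
have sm : cutoff c (bump_fct b) F \in @smooth_pred R m M.
  by apply/asboolP; exact: cutoff_smooth.
exists (SmoothFun sm), (chart_dom c `&` c @^-1` ball (c p) (bump_rad b)); split.
- by apply: open_chart_preimage; exact: ball_open.
- by split=> //; apply: ballxx; exact: bump_rad_gt0.
- by move=> q [].
- by move=> q [cq bq] /=; rewrite cutoff_dom// (bump1 bq) mul1r.
Qed.

Lemma bump_fun p (O : set M) : open O -> O p ->
  exists b : smooth_fun M, b p = 1 /\ forall q, ~ O q -> b q = 0.
Proof.
move=> oO Op; have [c ac cp] := @atlas_cover R m M p.
pose W := c @` (chart_dom c `&` O).
have oW : open W by exact: open_chart_image.
have Wp : W (c p) by exists p.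
have Wc : W `<=` chart_im c by move=> _ [q [cq _] <-]; exists q.
have [b] := chart_bump_ex oW Wp.
have sm : cutoff c (bump_fct b) (fun=> 1) \in @smooth_pred R m M.
  by apply/asboolP; apply: cutoff_smooth => // k; exact: Ck_cst.
exists (SmoothFun sm); split=> [|q Oq] /=.
  by rewrite cutoff_dom// mulr1 bump1//; apply: ballxx; exact: bump_rad_gt0.
have [cq|cq] := pselect (chart_dom c q); last by rewrite cutoff_out.
rewrite cutoff_dom// mulr1; have [//|/bump_supp bq] := eqVneq (bump_fct b (c q)) 0.
have o0 : 0 < bump_out b by apply: lt_trans (bump_out_gt b); exact: bump_rad_gt0.
have [q' [cq' Oq'] e] := bump_sub (cbox_ball (bump_out2 b) o0 bq).
by case: Oq; rewrite -(chart_inj cq' cq e).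
Qed.

End Smooth.

Local Arguments smooth_fun_val : simpl never.

(** * Derivations: locality and coordinate expansion *)

Section VectorFieldTheory.
Context {R : realType} {m : nat} {M : manifold R m}.
Implicit Types (p q : M) (c : @chart R M m) (f h : smooth_fun M) (X : vfield M).

Lemma smooth_funP f h : (forall p, f p = h p) -> f = h.
Proof. by move=> fh; apply/val_inj/funext. Qed.

Lemma smoothD f h p : (f + h) p = f p + h p. Proof. by []. Qed.
Lemma smoothN f p : (- f) p = - f p. Proof. by []. Qed.
Lemma smoothM f h p : (f * h) p = f p * h p. Proof. by []. Qed.
Lemma smooth0 p : @smooth_fun_val R m M 0 p = 0. Proof. by []. Qed.
Lemma smooth1 p : @smooth_fun_val R m M 1 p = 1. Proof. by []. Qed.
Lemma smooth_cstE (a : R) p : smooth_cst M a p = a. Proof. by []. Qed.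
Lemma smooth_sum (I : Type) (s : seq I) (F : I -> smooth_fun M) p :
  (\sum_(i <- s) F i) p = \sum_(i <- s) F i p.
Proof. by elim: s => [|i s IH]; rewrite ?big_nil// !big_cons smoothD IH. Qed.
Definition smoothE := (smoothD, smoothN, smoothM, smooth0, smooth1, smooth_cstE).

Lemma vfield0 X : X 0 = 0.
Proof. by apply: (addrI (X 0)); rewrite -vfieldD !addr0. Qed.
Lemma vfieldN X f : X (- f) = - X f.
Proof. by apply: (addrI (X f)); rewrite -vfieldD !subrr vfield0. Qed.
Lemma vfield1 X : X 1 = 0.
Proof.
have := vfield_leibniz X 1 1; rewrite !mulr1 mul1r => e.
by apply: (addrI (X 1)); rewrite -e addr0.
Qed.
Lemma vfield_cst X (a : R) : X (smooth_cst M a) = 0.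
Proof.
have := vfield_linear X a 1 0; rewrite !vfield0 vfield1 mulr0 !addr0.
by rewrite mulr1.
Qed.
Lemma vfield_sum X (I : Type) (s : seq I) (F : I -> smooth_fun M) :
  X (\sum_(i <- s) F i) = \sum_(i <- s) X (F i).
Proof. by apply: (big_morph _ (vfieldD X) (vfield0 X)). Qed.

(** With a bump b at q supported in O, b (f - h) = 0; the Leibniz rule at q then leaves X (f - h) q
    = 0. *)
Lemma vfield_local X f h (O : set M) q : open O -> O q ->
  (forall q, O q -> f q = h q) -> X f q = X h q.
Proof.
move=> oO Oq fh; have [b [bq b0]] := bump_fun oO Oq.
have e : b * (f - h) = 0.
  apply: smooth_funP => q'; rewrite !smoothE.
  have [Oq'|/b0->] := pselect (O q'); last by rewrite mul0r.
  by rewrite fh// subrr mulr0.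
have := f_equal (fun F => smooth_fun_val F q) (vfield_leibniz X b (f - h)).
rewrite e vfield0 vfieldD vfieldN !smoothE bq fh// subrr mulr0 add0r mul1r.
by move/esym/eqP; rewrite subr_eq0 => /eqP.
Qed.

Lemma derive_near (V : set 'rV[R]_m) (F G : 'rV[R]_m -> R) x v : open V -> V x ->
  (forall y, V y -> F y = G y) -> 'D_v F x = 'D_v G x.
Proof.
move=> oV Vx FG; apply: near_eq_derive.
by apply: filterS (open_nbhs_nbhs (conj oV Vx)) => y /FG.
Qed.

Section CoordField.
Context {c} {p : M} {W : set 'rV[R]_m} (ac : @atlas R m M c).
Context (oW : open W) (Wc : W `<=` chart_im c).
Context (b : chart_bump c p W) (i : 'I_m).

Let F f := fun y => 'D_(delta_mx 0 i) (f \o chart_inv c) y.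

Lemma coord_field_smooth f : cutoff c (bump_fct b) (F f) \in @smooth_pred R m M.
Proof.
apply/asboolP; apply: cutoff_smooth => //; apply: smooth_derive.
by apply: smooth_onS (smooth_funE f ac).
Qed.

Let fld f : smooth_fun M := SmoothFun (coord_field_smooth f).

Let fldE f q : fld f q = cutoff c (bump_fct b) (F f) q. Proof. by []. Qed.

Lemma derivable_chart f q : chart_dom c q ->
  derivable (f \o chart_inv c) (c q) (delta_mx 0 i).
Proof.
move=> cq; have icq : chart_im c (c q) by exists q.
exact: smooth_derivable (smooth_funE f ac) icq.
Qed.

Lemma coord_field_linear (a : R) f h :
  fld (smooth_cst M a * f + h) = smooth_cst M a * fld f + fld h.
Proof.
apply: smooth_funP => q; rewrite !(smoothE, fldE).
have [cq|cq] := pselect (chart_dom c q); last by rewrite !cutoff_out// mulr0 addr0.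
rewrite !cutoff_dom// /F mulrCA -mulrDr; congr (_ * _).
have df := derivable_chart (f := f) cq; have dh := derivable_chart (f := h) cq.
have d1 := is_deriveZ a (DeriveDef df erefl).
by have [_] := is_deriveD d1 (DeriveDef dh erefl).
Qed.

Lemma coord_field_leibniz f h : fld (f * h) = fld f * h + f * fld h.
Proof.
apply: smooth_funP => q; rewrite !(smoothE, fldE).
have [cq|cq] := pselect (chart_dom c q).
  rewrite !cutoff_dom// /F.
  have df := derivable_chart (f := f) cq; have dh := derivable_chart (f := h) cq.
  have [_ e] := is_deriveM (DeriveDef df erefl) (DeriveDef dh erefl).
  have -> : 'D_(delta_mx 0 i) (f * h \o chart_inv c) (c q) =
      f q * 'D_(delta_mx 0 i) (h \o chart_inv c) (c q) +
      h q * 'D_(delta_mx 0 i) (f \o chart_inv c) (c q).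
    by rewrite -[in f q](chart_mapK cq) -[in h q](chart_mapK cq); exact: e.
  ring.
by rewrite !cutoff_out// mulr0 mul0r addr0.
Qed.

Definition coord_field : vfield M := VField coord_field_linear coord_field_leibniz.

Lemma coord_fieldE q f : chart_dom c q -> ball (c p) (bump_rad b) (c q) ->
  coord_field f q = coord_vector c i q f.
Proof.
by move=> cq bq; rewrite /= /smooth_fun_val /= cutoff_dom// (bump1 bq) mul1r.
Qed.

End CoordField.

(* By Hadamard's lemma, near [q] the function [f] is [f q] plus a sum of products
   [(x i - x i q) * g i] with [g i] smooth and equal at [q] to the partial derivative. *)
Lemma vfield_expansion c q (x : 'I_m -> smooth_fun M) (O : set M) X f :
  @atlas R m M c -> open O -> O q -> O `<=` chart_dom c ->
  (forall i q, O q -> x i q = c q 0 i) ->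
  X f q = \sum_i X (x i) q * coord_vector c i q f.
Proof.
move=> ac oO Oq Oc xc; have cq := Oc _ Oq.
pose W := c @` (chart_dom c `&` O).
have oW : open W by exact: open_chart_image.
have Wq : W (c q) by exists q.
have Wc : W `<=` chart_im c by move=> _ [q' [cq' _] <-]; exists q'.
have [r r0 rW] := open_ballP oW Wq.
pose F := f \o chart_inv c.
have sF : smooth_on (ball (c q) r) F.
  by apply: smooth_onS (smooth_funE f ac) => y /rW/Wc.
pose G i := radial (c q) 0 (fun y => 'D_(delta_mx 0 i) F y).
have sG i : smooth_on (ball (c q) r) (G i).
  by move=> k; apply: Ck_radial => //; exact: smooth_derive.
have ext i : exists g : smooth_fun M, exists N : set M,
    [/\ open N, N q & forall q', N q' -> g q' = G i (c q')].
  have [|g [N [oN Nq _ gG]]] :=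
    smooth_extension ac cq (ball_open (c q) r) (ballxx _ r0) _ (sG i).
    by move=> y /rW/Wc.
  by exists g, N.
have /choice[g hg] := ext.
have /choice[N hO] := hg.
pose N' := O `&` (chart_dom c `&` c @^-1` ball (c q) r) `&`
  [set q' | forall i, N i q'].
have oN' : open N'.
  apply: openI.
    by apply: openI => //; apply: open_chart_preimage; exact: ball_open.
  rewrite openE => q' h; apply: filter_forall => i.
  by apply: open_nbhs_nbhs; split; [have [] := hO i|exact: h].
have N'q : N' q.
  split; first by split=> //; split=> //; exact: ballxx.
  by move=> i; have [] := hO i.
pose h := smooth_cst M (f q) + \sum_i (x i - smooth_cst M (c q 0 i)) * g i.
have fh q' : N' q' -> f q' = h q'.
  move=> [[Oq' [cq' bq']] Nq']; rewrite /h smoothD smooth_cstE smooth_sum.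
  have := hadamard r0 sF bq'; rewrite /F /= !chart_mapK// => /(canRL (subrK _)) ->.
  rewrite addrC; congr (_ + _); apply: eq_bigr => i _.
  by rewrite !smoothE xc//; have [_ _ ->] := hO i; last exact: Nq'.
rewrite (vfield_local X oN' N'q fh) /h vfieldD vfield_cst add0r vfield_sum.
rewrite smooth_sum; apply: eq_bigr => i _.
rewrite vfield_leibniz vfieldD vfieldN vfield_cst oppr0 addr0 !smoothE xc//.
rewrite subrr mul0r addr0; congr (_ * _); have [_ Nq ->//] := hO i.
(* At the centre of the ball the integrand is constant, so the Hadamard factor is the partial
   derivative itself. *)
rewrite /G /radial subrr; under eq_Rintegral do rewrite expr0 mul1r scaler0 addr0.
by rewrite Rintegral_cst//= lebesgue_measure_itv/= lte01 oppr0 adde0 /= mulr1.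
Qed.

(** Coordinates and coordinate fields are made global by a cutoff, so they agree with those of the
    chart only on a neighbourhood of p. *)
Record chart_frame c p := ChartFrame {
  frame_vec : 'I_m -> vfield M;
  frame_coord : 'I_m -> smooth_fun M;
  frame_nbhs : set M;
  frame_open : open frame_nbhs;
  frame_base : frame_nbhs p;
  frame_dom : frame_nbhs `<=` chart_dom c;
  frame_coordE : forall i q, frame_nbhs q -> frame_coord i q = c q 0 i;
  frame_vecE : forall i q f, frame_nbhs q ->
    frame_vec i f q = coord_vector c i q f;
  frame_expansion : forall X f q, frame_nbhs q ->
    X f q = \sum_i X (frame_coord i) q * frame_vec i f q;
  frame_dual : forall i j q, frame_nbhs q ->
    frame_vec i (frame_coord j) q = (i == j)%:R }.

Lemma chart_frame_ex c p : @atlas R m M c -> chart_dom c p ->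
  inhabited (chart_frame c p).
Proof.
move=> ac cp.
have oc : open (chart_im c) by exact: chart_im_open.
have pc : chart_im c (c p) by exists p.
have [b] := chart_bump_ex oc pc.
have sx i : cutoff c (bump_fct b) (fun y => y 0 i) \in @smooth_pred R m M.
  by apply/asboolP; apply: cutoff_smooth => // k; exact: Ck_coord.
pose x i := SmoothFun (sx i).
pose E i := coord_field ac oc (@subset_refl _ _) b i.
pose O := chart_dom c `&` c @^-1` ball (c p) (bump_rad b).
have oO : open O by apply: open_chart_preimage; exact: ball_open.
have Op : O p by split=> //; apply: ballxx; exact: bump_rad_gt0.
have Oc : O `<=` chart_dom c by move=> q [].
have xE i q : O q -> x i q = c q 0 i.
  by move=> [cq bq]; rewrite /x /smooth_fun_val /= cutoff_dom// (bump1 bq) mul1r.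
have EE i q f : O q -> E i f q = coord_vector c i q f.
  by move=> [cq bq]; exact: coord_fieldE.
constructor; apply: (@ChartFrame _ _ E x O) => //.
  move=> X f q Oq; rewrite (vfield_expansion X f ac oO Oq Oc xE).
  by apply: eq_bigr => i _; rewrite EE.
move=> i j q Oq; rewrite EE//.
have [_ <-] := derive_coord i j (c q).
apply: (@derive_near (c @` (chart_dom c `&` O))).
- exact: open_chart_image.
- by exists q => //; split=> //; exact: Oc.
- by move=> _ [q' [cq' Oq'] <-] /=; rewrite chart_mapK// xE.
Qed.

End VectorFieldTheory.

(** * A nearly Kenmotsu manifold as a contact calculus *)

Section Instance.
Context {R : realType} {m : nat} {M : manifold R m}.
Implicit Types (p q : M) (f h : smooth_fun M) (X Y Z : vfield M).

Lemma frame_decomposition c p (F : chart_frame c p) (b : smooth_fun M) Z :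
  (forall q, ~ frame_nbhs F q -> b q = 0) ->
  b *: Z = \sum_i (b * Z (frame_coord F i)) *: frame_vec F i.
Proof.
move=> b0; apply: vfieldP => f; apply: smooth_funP => q.
rewrite (big_morph (fun V : vfield M => V f) (fun V W => erefl) erefl).
rewrite /= smooth_sum smoothM.
have [Fq|b0q] := pselect (frame_nbhs F q).
  rewrite (frame_expansion Z f Fq) mulr_sumr; apply: eq_bigr => i _.
  by rewrite !smoothM mulrA.
rewrite (b0 _ b0q) mul0r big1// => i _.
by rewrite !smoothM (b0 _ b0q) !mul0r.
Qed.

Section Metric.
Context (g : riemannian_metric M) (D : levi_civita g).

Lemma metric0l Z : g 0 Z = 0.
Proof.
have := Defs.metric_linear g 1 0 0 Z; rewrite scale1r addr0 mul1r => e.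
by apply: (addrI (g 0 Z)); rewrite -e addr0.
Qed.
Lemma metricB X Y Z : g (X - Y) Z = g X Z - g Y Z.
Proof.
have a X1 Y1 Z1 : g (X1 + Y1) Z1 = g X1 Z1 + g Y1 Z1.
  by have := Defs.metric_linear g 1 X1 Y1 Z1; rewrite scale1r mul1r.
by apply: (addIr (g Y Z)); rewrite -a !subrK.
Qed.

(** X - Y is orthogonal to itself, so positivity leaves no point at which it is nonzero. *)
Lemma metric_inj X Y : (forall Z, g X Z = g Y Z) -> X = Y.
Proof.
move=> XY; apply/eqP; rewrite -subr_eq0; apply/eqP/vfieldP => f.
apply: smooth_funP => p; apply/eqP; apply: contraT => Xf.
have := metric_pos g (ex_intro _ f Xf).
by rewrite metricB XY subrr smooth0 ltxx.
Qed.

Lemma lie_bracket_jacobi X Y Z : lie_bracket X (lie_bracket Y Z) +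
  lie_bracket Y (lie_bracket Z X) + lie_bracket Z (lie_bracket X Y) = 0.
Proof.
apply: vfieldP => f; apply: smooth_funP => p.
rewrite /= !(vfieldD, vfieldN, smoothE); ring.
Qed.

Definition manifold_calculus : @metric_calculus R (smooth_fun M) (vfield M).
Proof.
refine (@MetricCalculus R (smooth_fun M) (vfield M) M (fun p f => f p) _ _ _ _
  (fun X f => X f) _ _ _ g _ _ _ D _ _ _ _ _ _) => //.
- exact: smooth_funP.
- exact: vfieldD.
- exact: vfield_leibniz.
- exact: Defs.metric_sym.
- exact: Defs.metric_linear.
- exact: metric_inj.
- exact: nabla_linear.
- exact: nabla_add.
- exact: nabla_leibniz.
- exact: nabla_metric.
- by move=> X Y f; rewrite (nabla_torsion_free D).
- by move=> X Y Z /=; rewrite !(nabla_torsion_free D); exact: lie_bracket_jacobi.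
Defined.

Context (phi0 : tensor11 M) (xi0 : vfield M) (eta0 : oneform M).
Hypothesis acm : almost_contact_metric phi0 xi0 eta0 g.
Hypothesis nk : nearly_kenmotsu phi0 eta0 D.

Definition kenmotsu_calculus : @contact_calculus R (smooth_fun M) (vfield M).
Proof.
refine (@ContactCalculus R (smooth_fun M) (vfield M) manifold_calculus phi0 _ _
  xi0 eta0 _ _ _ _ _ _).
- by move=> X Y; rewrite raddfD.
- by move=> f X; rewrite linearZ.
- by move=> X Y; rewrite raddfD.
- by move=> f X; rewrite linearZ.
- exact: acm_phi2 acm.
- exact: acm_eta_xi acm.
- exact: acm_compat acm.
- exact: nk.
Defined.

Lemma ext_deriv_eq0 X Y : ext_deriv eta0 X Y = 0.
Proof.
have := d_eta_shape (c := kenmotsu_calculus) X Y.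
rewrite /= (nabla_torsion_free D) -/(ext_deriv eta0 X Y) => ->.
apply: smooth_funP => p; rewrite smoothM smooth0.
have [c ac cp] := @atlas_cover R m M p.
have [F] := chart_frame_ex ac cp.
(* [b] serves as the cutoff [psi] of the trace argument. *)
have [b [bp b0]] := bump_fun (frame_open F) (frame_base F).
have := @shape_eq0 R (smooth_fun M) (vfield M) kenmotsu_calculus m
  (frame_vec F) (frame_coord F) b (smooth_cst M) _ _ _ _ p X Y.
move=> /= ->; rewrite ?mulr0//.
- by move=> Z; exact: frame_decomposition.
- move=> i j; apply: smooth_funP => q; rewrite !smoothM.
  have [Fq|/b0->] := pselect (frame_nbhs F q); last by rewrite !mul0r.
  rewrite (frame_dual _ _ Fq); case: eqP => _; by rewrite ?smoothE.
- by move=> q Z f Zf; apply: metric_pos; exists f.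
- by rewrite bp oner_eq0.
Qed.

Lemma exact_tensor_eq0 (H : tensor11 M) :
  (forall X Y, ext_deriv eta0 X Y = g (H X) Y) -> forall X, H X = 0.
Proof.
by move=> gH X; apply: metric_inj => Y; rewrite -gH ext_deriv_eq0 metric0l.
Qed.

End Metric.
End Instance.

(** * Flat charts *)

Section StraightChart.
Context {R : realType} {m : nat} {M : manifold R m}.
Context (c : @chart R M m) (k l : 'I_m) (u : 'rV[R]_m -> R).
Context (y0 : 'rV[R]_m) (r : R).
Local Notation V := (ball y0 r).
Local Notation Psi := (straight k l u).
Local Notation Phi := (unstraight k l u y0 r).
Hypothesis r0 : 0 < r.
Hypothesis ac : @atlas R m M c.
Hypothesis Vc : V `<=` chart_im c.
Hypothesis su : smooth_on V u.
Hypothesis du : forall y, V y -> 0 < 'D_(delta_mx 0 k) u y.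

Let dom := chart_dom c `&` c @^-1` V.

Lemma straight_im : [set Psi (c q) | q in dom] = Psi @` V.
Proof.
apply/seteqP; split=> [_ [q [cq Vq] <-]|_ [y Vy <-]]; first by exists (c q).
have [cy e] := chart_invP (Vc Vy).
by exists (chart_inv c y); rewrite ?e//; split=> //; rewrite /= e.
Qed.

(** By maximality of the atlas it suffices that the transitions to and from every chart are smooth;
    composing with Phi or Psi reduces them to those of c. *)
Lemma straight_chart_ex : exists c' : @chart R M m,
  [/\ @atlas R m M c', chart_dom c' = dom & forall q, c' q = Psi (c q)].
Proof.
have od : open dom by apply: open_chart_preimage; exact: ball_open.
have oi : open [set Psi (c q) | q in dom].
  by rewrite straight_im; exact: open_straight.
have mK q : dom q -> chart_inv c (Phi (Psi (c q))) = q.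
  by move=> [cq Vq]; rewrite unstraightK// chart_mapK.
have cP q : dom q -> {for q, continuous (fun q => Psi (c q))}.
  move=> [cq Vq]; apply: (@cvg_comp _ _ _ c Psi _ (nbhs (c q))).
    exact: chart_continuous_at.
  apply: (@cvg_row R m _ (nbhs (c q)) (nbhs_filter (c q)) Psi) => j.
  exact: smooth_continuous (smooth_straight k l su j) Vq.
have cI w : (Psi @` V) w -> {for w, continuous (fun w => chart_inv c (Phi w))}.
  move=> Vw; apply: (@cvg_comp _ _ _ Phi (chart_inv c) _ (nbhs (Phi w))).
    exact: (unstraight_continuous r0 su du Vw).
  apply: chart_inv_continuous_at; apply: Vc.
  by have [] := unstraightP Vw.
have ct : {within dom, continuous (fun q => Psi (c q))}.
  by rewrite continuous_open_subspace// => q /set_mem; exact: cP.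
have it : {within [set Psi (c q) | q in dom],
    continuous (fun w => chart_inv c (Phi w))}.
  rewrite continuous_open_subspace// => w /set_mem; rewrite straight_im.
  exact: cI.
pose c' := @Chart R M m dom _ _ od oi mK ct it.
exists c'; split=> //; apply: atlas_max => c1 ac1; split=> j d.
- have oT : open (c @` (chart_dom c `&` chart_dom c1)).
    by apply: open_chart_image; exact: chart_dom_open.
  have sT := atlas_smooth ac ac1 j d.
  have -> : (fun x => c1 (chart_inv c' x) 0 j) =
     (fun w => (fun y => c1 (chart_inv c y) 0 j) (Phi w)) by [].
  apply: (Ck_comp oT _ sT).
  + by apply: open_chart_image; exact: chart_dom_open.
  + move=> i; have := @smooth_unstraight R m k l u y0 r r0 su du (fun y => y 0 i)
      (fun d => Ck_coord d _ i) d; apply: CkS.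
    by move=> _ [q [[cq Vq] _] <-]; exists (c q).
  + move=> _ [q [[cq Vq] c1q] <-]; rewrite /c' /= unstraightK//.
    by exists q.
- have oV : open V by exact: ball_open.
  apply: (Ck_comp oV _ (smooth_straight k l su j d)).
  + by apply: open_chart_image; exact: chart_dom_open.
  + move=> i; apply: CkS (atlas_smooth ac1 ac i d) => _ [q [c1q [cq _]] <-].
    by exists q.
  + by move=> _ [q [c1q [cq Vq]] <-]; rewrite chart_mapK.
Qed.

End StraightChart.

Section Integrability.
Context {R : realType} {n : nat} {M : manifold R n.+1}.
Implicit Types (p q : M) (X Y : vfield M).

(** A one-form acts on global fields only; decomposing X after multiplication by a bump at q gives
    its value there. *)
Lemma form_expansion c p (F : chart_frame c p) (eta : oneform M) X q :
  frame_nbhs F q ->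
  (eta X : smooth_fun M) q = \sum_i X (frame_coord F i) q *
    (eta (frame_vec F i) : smooth_fun M) q.
Proof.
move=> Fq; have [b [bq b0]] := bump_fun (frame_open F) Fq.
have e := f_equal (fun V => (eta V : smooth_fun M)) (frame_decomposition X b0).
have := f_equal (fun h => smooth_fun_val h q) e.
rewrite linearZ linear_sum /= smooth_sum smoothM bq mul1r => ->.
by apply: eq_bigr => i _; rewrite linearZ /= !smoothM bq mul1r.
Qed.

(** The components of the coordinate fields are locally constant, so the bracket kills every
    coordinate. *)
Lemma frame_bracket c p (F : chart_frame c p) i j (eta : oneform M) q :
  frame_nbhs F q ->
  (eta (lie_bracket (frame_vec F i) (frame_vec F j)) : smooth_fun M) q = 0.
Proof.
move=> Fq; rewrite (form_expansion _ _ Fq) big1// => k _.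
have z i1 j1 : frame_vec F i1 (frame_vec F j1 (frame_coord F k)) q = 0.
  rewrite (@vfield_local _ _ _ _ _ (smooth_cst M (j1 == k)%:R) _ q
    (frame_open F) Fq) ?vfield_cst//.
  by move=> q' Fq'; rewrite (frame_dual _ _ Fq').
by rewrite /= smoothD smoothN !z subrr mul0r.
Qed.

Lemma closed_form_integrable (eta : oneform M) (xi : vfield M) :
  (eta xi : smooth_fun M) = 1 -> (forall X Y, ext_deriv eta X Y = 0) ->
  completely_integrable n (ker_oneform eta).
Proof.
move=> exi closed p.
have [c ac cp] := @atlas_cover R n.+1 M p.
have [F] := chart_frame_ex ac cp.
pose O := frame_nbhs F; have oO : open O := frame_open F.
pose W := c @` (chart_dom c `&` O).
have oW : open W by exact: open_chart_image.
have Wp : W (c p) by exists p => //; split=> //; exact: frame_base.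
have Wc : W `<=` chart_im c by move=> _ [q [cq _] <-]; exists q.
have [r1 r10 r1W] := open_ballP oW Wp.
pose a i := (eta (frame_vec F i) : smooth_fun M) \o chart_inv c.
have sa i : smooth_on (ball (c p) r1) (a i).
  by apply: smooth_onS (smooth_funE _ ac) => y /r1W/Wc.
have ca i j x : ball (c p) r1 x ->
    'D_(delta_mx 0 i) (a j) x = 'D_(delta_mx 0 j) (a i) x.
  move=> /r1W[q [cq Oq] <-].
  have e i1 j1 : 'D_(delta_mx 0 i1) (a j1) (c q) =
     frame_vec F i1 (eta (frame_vec F j1)) q by rewrite (frame_vecE _ _ Oq).
  rewrite !e; have := f_equal (fun h => smooth_fun_val h q)
     (closed (frame_vec F i) (frame_vec F j)).
  rewrite /ext_deriv !(smoothD, smoothN) frame_bracket// subr0 smooth0.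
  by move/eqP; rewrite subr_eq0 => /eqP.
have [u0 su0 du0] := poincare r10 sa ca.
(* Some component of eta is nonzero at p, because eta(xi) = 1. *)
have [k ak] : exists k, a k (c p) != 0.
  apply/existsP; apply: contraT; rewrite negb_exists => /forallP a0.
  have := form_expansion eta xi (frame_base F); rewrite exi smooth1 big1.
    by move/eqP; rewrite oner_eq0.
  move=> i _; have := a0 i; rewrite negbK /a /= (chart_mapK cp) => /eqP ->.
  by rewrite mulr0.
(* The sign makes the k-th derivative of [u] positive, as straightening demands. *)
pose s : R := Num.sg (a k (c p)).
have s0 : s != 0 by rewrite sgr_eq0.
pose u y := s * u0 y.
have su1 : smooth_on (ball (c p) r1) u.
  by move=> d; apply: CkM (Ck_cst _ _ _) (su0 d); exact: ball_open.
have du1 i y : ball (c p) r1 y -> 'D_(delta_mx 0 i) u y = s * a i y.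
  move=> by_; have dd := smooth_derivable (i := i) su0 by_.
  by have [_ ->] := is_deriveZ s (DeriveDef dd erefl); rewrite du0.
have bp : ball (c p) r1 (c p) by exact: ballxx.
have ck : {for c p, continuous (fun y => s * a k y)}.
  exact: Ck_continuous (CkM (ball_open _ _) (Ck_cst 0 _ s) (sa k 0)) bp.
have pk : 0 < s * a k (c p).
  by rewrite /s -normrEsg normr_gt0.
have nk : \forall y \near c p, 0 < s * a k y by exact: (cvgr_gt _ ck) pk.
have /nbhs_ballP[r /= r0 rV] : nbhs (c p)
   [set y | ball (c p) r1 y /\ 0 < s * a k y].
  by apply: filterI => //; apply: open_nbhs_nbhs; split=> //; exact: ball_open.
have rr1 y : ball (c p) r y -> ball (c p) r1 y by move=> /rV[].
have su : smooth_on (ball (c p) r) u by apply: smooth_onS su1.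
have du y : ball (c p) r y -> 0 < 'D_(delta_mx 0 k) u y.
  by move=> /rV[b1 h]; rewrite du1.
have Vc : ball (c p) r `<=` chart_im c by move=> y /rr1/r1W/Wc.
(* [u] goes into the last slot, so that the kernel is spanned by the first n coordinate vectors. *)
have [c' [ac' dc' c'E]] := straight_chart_ex ord_max r0 ac Vc su du.
exists c'; split=> //.
  by rewrite dc'; split=> //; exact: ballxx.
(* A frame is rebuilt at each q of the chart domain, being valid only near its base point. *)
move=> q c'q; have [F'] := chart_frame_ex ac' c'q.
have [cq Vq] : chart_dom c q /\ ball (c p) r (c q) by move: c'q; rewrite dc'.
have Oq : O q.
  by have [q' [cq' Oq'] e] := r1W _ (rr1 _ Vq); rewrite -(chart_inj cq' cq e).
have F'q := frame_base F'.
(* The last coordinate of the new chart is [u], whose differential is s eta; lying in the kernel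
   thus means having no last component. *)
have last X : X (frame_coord F' ord_max) q = s * (eta X : smooth_fun M) q.
  rewrite (frame_expansion X _ Oq) (form_expansion eta X Oq) mulr_sumr.
  apply: eq_bigr => i _; rewrite mulrCA; congr (_ * _).
  rewrite (frame_vecE _ _ Oq) /coord_vector.
  pose N := frame_nbhs F' `&` chart_dom c'.
  have oN : open N by apply: openI; [exact: frame_open|exact: chart_dom_open].
  rewrite (@derive_near _ _ (c @` (chart_dom c `&` N)) _ u).
  - by rewrite du1; [rewrite /a /= (chart_mapK cq)|exact: rr1].
  - exact: open_chart_image.
  - by exists q.
  - move=> _ [q' [cq' [F'q' _]] <-] /=; rewrite (chart_mapK cq').
    by rewrite (frame_coordE _ F'q') c'E straight_l.
apply/seteqP; split=> [v [X [X0 ->]]|v [b ->]].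
  exists (fun i => X (frame_coord F' i) q); apply/funext => f.
  rewrite (frame_expansion X f F'q) big_ord_recr /= last X0 mulr0 mul0r addr0.
  rewrite [RHS]big_mkcond big_ord_recr /= ltnn addr0; apply: eq_bigr => i _.
  by rewrite ltn_ord (frame_vecE _ _ F'q).
pose X := \sum_(i < n.+1 | (i < n)%N) smooth_cst M (b i) *: frame_vec F' i.
have XE f : X f q = \sum_(i < n.+1 | (i < n)%N) b i * coord_vector c' i q f.
  rewrite /X (big_morph (fun V : vfield M => V f q) (fun V W => erefl) erefl).
  by apply: eq_bigr => i _; rewrite -(frame_vecE _ _ F'q).
exists X; split; last by apply/funext.
apply: (mulfI s0); rewrite mulr0 -last XE big1// => i iN.
rewrite -(frame_vecE _ _ F'q) (frame_dual _ _ F'q) -val_eqE /= ltn_eqF//.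
by rewrite mulr0.
Qed.

End Integrability.

Theorem mainTheorem2 (R : realType) (n : nat) (M : manifold R (n.*2.+1))
    (phi : tensor11 M) (xi : vfield M) (eta : oneform M)
    (g : riemannian_metric M) (nabla : levi_civita g)
    (hacm : almost_contact_metric phi xi eta g)
    (hnk : nearly_kenmotsu phi eta nabla)
    (H : tensor11 M)
    (hH : forall X Y : vfield M, ext_deriv eta X Y = g (H X) Y) :
  (forall X : vfield M, H X = 0) /\
  completely_integrable n.*2 (ker_oneform eta).
Proof.
split; first exact: (exact_tensor_eq0 hacm hnk hH).
exact: closed_form_integrable (acm_eta_xi hacm) (ext_deriv_eq0 hacm hnk).
Qed.
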